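(* Let $G$ be a finite solvable group and let $\chi\in\operatorname{Irr}(G)$ be a faithful character. Assume that $$\chi\overline{\chi}=1_G+m\alpha$$ for some $\alpha\in\operatorname{Irr}(G)$ and some positive integer $m$. Set $Z=\mathbf{Z}(G)$. Let $E/Z$ be a chief factor of $G$ and set $\bar G=G/E$. Then $m=1$, $\chi(1)^2=|E:Z|$, and one of the following holds: (i) $\chi(1)=2$, and $G/Z\cong A_4$ or $G/Z\cong S_4$. (ii) $\chi(1)=3$, and either $\bar G\cong \mathbf{Q}_8$ or $\bar G\cong \operatorname{SL}(2,3)$. (iii) $\chi(1)=5$ and $\bar G\cong\operatorname{SL}(2,3)$. (iv) $\chi(1)=7$ and $\bar G\cong\widetilde{\operatorname{GL}}(2,3)$. (v) $\chi(1)=9$, $\mathbf{F}(\bar G)$ is an extra-special group of order $2^5$, namely the central product of the quaternion group $\mathbf{Q}_8$ and the dihedral group of order $8$, $|\mathbf{F}_2(\bar G)/\mathbf{F}(\bar G)|=5$, and $\bar G/\mathbf{F}_2(\bar G)$ is (isomorphic to) a subgroup of the cyclic group of order $2$.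
   Context: $\operatorname{Irr}(G)$ is the set of irreducible complex characters of $G$, $1_G$ is the principal character, and $\overline{\chi}$ is the complex conjugate of $\chi$. $\mathbf{Z}(G)$ is the center of $G$. A chief factor $E/Z$ of $G$ means $Z<E$ are normal subgroups of $G$ with no normal subgroup of $G$ strictly between them. $\mathbf{F}(H)$ is the Fitting subgroup of $H$, and $\mathbf{F}_2(H)$ is the subgroup with $\mathbf{F}_2(H)/\mathbf{F}(H)=\mathbf{F}(H/\mathbf{F}(H))$. $\mathbf{Q}_8$ is the quaternion group of order $8$. $\widetilde{\operatorname{GL}}(2,3)$ is the group with presentation $$\langle x,y,z\mid x^8=1,\ y^2=x^4,\ z^3=1,\ yxy^{-1}=x^{-1},\ xzx^{-1}=x^2yz^{-1},\ zx^2z^{-1}=y\rangle .$$ *)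

(* Defs.v *)
From HB Require Import structures.
From mathcomp Require Import all_boot all_order all_algebra all_fingroup.
From mathcomp Require Import all_solvable all_field all_character.
Set Implicit Arguments.
Unset Strict Implicit.
Unset Printing Implicit Defensive.

Import GroupScope GRing.Theory.

Definition SL (n : nat) (R : finComUnitRingType) : {set {'GL_n[R]}} :=
  [set u : {'GL_n[R]} | (\det (GLval u) == 1)%R].

Lemma SL_group_set (n : nat) (R : finComUnitRingType) : group_set (SL n R).
Proof.
apply/group_setP; split=> [|u v]; first by rewrite inE GL_1E det1.
by rewrite !inE GL_ME => /eqP du /eqP dv; rewrite det_mulmx du dv mulr1.
Qed.

Canonical SL_group (n : nat) (R : finComUnitRingType) : {group {'GL_n[R]}} :=
  Group (SL_group_set n R).

(* The second term of the upper Fitting series: the preimage in H of          *)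
(* 'F(H / 'F(H)).  Since 'F(H) <| H, the preimage, which is taken in          *)
(* 'N('F(H)), lies in H.                                                      *)
Definition Fitting2 (gT : finGroupType) (H : {set gT}) : {set gT} :=
  coset 'F(H) @*^-1 'F(H / 'F(H)).

Canonical Fitting2_group (gT : finGroupType) (H : {group gT}) : {group gT} :=
  Eval hnf in [group of Fitting2 H].

(* The binary octahedral group, of order 48.  The group presented here is     *)
(* finite, so that "H \isog Grp _", which compares the finite homomorphic     *)
(* images of H with those of the presented group, does mean that H is         *)
(* isomorphic to it.                                                          *)
Definition is_GLtilde23 (gT : finGroupType) (H : {group gT}) : Prop :=
  H \isog Grp (x : y : z :
    x ^+ 8 = 1, y ^+ 2 = x ^+ 4, z ^+ 3 = 1, y * x * y^-1 = x^-1,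
    x * z * x^-1 = x ^+ 2 * y * z^-1, z * x ^+ 2 * z^-1 = y).

(* The order forces Q :&: D to have order 2, i.e., Q and D share their        *)
(* centers, so that the internal central product Q \* D is the central        *)
(* product of Q_8 and D_8 with amalgamated centers.                           *)
Definition is_extraspecial_Q8_D8 (gT : finGroupType) (H : {group gT}) : Prop :=
  [/\ extraspecial H, #|H| = 2 ^ 5 &
      exists Q D : {group gT},
        [/\ Q \isog 'Q_8, D \isog 'D_8 & Q \* D = H]]%N.

(* Main.v *)
From HB Require Import structures.
Require Import Defs.
From mathcomp Require Import all_boot all_order all_algebra all_fingroup.
From mathcomp Require Import all_solvable all_field all_character.
From mathcomp Require Import zify ring.
Set Implicit Arguments.
Unset Strict Implicit.
Unset Printing Implicit Defensive.

Import Order.TTheory GroupScope GRing.Theory Num.Theory.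

(* Since chi vanishes on D \ Z for D = 'C_G(E / Z) and its restriction to D is
   irreducible, chi(1)^2 = |D : Z| = |E : Z|, so D = E.  For e in E \ Z, the
   linear characters f |-> chi [e, f] / chi 1 are constituents of the
   restriction of alpha to E; hence m = 1 and, by Clifford's theorem, G is
   transitive on the nontrivial elements of E / Z, a space of dimension 2n over
   'F_p with p ^ n = chi(1).  Commutators induce a symplectic form on E / Z, so
   H = G / E is a solvable subgroup of Sp(2n, p) transitive on nonzero vectors.

   If n >= 2 and (p, 2n) <> (2, 6), Zsigmondy's theorem yields a prime l that
   divides p ^ 2n - 1 but no p ^ j - 1 with 0 < j < 2n.  An element x of order
   l is irreducible and centralises every abelian p'-subgroup that it
   normalises.  For some prime r, x does not centralise 'O_r(H); then
   [~: 'O_r(H), <[x]>] is extraspecial, and comparing its order with the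
   dimension gives r = 2 and l = 2n + 1, with n a power of 2.  Every odd prime
   divisor of p ^ n + 1 is therefore primitive, hence equal to 2n + 1, and has
   multiplicity one, so that p ^ n = 9.  In this last case 'O_2(H) is
   Q_8 * D_8, because x fixes only two of its elements of order at most 2, and
   H / 'O_2(H) acts faithfully on the five noncentral classes of involutions.
   If n = 1, H is a subgroup of SL(2, p) with 'O_2(H) = Q_8 or p = 3, which
   leaves p = 3, 5, 7, and G / Z is A_4 or S_4 when p = 2. *)

(** * Primitive prime divisors *)

(** The invariant form is what leaves only finitely many quotients: the semilinear group of a field
    with p ^ 2n elements is solvable and transitive for every n. Because of the form, the inverse of
    an element c commuting with an irreducible element is a Galois conjugate c ^ (p ^ i) of c, which
    bounds a cyclic centraliser by p ^ n + 1 instead of p ^ 2n - 1; transitivity then has no room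
    left. No field extension is built. If the nonidentity elements of an abelian group A fix no
    nonzero vector, the differences of distinct elements of A are invertible, so a polynomial over
    'F_p has no more roots in A than its degree, although matrices form a ring with zero divisors.
    Orders of centralisers and numbers of conjugates are bounded by counting such roots of a
    characteristic polynomial. For p = 2 and 2n = 6, the number 63 = 9 * 7 has no primitive prime
    divisor. A Hall {3, 7}-subgroup takes over: it is still transitive, and its Sylow 7-subgroup is
    normal. *)

Section CyclotomicValues.
Local Open Scope ring_scope.
Local Open Scope nat_scope.

Definition Phi_val (n a : nat) : nat := `|('Phi_n).[a%:Z]|%N.

Lemma prod_Phi_val n a : 0 < n -> 0 < a ->
  \prod_(d <- divisors n) Phi_val d a = a ^ n - 1.
Proof.
move=> n_gt0 a_gt0; have := congr1 (fun p => `|p.[a%:Z]|%N) (prod_Cyclotomic n_gt0).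
rewrite horner_prod !hornerE => E.
have <- : `|(a%:Z ^+ n - 1)%R|%N = a ^ n - 1.
  by rewrite -[a%:Z]natz -natrX natz -[(1)%R]/(1%:Z) subzn ?absz_nat // expn_gt0 a_gt0.
rewrite -E; elim: (divisors n) => [|d s IH]; first by rewrite !big_nil.
by rewrite !big_cons abszM IH.
Qed.

(** Over [algC] the value is the product of the [a - z ^+ k] over the primitive n-th roots of unity,
    each of modulus between [a - 1] and [a + 1]. *)
Lemma Phi_val_bounds n a : 1 < a ->
  (a - 1) ^ totient n <= Phi_val n a <= a.+1 ^ totient n.
Proof.
move=> a_gt1; case: (posnP n) => [->|n_gt0].
  by rewrite /Phi_val Cyclotomic0 hornerC !expn0.
have [z prim_z] := C_prim_root_exists n_gt0.
have E : ((Phi_val n a)%:R = \prod_(k < n | coprime k n) `|a%:R - z ^+ k| :> algC)%R.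
  rewrite /Phi_val natr_absz intr_norm.
  have -> : (('Phi_n).[a%:Z]%:~R = (cyclotomic z n).[a%:R] :> algC)%R.
    rewrite -(Cintr_Cyclotomic prim_z) (_ : a%:R = a%:Z%:~R)%R //.
    by rewrite horner_map.
  rewrite /cyclotomic horner_prod normr_prod; apply: eq_bigr => k _.
  by rewrite hornerXsubC.
have Et : totient n = \sum_(k < n | coprime k n) 1.
  rewrite totient_count_coprime big_mkord [RHS]big_mkcond /=.
  by apply: eq_bigr => k _; rewrite coprime_sym; case: coprime.
have nz k : (`|z ^+ k| = 1 :> algC)%R.
  have: (`|z ^+ k| ^+ n == 1 :> algC)%R.
    by rewrite -normrX -exprM mulnC exprM (prim_expr_order prim_z) expr1n normr1.
  by rewrite pexpr_eq1 ?normr_ge0 // => /eqP.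
apply/andP; split; rewrite -(ler_nat algC) E natrX Et GRing.expr_sum.
  apply: ler_prod => k _; rewrite expr1 natrB ?(ltnW a_gt1) // subr_ge0.
  rewrite ler1n (ltnW a_gt1) /=.
  by rewrite -[X in (_ - X)%R](nz k) -[X in (X - _ <= _)%R]normr_nat lerB_dist.
apply: ler_prod => k _; rewrite expr1 normr_ge0 /= -addn1 natrD.
by rewrite -[X in (_ <= _ + X)%R](nz k) -[X in (_ <= X + _)%R]normr_nat ler_normB.
Qed.

Lemma Phi_val_gt0 n a : 1 < a -> 0 < Phi_val n a.
Proof.
move=> a_gt1; have /andP[le _] := Phi_val_bounds n a_gt1.
by apply: leq_trans le; rewrite expn_gt0 subn_gt0 a_gt1.
Qed.

(** By induction on [n]: the products of both sides over the divisors of [n] agree, hence so do the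
    factors at [n]. *)
Lemma Phi_val_exp n s a : prime s -> 0 < n -> 1 < a ->
  Phi_val n (a ^ s) = Phi_val (n * s) a * (if s %| n then 1 else Phi_val n a).
Proof.
move=> pr_s; elim/ltn_ind: n => n IH n_gt0 a_gt1.
have s_gt0 := prime_gt0 pr_s.
have as_gt1 : 1 < a ^ s by rewrite -(exp1n s) ltn_exp2r.
have ns_gt0 : 0 < n * s by rewrite muln_gt0 n_gt0.
pose F d := Phi_val (d * s) a * (if s %| d then 1 else Phi_val d a).
(* Both sides are [a ^ (n * s) - 1]: a divisor of [n * s] is either [d * s] with [d %| n], or a
   divisor of [n] prime to [s]. *)
have E : \prod_(d <- divisors n) Phi_val d (a ^ s) = \prod_(d <- divisors n) F d.
  rewrite prod_Phi_val ?(ltnW as_gt1) // -expnM mulnC.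
  rewrite -prod_Phi_val ?(ltnW a_gt1) // /F big_split /=.
  rewrite -(big_map (muln^~ s) predT (fun e => Phi_val e a)).
  have -> : \prod_(d <- divisors n) (if s %| d then 1 else Phi_val d a) =
    \prod_(d <- [seq d <- divisors n | ~~ (s %| d)]) Phi_val d a.
    by rewrite big_filter [RHS]big_mkcond; apply: eq_bigr => d _; case: (s %| d).
  rewrite -big_cat.
  apply: perm_big; apply: uniq_perm; rewrite ?divisors_uniq //.
    rewrite cat_uniq map_inj_uniq ?divisors_uniq ?filter_uniq ?divisors_uniq ?andbT //=.
      apply/hasPn => d; rewrite mem_filter => /andP[sd _].
      by apply/mapP => -[e _ de]; rewrite de dvdn_mull in sd.
    by move=> x y /eqP; rewrite eqn_pmul2r // => /eqP.
  move=> e; rewrite mem_cat mem_filter -!dvdn_divisors //.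
  apply/idP/orP => [ens|[/mapP[d]|/andP[_]]]; first last.
  - by move/dvdn_mulr; apply.
  - by rewrite -dvdn_divisors // => dn ->; rewrite dvdn_pmul2r.
  case sd : (s %| e); last first.
    right; rewrite /=; move: ens; rewrite Gauss_dvdl // coprime_sym.
    by rewrite prime_coprime // sd.
  left; case/dvdnP: sd => d de; apply/mapP; exists d => //.
  by rewrite -dvdn_divisors // -(dvdn_pmul2r s_gt0) -de.
have nD : n \in divisors n by rewrite -dvdn_divisors.
rewrite !(big_rem n nD) /= in E.
have E' : \prod_(d <- rem n (divisors n)) Phi_val d (a ^ s) =
          \prod_(d <- rem n (divisors n)) F d.
  apply: eq_big_seq => d; rewrite mem_rem_uniq ?divisors_uniq // inE.
  rewrite -dvdn_divisors // => /andP[dn dvd].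
  by rewrite IH // ?(dvdn_gt0 _ dvd) // ltn_neqAle dn dvdn_leq.
apply/eqP; rewrite -(eqn_pmul2r (m := \prod_(d <- rem n (divisors n)) F d)).
  by rewrite -{1}E' E.
rewrite -E'; apply: (big_ind (fun x => 0 < x)) => // [x y|d _].
  by rewrite muln_gt0 => -> ->.
exact: Phi_val_gt0.
Qed.

Lemma Phi_val_dvd n e a : 0 < n -> 1 < a -> e %| n -> e < n ->
  Phi_val n a * (a ^ e - 1) %| a ^ n - 1.
Proof.
move=> n_gt0 a_gt1 en ltn; have e_gt0 := dvdn_gt0 n_gt0 en.
rewrite -!prod_Phi_val ?(ltnW a_gt1) //.
have nD : n \in divisors n by rewrite -dvdn_divisors.
rewrite (big_rem n nD) /= dvdn_pmul2l ?Phi_val_gt0 //.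
have -> : \prod_(d <- rem n (divisors n)) Phi_val d a =
  \prod_(d <- divisors e) Phi_val d a *
  \prod_(d <- [seq d <- rem n (divisors n) | ~~ (d %| e)]) Phi_val d a.
  rewrite -big_cat; apply: perm_big; apply: uniq_perm.
  - by rewrite rem_uniq ?divisors_uniq.
  - rewrite cat_uniq divisors_uniq filter_uniq ?rem_uniq ?divisors_uniq //= andbT.
    by apply/hasPn => d; rewrite mem_filter -dvdn_divisors // => /andP[/negbTE->].
  move=> d; rewrite mem_cat mem_filter mem_rem_uniq ?divisors_uniq // inE /=.
  rewrite -!dvdn_divisors //; case de: (d %| e) => //=.
  rewrite (dvdn_trans de en) andbT neq_ltn.
  by rewrite (leq_ltn_trans (dvdn_leq e_gt0 de) ltn).
exact: dvdn_mulr.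
Qed.

Lemma geom_mod q y s : y = 1 %[mod q] -> \sum_(i < s) y ^ i = s %[mod q].
Proof.
move=> y1; elim: s => [|s IH]; first by rewrite big_ord0.
rewrite big_ord_recr /= -modnDm IH -modnXm y1 modnXm exp1n modnDm.
by rewrite addn1.
Qed.

Lemma geom_mul y s : 0 < y -> (y - 1) * \sum_(i < s) y ^ i = y ^ s - 1.
Proof. by move=> y0; rewrite subn1 -predn_exp subn1. Qed.

(** With [y = 1 + q * t] the sum is [q + 'C(q, 2) * (q * t)] modulo [q ^ 2], and an odd [q] divides
    ['C(q, 2)]; so the sum is [q] modulo [q ^ 2]. *)
Lemma geom_not_sq q y : prime q -> odd q -> y = 1 %[mod q] ->
  ~~ (q ^ 2 %| \sum_(i < q) y ^ i).
Proof.
move=> pr_q odd_q y1; have q_gt0 := prime_gt0 pr_q.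
have q_gt2 : 2 < q by rewrite odd_prime_gt2.
have [t Dy] : exists t, y = 1 + q * t.
  have := divn_eq y q; rewrite y1 modn_small ?prime_gt1 // => ->.
  by exists (y %/ q); rewrite addnC mulnC.
have E i : y ^ i = 1 + i * (q * t) %[mod q ^ 2].
  elim: i => [|i IH]; first by rewrite expn0 mul0n.
  rewrite expnS -modnMmr IH modnMmr Dy.
  rewrite (_ : _ * _ = (i * t * t) * q ^ 2 + (1 + i.+1 * (q * t))); last by ring.
  by rewrite modnMDl.
have S n : \sum_(i < n) y ^ i = n + 'C(n, 2) * (q * t) %[mod q ^ 2].
  elim: n => [|n IH]; first by rewrite big_ord0.
  rewrite big_ord_recr /= -modnDm IH E modnDm binS bin1.
  by congr (_ %% _); ring.
rewrite /dvdn S -/(dvdn _ _) bin2odd //.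
rewrite (_ : _ + _ = q * (1 + q * (q.-1./2 * t))); last by ring.
rewrite expnS expn1 dvdn_pmul2l // dvdn_addl ?dvdn_mulr // dvdn1.
by rewrite gtn_eqF ?prime_gt1.
Qed.

Lemma dvdn_exp_sub1_gcd q a x y : 0 < a -> 0 < x ->
  q %| a ^ x - 1 -> q %| a ^ y - 1 -> q %| a ^ gcdn x y - 1.
Proof.
move=> a_gt0 x_gt0.
have one m : (q %| a ^ m - 1) = (a ^ m == 1 %[mod q]).
  by rewrite -eqn_mod_dvd // expn_gt0 a_gt0.
rewrite !one => /eqP ax /eqP ay.
case: (egcdnP y x_gt0) => u v uv _.
apply/eqP; have : a ^ (u * x) = 1 %[mod q] by rewrite mulnC expnM -modnXm ax modnXm exp1n.
rewrite uv expnD -modnMml mulnC [v * y]mulnC expnM -modnXm ay modnXm exp1n.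
by rewrite modnMmr muln1.
Qed.

(** With [e] the gcd of [j], [n] and [q - 1], [q] divides [a ^ e - 1]. For a prime [s] dividing
    [n / e], [Phi_val n a] divides the sum of the first [s] powers of [a ^ (n / s)], which is [s]
    modulo [q]; hence [s = q]. A prime divisor of [e] divides [q - 1], so it is smaller than [q]. *)
Lemma Phi_val_nonprimitive n a q j : 2 < n -> 1 < a -> prime q ->
    q %| Phi_val n a -> 0 < j < n -> q %| a ^ j - 1 ->
  [/\ q %| n, ~~ (q ^ 2 %| Phi_val n a)
    & forall r, prime r -> r %| n -> r <= q].
Proof.
move=> n_gt2 a_gt1 pr_q qP /andP[j_gt0 ltjn] qj.
have n_gt0 : 0 < n by apply: leq_trans n_gt2.
have a_gt0 := ltnW a_gt1.
have one m : (q %| a ^ m - 1) = (a ^ m == 1 %[mod q]).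
  by rewrite -eqn_mod_dvd // expn_gt0 a_gt0.
have qn : q %| a ^ n - 1.
  rewrite -prod_Phi_val // (big_rem n) ?dvdn_mulr //=.
  by rewrite -dvdn_divisors.
have coqa : coprime q a.
  rewrite prime_coprime //; apply/negP => qa.
  have: q %| a ^ n by rewrite dvdn_exp.
  have : a ^ n = (a ^ n - 1) + 1 by rewrite subnK // expn_gt0 a_gt0.
  move=> ->; rewrite dvdn_addr // dvdn1 => /eqP q1.
  by rewrite q1 in pr_q.
have gcdE x y := @dvdn_exp_sub1_gcd q a x y a_gt0.
have fermat : q %| a ^ q.-1 - 1.
  rewrite one; apply/eqP; rewrite -(totient_prime pr_q).
  by apply: Euler_exp_totient; rewrite coprime_sym.
pose e := gcdn (gcdn j n) q.-1.
have q1_gt0 : 0 < q.-1 by have := prime_gt1 pr_q; case: (q) => [|[]].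
have e_gt0 : 0 < e by rewrite gcdn_gt0 q1_gt0 orbT.
have qe : q %| a ^ e - 1 by rewrite !gcdE // gcdn_gt0 j_gt0.
have e_n : e %| n by rewrite (dvdn_trans (dvdn_gcdl _ _)) ?dvdn_gcdr.
have e_q : e %| q.-1 by rewrite dvdn_gcdr.
have lte : e < n.
  apply: leq_ltn_trans ltjn; apply: dvdn_leq => //.
  by rewrite (dvdn_trans (dvdn_gcdl _ _)) ?dvdn_gcdl.
have key s : prime s -> s %| n %/ e ->
  [/\ s = q, a ^ (n %/ s) = 1 %[mod q] & Phi_val n a %| \sum_(i < s) (a ^ (n %/ s)) ^ i].
  move=> pr_s s_ne.
  have sn : s %| n by apply: dvdn_trans s_ne _; rewrite dvdn_div //.
  have e_ns : e %| n %/ s.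
    have /dvdnP[t Dt] := s_ne.
    have Dn : n = t * s * e by rewrite -Dt divnK.
    by rewrite Dn -mulnA [s * e]mulnC mulnA mulnK ?prime_gt0 // dvdn_mull.
  have ns_gt0 : 0 < n %/ s by rewrite divn_gt0 ?prime_gt0 // dvdn_leq.
  have y1 : a ^ (n %/ s) = 1 %[mod q].
    case/dvdnP: e_ns => t ->; rewrite mulnC expnM -modnXm.
    by move: qe; rewrite one => /eqP ->; rewrite modnXm exp1n.
  have Pd : Phi_val n a %| \sum_(i < s) (a ^ (n %/ s)) ^ i.
    have := @Phi_val_dvd n (n %/ s) a n_gt0 a_gt1.
    rewrite dvdn_div // => /(_ isT); rewrite ltn_Pdiv ?prime_gt1 // => /(_ isT).
    have -> : a ^ n = (a ^ (n %/ s)) ^ s by rewrite -expnM divnK.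
    rewrite -[X in _ %| X]geom_mul ?expn_gt0 ?a_gt0 // mulnC dvdn_pmul2l //.
    by rewrite subn_gt0 -{1}(exp1n (n %/ s)) ltn_exp2r.
  split=> //; have: q %| s.
    by rewrite /dvdn -(geom_mod _ y1) -/(dvdn _ _) (dvdn_trans qP).
  by rewrite dvdn_prime2 // => /eqP.
have ne_gt1 : 1 < n %/ e by rewrite ltn_divRL // mul1n.
have [Dq y1 Pd] := key _ (pdiv_prime ne_gt1) (pdiv_dvd _).
rewrite Dq in y1 Pd.
have q_ne : q %| n %/ e by rewrite -Dq pdiv_dvd.
have q_n : q %| n by apply: dvdn_trans q_ne _; rewrite dvdn_div //.
split=> //.
  case: (boolP (odd q)) => [odd_q|].
    apply/negP => /dvdn_trans/(_ Pd); apply/negP; exact: geom_not_sq.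
  (* For [q = 2], [e] is 1, so [n] is a power of 2 divisible by 4, and [Phi_val n a] divides
     [a ^ (n / 2) + 1], an odd square plus 1, which is 2 modulo 4. *)
  case/(prime_oddPn pr_q)=> q2.
  have e1 : e = 1 by apply/eqP; rewrite -dvdn1; move: e_q; rewrite q2.
  have n4 : 4 %| n.
    have n_pow : n = 2 ^ logn 2 n.
      rewrite -p_part; apply/esym/part_pnat_id.
      apply/pnatP => // s pr_s sn; rewrite e1 divn1 in key.
      by have [-> _ _] := key s pr_s sn; rewrite q2.
    move: n_gt2; rewrite n_pow; case: (logn 2 n) => [|[|k]] // _.
    by rewrite !expnS mulnA dvdn_mulr.
  apply/negP => /dvdn_trans/(_ Pd); rewrite q2 !big_ord_recr big_ord0 /= expn0 expn1.
  case/dvdnP: n4 => k ->; rewrite (_ : k * 4 = k * 2 * 2); last by ring.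
  rewrite mulnK // expnM.
  have: odd a by rewrite q2 in coqa; rewrite -coprime2n.
  move=> odd_a; have : odd (a ^ k) by rewrite oddX odd_a orbT.
  move: (a ^ k) => y odd_y; rewrite -(odd_double_half y) odd_y -muln2.
  rewrite (_ : 0 + 1 + _ = (y./2 + y./2 ^ 2) * 4 + 2); last by rewrite -[nat_of_bool true]/1; ring.
  by rewrite /dvdn modnMDl.
move=> r pr_r rn; case: (leqP r q) => // ltqr.
have : r %| (n %/ e) * e by rewrite divnK.
rewrite Euclid_dvdM // => /orP[/(key r pr_r)[rq _ _]|re]; first by rewrite rq ltnn in ltqr.
have := dvdn_leq q1_gt0 (dvdn_trans re e_q).
by rewrite leqNgt; case: (q) ltqr pr_q => // q' /ltnW -> _.
Qed.

Definition primitive_prime a n l :=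
  [/\ prime l, l %| a ^ n - 1 & forall j, 0 < j < n -> ~~ (l %| a ^ j - 1)].

Lemma totient_ge_prime q n : 0 < n -> prime q -> q %| n -> q.-1 <= totient n.
Proof.
move=> n_gt0 pr_q qn.
have [k [co ->]] : exists k, coprime q k /\ n = q ^ (logn q n) * k.
  exists (n`_q^'); split; last by rewrite -p_part partnC.
  rewrite prime_coprime //; apply/negP => qd.
  have := pnatP _ (part_gt0 q^' n) (part_pnat q^' n).
  by move/(_ q pr_q qd); rewrite !inE eqxx.
have lq : 0 < logn q n by rewrite logn_gt0 mem_primes pr_q n_gt0.
rewrite totient_coprime ?coprimeXl // totient_pfactor //.
have k0 : 0 < k by rewrite lt0n;
  apply: contraL co => /eqP->; rewrite /coprime gcdn0; have := prime_gt1 pr_q; case: (q) => [|[]].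
rewrite -mulnA leq_pmulr // muln_gt0 expn_gt0 prime_gt0 //=.
by rewrite totient_gt0.
Qed.

(** For [a = 2] the general lower bound is only 1. With [n = M * s], [Phi_val_exp] gives at least
    [(2 ^ s - 1) ^ totient M] divided by [3 ^ totient M]. This exceeds [s] if [s > 3]; for [s = 3]
    it needs [totient M > 1], which fails only for [n = 3] and [n = 6]. *)
Lemma Phi_val2_gt s n : prime s -> odd s -> s %| n -> 3 < n -> n != 6 ->
  s < Phi_val n 2.
Proof.
move=> pr_s odd_s /dvdnP[M DM] n_gt3 n6.
have s_gt2 : 2 < s by rewrite odd_prime_gt2.
have M_gt0 : 0 < M by case: M DM => // Dn; rewrite Dn in n_gt3.
have tM : 0 < totient M by rewrite totient_gt0.
have ts_gt1 : 1 < 2 ^ s by rewrite -(expn0 2) ltn_exp2l // prime_gt0.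
have /andP[lo _] := Phi_val_bounds M ts_gt1.
have /andP[_ hi] := Phi_val_bounds M (isT : 1 < 2).
have le : (2 ^ s - 1) ^ totient M <= Phi_val n 2 * 3 ^ totient M.
  apply: leq_trans lo _; rewrite Phi_val_exp // -DM leq_mul2l.
  case: ifP => _; last by rewrite hi orbT.
  by rewrite expn_gt0 orbT.
have gt3 k : 0 < k -> 0 < 3 ^ k by rewrite expn_gt0.
case: (ltnP 3 s) => [s3|].
  have big : 3 * s < 2 ^ s - 1.
    have : 4 < s by move: s3; rewrite leq_eqVlt => /orP[/eqP s4|//]; rewrite -s4 in odd_s.
    clear; elim: {s}(s) => // k IH; rewrite ltnS leq_eqVlt => /orP[/eqP <- //|].
    move=> k4; have := IH k4; rewrite expnS; move: (2 ^ k) => x le_x; lia.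
  rewrite -(ltn_pmul2r (gt3 _ tM)); apply: leq_trans le.
  apply: leq_ltn_trans (_ : (3 * s) ^ totient M < _); last by rewrite ltn_exp2r.
  rewrite expnMn mulnC leq_mul2l -{1}(expn1 s) leq_pexp2l ?orbT //.
  exact: prime_gt0.
move=> s3; have {}s3 : s = 3 by apply/eqP; rewrite eqn_leq s3.
rewrite s3 in le DM *; rewrite -[2 ^ 3 - 1]/7 in le.
have t2 : 1 < totient M.
  by rewrite totient_gt1; case: M DM n_gt3 n6 {M_gt0 tM lo hi le} => [|[|[|M]]] // ->.
rewrite -(ltn_pmul2r (gt3 _ tM)); apply: leq_trans le.
rewrite -expnS; case: (totient M) t2 => [|[|k]] // _.
rewrite !expnS; elim: k => // k IH; rewrite !expnS; lia.
Qed.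

(* Without a primitive prime, ['Phi_n(p)] would be a prime divisor of [n];
   but ['Phi_n(p)] is too large for that. *)
Lemma Zsigmondy p n : prime p -> 3 < n -> ~~ ((p == 2) && (n == 6)) ->
  exists l, primitive_prime p n l.
Proof.
move=> pr_p n_gt3 exc; have p_gt1 := prime_gt1 pr_p.
have n_gt2 := ltnW n_gt3.
have n_gt0 : 0 < n by apply: leq_trans n_gt2.
set P := Phi_val n p.
have P_gt0 : 0 < P := Phi_val_gt0 n p_gt1.
have Pn : P %| p ^ n - 1.
  rewrite -(prod_Phi_val n_gt0 (ltnW p_gt1)).
  have nD : n \in divisors n by rewrite -dvdn_divisors.
  by rewrite (big_rem n nD) dvdn_mulr.
case: (boolP (has (fun q => all (fun j => ~~ (q %| p ^ j - 1)) (iota 1 n.-1)) (primes P))).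
  case/hasP => q; rewrite mem_primes => /and3P[pr_q _ qP] /allP Hq.
  exists q; split=> //; first exact: dvdn_trans Pn.
  by move=> j /andP[j0 jn]; apply: Hq; rewrite mem_iota j0 add1n prednK.
move/hasPn => noprim.
have nonprim q : prime q -> q %| P -> exists2 j, 0 < j < n & q %| p ^ j - 1.
  move=> pr_q qP; have := noprim q; rewrite mem_primes pr_q P_gt0 qP => /(_ isT).
  case/allPn => j; rewrite mem_iota add1n prednK // negbK => jn qj.
  by exists j.
have tn_gt1 : 1 < totient n by rewrite totient_gt1.
have Plo : odd p -> 2 ^ totient n <= P.
  move=> odd_p; have /andP[lo _] := Phi_val_bounds n p_gt1.
  apply: leq_trans lo; rewrite leq_exp2r ?(ltnW tn_gt1) //.
  by move: p_gt1 odd_p; case: (p) => [|[|[|k]]] // _ _; rewrite subn1.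
have big q : prime q -> q %| n -> odd q || odd p -> q < P.
  move=> pr_q qn; have tq := totient_ge_prime n_gt0 pr_q qn.
  case: (even_prime pr_p) => [p2|odd_p].
    rewrite p2 orbF => odd_q; rewrite /P p2; rewrite p2 /= in exc.
    exact: Phi_val2_gt.
  move=> _; apply: leq_trans (Plo odd_p).
  case: (ltnP 3 q) => [q4|q3].
    apply: (@leq_trans (2 ^ q.-1)); last by rewrite leq_exp2l.
    case: q q4 {pr_q qn tq} => // k /=; elim: k => // k IH.
    by rewrite ltnS leq_eqVlt => /orP[/eqP <- //|/IH]; rewrite expnS; lia.
  by apply: leq_ltn_trans q3 _; rewrite (@leq_exp2l 2 2).
have Pn1 : 1 < P.
  case: (even_prime pr_p) => [p2|odd_p]; last first.
    by apply: leq_trans (Plo odd_p); rewrite (@leq_exp2l 2 1) // ltnW.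
  (* If [n] is a power of 2, the value of index [n] at 2 is the value of index [n / 2] at 4, hence
     at least a power of 3. *)
  case: (boolP (2.-nat n)) => [n2|].
    have Dn : n = n %/ 2 * 2.
      rewrite divnK //; move/p_natP: n2 n_gt2 => [[|k] ->] // _.
      by rewrite expnS dvdn_mulr.
    have m_gt0 : 0 < n %/ 2 by rewrite divn_gt0 // ltnW.
    have /andP[lo _] := Phi_val_bounds (n %/ 2) (isT : 1 < 4).
    have := @Phi_val_exp (n %/ 2) 2 2 isT m_gt0 isT; rewrite -Dn.
    have -> : 2 %| n %/ 2.
      move/p_natP: n2 n_gt3 => [k ->]; case: k => [|[|k]] // _.
      by rewrite !expnS mulKn // dvdn_mulr.
    rewrite muln1 /P p2 -[2 ^ 2]/4 => <-; apply: leq_trans lo.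
    by rewrite -(expn0 3) ltn_exp2l // totient_gt0.
  rewrite /pnat n_gt0 => /allPn[s]; rewrite mem_primes inE => /and3P[pr_s _ sn] s2.
  have odd_s : odd s by case: (even_prime pr_s) => [s2'|//]; rewrite s2' in s2.
  by apply: leq_ltn_trans (prime_gt0 pr_s) _; apply: big; rewrite ?odd_s.
set q := pdiv P; have pr_q : prime q := pdiv_prime Pn1.
have qP : q %| P := pdiv_dvd P.
have [j jn qj] := nonprim q pr_q qP.
have [qn q2P maxq] := Phi_val_nonprimitive n_gt2 p_gt1 pr_q qP jn qj.
have Pq : q.-nat P.
  apply/pnatP => // r pr_r rP; have [i iin ri] := nonprim r pr_r rP.
  have [rn _ maxr] := Phi_val_nonprimitive n_gt2 p_gt1 pr_r rP iin ri.
  by rewrite inE eqn_leq maxq ?maxr.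
have : P <= q.
  have -> : P = q ^ logn q P by rewrite -p_part part_pnat_id.
  rewrite -[X in _ <= X]expn1 leq_exp2l ?prime_gt1 //.
  by rewrite leqNgt -pfactor_dvdn.
rewrite leqNgt big //; case: (even_prime pr_p) => [p2|->]; last by rewrite orbT.
have : q %| 2 ^ n - 1 by rewrite -p2 (dvdn_trans qP).
case: (even_prime pr_q) => [->|-> //].
by rewrite dvdn2 oddB ?expn_gt0 // oddX gtn_eqF.
Qed.

End CyclotomicValues.

(** Otherwise some normal subgroup [K0] of [G] inside [C] is nontrivial and abelian modulo [Z]. As
    [Z] is central in [K0], [K0] is nilpotent, so it lies in ['F(G)], hence in [Z]. *)
Lemma sub_cent_Fitting (gT : finGroupType) (G : {group gT}) :
  solvable G -> 'C_G('F(G)) \subset 'F(G).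
Proof.
move=> solG; set C := 'C_G('F(G)); set Z := C :&: 'F(G).
have nsCG : C <| G.
  by rewrite /normal subsetIl /= normsI ?normG // norms_cent // gFnorm.
have nsZG : Z <| G by rewrite normalI // gFnormal.
have [sZG nZG] := andP nsZG.
have sZC : Z \subset C := subsetIl _ _.
apply/setIidPl; apply/eqP; rewrite eqEsubset subsetIl /=.
have nZC : C \subset 'N(Z) := subset_trans (normal_sub nsCG) nZG.
rewrite -quotient_sub1 // subG1; apply/negPn/negP => ntC.
have solC : solvable (C / Z) by rewrite quotient_sol // (solvableS _ solG) ?normal_sub.
have nsCbar : C / Z <| G / Z by rewrite quotient_normal.
have [K [sK nsK ntK abK]] := solvable_norm_abelem solC nsCbar ntC.
have [K0 [DK sZK0 nsK0]] := inv_quotientN nsZG nsK.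
have sK0C : K0 \subset C.
  by rewrite -(quotientSGK _ sZC) -?DK // (subset_trans (normal_sub nsK0)).
have cZK0 : Z \subset 'Z(K0).
  rewrite subsetI sZK0 /= centsC (subset_trans sK0C) //.
  by rewrite (subset_trans (subsetIr _ _)) // centS // subsetIr.
have abKZ : abelian (K0 / Z) by rewrite -DK (abelem_abelian abK) || (case/is_abelemP: abK => q _ /abelem_abelian).
have nilK0 : nilpotent K0.
  rewrite -quotient_center_nil abelian_nil // sub_der1_abelian //.
  by apply: subset_trans cZK0; rewrite der1_min // (subset_trans sK0C).
case/negP: ntK; rewrite -subG1 DK quotient_sub1; last exact: subset_trans sK0C nZC.
by rewrite subsetI sK0C Fitting_max.
Qed.

(** * Powers of p modulo a primitive prime divisor *)

Section PrimitivePrime.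
Variables (p n' l : nat).
Local Notation N := n'.+1.
Hypotheses (pr_p : prime p) (pl : primitive_prime p N l).

Lemma prim_prime : prime l. Proof. by case: pl. Qed.

Lemma prim_coprime : coprime l p.
Proof.
rewrite prime_coprime ?prim_prime //; have [pr_l lN _] := pl.
apply/negP => /(dvdn_exp (ltn0Sn n')).
rewrite -[X in (_ %| X)%N](subnK (_ : 0 < _)%N) ?expn_gt0 ?prime_gt0 //.
by rewrite dvdn_addr // dvdn1 => /eqP l1; rewrite l1 in pr_l.
Qed.

Lemma prim_gtN : (N < l)%N.
Proof.
have [pr_l lN notl] := pl; have l_gt1 := prime_gt1 pr_l.
have l1_gt0 : (0 < l.-1)%N by case: (l) l_gt1 => [|[]].
rewrite -(prednK (ltnW l_gt1)) ltnS leqNgt; apply/negP => ltl.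
suff: ~~ (l %| p ^ l.-1 - 1)%N.
  apply/negP/negPn.
  rewrite -eqn_mod_dvd ?expn_gt0 ?prime_gt0 // -(totient_prime pr_l).
  by rewrite Euler_exp_totient // coprime_sym prim_coprime.
by apply: notl; rewrite l1_gt0.
Qed.

(** [p] has order exactly [N] modulo [l]. Orders of modules and of their fixed spaces are powers of
    [p], and are compared modulo [l] in this way. *)
Lemma prim_eq_mod (i j : nat) : (i <= j <= N)%N -> (p ^ j = p ^ i %[mod l])%N -> i = j \/ (i = 0%N /\ j = N).
Proof.
case/andP=> ij jN /eqP; rewrite eqn_mod_dvd ?leq_exp2l ?prime_gt1 //.
rewrite -{1}(subnK ij) expnD -[X in (_ - X)%N]mul1n -mulnBl Gauss_dvdl; last first.
  by rewrite coprimeXr // prim_coprime.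
have [_ _ notl] := pl => dl.
case: (posnP (j - i)%N) => [ji|ji_gt0].
  by left; apply/eqP; rewrite eqn_leq ij -subn_eq0 ji.
case: (ltnP (j - i)%N N) => [lt|ge]; first by rewrite (negPf (notl _ _)) ?ji_gt0 in dl.
right; have : (j - i <= j)%N by apply: leq_subr.
lia.
Qed.

End PrimitivePrime.

(** * Elements of primitive prime order in linear groups *)

Section FaithfulModule.
Local Open Scope ring_scope.
Variables (p n' : nat).
Local Notation N := n'.+1.
Variables (hT : finGroupType) (H : {group hT}) (rH : mx_representation 'F_p H N).
Hypotheses (pr_p : prime p) (ffulH : mx_faithful rH).

Definition irr_elt (x : hT) := forall U : 'M['F_p]_N,
  (U *m rH x <= U)%MS -> U != 0%R -> row_full U.

(** Nonidentity elements of [A] fix no nonzero vector. When [A] is abelian, the invertible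
    differences make it cyclic and bound the number of roots of a polynomial in it. *)
Definition mxfree (A : {set hT}) := forall a, a \in A -> a != 1%g -> (rH a - 1%:M)%R \in unitmx.

Lemma rH_inj : {in H &, injective rH}. Proof. exact: mx_faithful_inj ffulH. Qed.

Lemma unitmx_ker n (A : 'M['F_p]_n) : kermx A = 0%R -> A \in unitmx.
Proof. by move=> kA; rewrite -row_free_unit -kermx_eq0 kA eqxx. Qed.

Lemma irr_cent_unit x c : x \in H -> irr_elt x -> comm_mx c (rH x) -> c != 0%R -> c \in unitmx.
Proof.
move=> Hx irr cx nz; apply: unitmx_ker; apply: contraNeq nz => nzk.
have st : (kermx c *m rH x <= kermx c)%MS.
  by rewrite sub_kermx -mulmxA -cx mulmxA mulmx_ker mul0mx.
have := mulmx_ker c; have /row_fullP[B BK] := irr _ st nzk.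
by move/(congr1 (mulmx B)); rewrite mulmxA BK mul1mx mulmx0 => ->.
Qed.

Lemma module_fix_mod (l : nat) (X : {group hT}) (U : 'M['F_p]_N) :
  X \subset H -> l.-group X -> (forall x, x \in X -> (U *m rH x <= U)%MS) ->
  (p ^ \rank U = p ^ \rank (U :&: rfix_mx rH X)%MS %[mod l])%N.
Proof.
move=> sXH lX modU.
have mU : mxmodule (subg_repr rH sXH) U by apply/mxmoduleP.
have aU : [acts X, on rowg U | 'MR (subg_repr rH sXH)] by rewrite acts_rowg.
have := pgroup_fix_mod lX aU.
rewrite [X in _ = X %[mod _]](_ : _ = #|rowg (U :&: rfix_mx rH X)%MS|); last first.
  by apply: eq_card => v; rewrite inE afix_repr // !inE sub_capmx.
by rewrite !card_rowg card_Fp.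
Qed.

Section PrimitiveElement.
Variables (l : nat) (x : hT).
Hypotheses (pl : primitive_prime p N l) (Hx : x \in H) (ox : #[x] = l).

(** The fixed space of [x] has rank 0 or [N] by [prim_eq_mod], and not [N] as [rH] is faithful. A
    stable [U] then has order 1 modulo [l], so its rank is 0 or [N] too. *)
Lemma prim_irr : irr_elt x.
Proof.
have sXH : <[x]> \subset H by rewrite cycle_subG.
have lX : l.-group <[x]> by rewrite /pgroup -orderE ox pnat_id ?(prim_prime pl).
have fix0 : \rank (rfix_mx rH <[x]>) = 0%N.
  have := @module_fix_mod l <[x]> 1%:M sXH lX.
  have m1 y : y \in <[x]> -> (1%:M *m rH y <= 1%:M)%MS by rewrite submx1.
  move/(_ m1); rewrite mxrank1 (cap1mx (rfix_mx rH <[x]>)) => E.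
  have := @prim_eq_mod p n' l pr_p pl (\rank (rfix_mx rH <[x]>)) N _ E.
  rewrite rank_leq_row leqnn => /(_ isT) [fN|[] //].
  have rf : row_full (rfix_mx rH <[x]>) by rewrite /row_full fN.
  have : rH x = rH 1%g.
    by have /rfix_mxP/(_ x (cycle_id x)) := submx_full 1%:M rf; rewrite mul1mx repr_mx1.
  move/(rH_inj Hx (group1 _)) => x1; have := prime_gt1 (prim_prime pl).
  by rewrite -ox x1 order1.
move=> U st nzU.
have mU y : y \in <[x]> -> (U *m rH y <= U)%MS.
  case/cycleP=> i ->; elim: i => [|i IH]; first by rewrite repr_mx1 mulmx1.
  rewrite expgSr repr_mxM ?groupX // mulmxA.
  by apply: submx_trans (submxMr _ IH) st.
have := module_fix_mod sXH lX mU.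
have -> : \rank (U :&: rfix_mx rH <[x]>)%MS = 0%N.
  by apply/eqP; rewrite -leqn0 -fix0 mxrankS // capmxSr.
move/(prim_eq_mod pr_p pl); rewrite rank_leq_row => /(_ isT)[/esym/eqP|[_ rU]].
  by rewrite mxrank_eq0 (negPf nzU).
by rewrite /row_full rU.
Qed.
End PrimitiveElement.

Lemma rfix_join (B C : {group hT}) m (v : 'M_(m, N)) : B \subset H -> C \subset H ->
  (v <= rfix_mx rH B)%MS -> (v <= rfix_mx rH C)%MS -> (v <= rfix_mx rH (B <*> C))%MS.
Proof.
move=> sB sC vB vC; rewrite -rfix_mx_rstabC; last by rewrite join_subG sB.
by rewrite join_subG (rfix_mx_rstabC _ _ sB) vB (rfix_mx_rstabC _ _ sC).
Qed.

Lemma rfix_eq0_trivial (B : {group hT}) : B \subset H -> row_full (rfix_mx rH B) -> B :=: 1%g.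
Proof.
move=> sBH rf; apply/trivgP/subsetP => b Bb; rewrite inE.
have : rH b = rH 1%g.
  by have /rfix_mxP/(_ b Bb) := submx_full 1%:M rf; rewrite mul1mx repr_mx1.
by move/(rH_inj (subsetP sBH _ Bb) (group1 _)) => ->.
Qed.

(** Maschke's projector onto the fixed space of [C], meant for groups of order prime to [p];
    otherwise the scalar is the inverse of 0, that is 0. *)
Definition avg (C : {set hT}) : 'M['F_p]_N := (#|C|%:R)^-1 *: \sum_(c in C) rH c.

Lemma avg_fix (C : {group hT}) m (v : 'M_(m, N)) : p^'.-group C ->
  (v <= rfix_mx rH C)%MS -> v *m avg C = v.
Proof.
move=> p'C /rfix_mxP fixv.
rewrite /avg -scalemxAr mulmx_sumr (eq_bigr (fun=> v)) => [|c Cc]; last exact: fixv.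
rewrite sumr_const -scaler_nat scalerA mulVf ?scale1r //.
by rewrite -(dvdn_pcharf (pchar_Fp pr_p)) -(p'natE _ pr_p).
Qed.

Lemma avg_in (C : {group hT}) m (v : 'M_(m, N)) : C \subset H -> (v *m avg C <= rfix_mx rH C)%MS.
Proof.
move=> sCH; apply/rfix_mxP => c Cc; rewrite /avg -mulmxA; congr (_ *m _).
rewrite -scalemxAl mulmx_suml; congr (_ *: _).
rewrite [RHS](reindex_inj (mulIg c)) /=; apply: eq_big => [b|b Cb].
  by rewrite groupMr.
by rewrite repr_mxM // (subsetP sCH).
Qed.

Lemma avg_comm (A C : {group hT}) a : abelian A -> A \subset H -> C \subset A -> a \in A ->
  avg C *m rH a = rH a *m avg C.
Proof.
move=> cAA sAH sCA Aa; rewrite /avg -scalemxAl -scalemxAr mulmx_suml mulmx_sumr.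
congr (_ *: _); apply: eq_bigr => c Cc; have Ac := subsetP sCA _ Cc.
by rewrite -!repr_mxM ?(subsetP sAH) // (centsP cAA).
Qed.

(** Since [A] is abelian, [v *m avg C] is still fixed by [B]; it is also fixed by [C]. *)
Lemma avg_orth (A B C : {group hT}) m (v : 'M_(m, N)) : abelian A -> A \subset H -> B \subset A ->
  C \subset A -> rfix_mx rH (B <*> C) = 0 -> (v <= rfix_mx rH B)%MS -> v *m avg C = 0.
Proof.
move=> cAA sAH sBA sCA fix0 /rfix_mxP fixv; apply/eqP; rewrite -submx0 -fix0.
apply: rfix_join; rewrite ?(subset_trans _ sAH) //; last by apply: avg_in; apply: subset_trans sAH.
apply/rfix_mxP => b Bb; have Ab := subsetP sBA _ Bb.
by rewrite -mulmxA (avg_comm cAA) // mulmxA fixv.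
Qed.

Section AbelianSub.
Variable A : {group hT}.
Hypotheses (sAH : A \subset H) (cAA : abelian A) (p'A : p^'.-group A).

Definition maxfix := maxgroup^~ [pred B : {group hT} | (B \subset A) && (rfix_mx rH B != 0)].

Lemma maxfix_exists a : a \in A -> (rH a - 1%:M \in unitmx) = false ->
  exists2 B : {group hT}, maxfix B & a \in B.
Proof.
move=> Aa nunit; have Ha := subsetP sAH _ Aa.
have nzf : rfix_mx rH <[a]> != 0.
  apply: contraFneq nunit => fix0; apply: unitmx_ker; apply/eqP; rewrite -submx0 -fix0.
  have ka : kermx (rH a - 1%:M) *m rH a = kermx (rH a - 1%:M).
    by apply/eqP; rewrite -subr_eq0 -[X in _ - X]mulmx1 -mulmxBr mulmx_ker.
  apply/rfix_mxP => _ /cycleP[i ->]; elim: i => [|i IH]; first by rewrite repr_mx1 mulmx1.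
  by rewrite expgSr repr_mxM ?groupX // mulmxA IH.
have [|B maxB sB] := @maxgroup_exists _ [pred B : {group hT} | (B \subset A) && (rfix_mx rH B != 0)] <[a]>%G.
  by rewrite /= nzf cycle_subG Aa.
by exists B; rewrite // -cycle_subG.
Qed.

Lemma maxfix_conj (B : {group hT}) h : maxfix B -> h \in H -> h \in 'N(A) -> maxfix (B :^ h)%G.
Proof.
move=> /maxgroupP[/= /andP[sBA nzB] maxB] Hh nAh; apply/maxgroupP => /=.
have conjfix (C : {group hT}) y : C \subset H -> y \in H -> rfix_mx rH C != 0 -> rfix_mx rH (C :^ y) != 0.
  move=> sCH Hy; apply: contraNneq => fix0; have E := rfix_mx_conjsg rH Hy sCH.
  have : (rfix_mx rH C *m rH y <= (0 : 'M_N))%MS by rewrite -E fix0.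
  by rewrite submx0 => /eqP E0; rewrite -[rfix_mx _ _](repr_mxK rH Hy) E0 mul0mx.
have sBH := subset_trans sBA sAH.
split; first by rewrite conjfix // -(normP nAh) conjSg sBA.
move=> C /andP[sCA nzC] sBC; have sCH := subset_trans sCA sAH.
have := maxB (C :^ h^-1)%G; rewrite /= conjfix ?groupV // andbT.
rewrite sub_conjgV (normP nAh) => /(_ sCA); rewrite -sub_conjg => /(_ sBC) <-.
by rewrite conjsgKV.
Qed.

(** A nonzero vector fixed by both groups would let [B <*> C] contradict their maximality. *)
Lemma maxfix_orth (B C : {group hT}) m (v : 'M_(m, N)) : maxfix B -> maxfix C -> B :!=: C ->
  (v <= rfix_mx rH B)%MS -> v *m avg C = 0.
Proof.
move=> /maxgroupP[/= /andP[sBA _] maxB] /maxgroupP[/= /andP[sCA _] maxC] neqBC.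
have fix0 : rfix_mx rH (B <*> C) = 0.
  apply/eqP/contraT => nz; case/eqP: neqBC.
  have sJ : B <*> C \subset A by rewrite join_subG sBA.
  have := maxB (B <*> C)%G; have := maxC (B <*> C)%G.
  by rewrite /= sJ nz joing_subl joing_subr => /(_ isT isT) -> /(_ isT isT) <-.
by move=> vB; apply: (avg_orth cAA sAH sBA sCA fix0 vB).
Qed.

Lemma maxfix_avg (B : {group hT}) m (v : 'M_(m, N)) : maxfix B -> (v <= rfix_mx rH B)%MS -> v *m avg B = v.
Proof. by case/maxgroupP=> /= /andP[sBA _] _; apply: avg_fix; apply: pgroupS p'A. Qed.

(* Let [B] be a maximal subgroup of [A] with nonzero fixed space.  If [x]
   normalises [B], that space is everything.  Otherwise the averages over the
   [l > N] conjugates of [B] are orthogonal idempotents. *)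
Lemma free_of_irr l x : x \in H -> x \in 'N(A) -> irr_elt x -> prime l -> #[x] = l -> (N < l)%N -> mxfree A.
Proof.
move=> Hx nAx irr pr_l ox ltNl a Aa nt_a; apply: contraT => /negbTE nunit.
have [B maxB Ba] := maxfix_exists Aa nunit.
have [/= /andP[sBA nzB] _] := maxgroupP maxB; have sBH := subset_trans sBA sAH.
have nBx : x \notin 'N(B).
  apply: contra nt_a => nBx; have := norm_sub_rstabs_rfix_mx rH sBH.
  move/subsetP/(_ x); rewrite inE Hx nBx => /(_ isT); rewrite inE Hx /= => st.
  by have B1 := rfix_eq0_trivial sBH (irr _ st nzB); rewrite -in_set1 -[[set 1%g]]B1.
pose Bx (i : 'I_l) := (B :^ (x ^+ i))%G.
have maxBx i : maxfix (Bx i) by apply: maxfix_conj; rewrite // groupX.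
have injB i j : i != j -> Bx i :!=: Bx j.
  wlog ltij : i j / (i < j)%N.
    move=> IH; case: (ltngtP i j) => [lt|lt|/val_inj ->]; last by rewrite eqxx.
      exact: IH.
    by move=> _; rewrite eq_sym; apply: IH => //; rewrite neq_ltn lt.
  move=> _; apply: contra nBx => /eqP; rewrite /= => E.
  have nk : (x ^+ (j - i))%g \in 'N(B).
    apply/normP/(can_inj (conjsgK (x ^+ i)%g)).
    by rewrite -conjsgM -expgD subnK 1?ltnW.
  have := @prime_meetG _ <[x]>%G 'N(B)%G; rewrite -orderE ox => /(_ pr_l); rewrite cycle_subG; apply.
  apply: contraNneq (_ : (x ^+ (j - i))%g != 1%g) => [I1|].
    by rewrite -in_set1 -[[set 1%g]]I1 inE mem_cycle.
  rewrite -order_dvdn ox gtnNdvd ?subn_gt0 //.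
  by apply: leq_ltn_trans (leq_subr _ _) _.
pose M := \matrix_(i < l) nz_row (rfix_mx rH (Bx i)).
have rfM : row_free M.
  apply: inj_row_free => u uM0; apply/rowP => j; rewrite mxE.
  have := congr1 (mulmx^~ (avg (Bx j))) uM0; rewrite /= mul0mx (mulmx_sum_row u M) mulmx_suml.
  rewrite (bigD1 j) //= big1 => [|i nij].
    rewrite addr0 -scalemxAl rowK (maxfix_avg (maxBx j)) ?nz_row_sub //.
    move/eqP; rewrite scaler_eq0 nz_row_eq0 => /orP[/eqP //|].
    by have [/= /andP[_ /negbTE->]] := maxgroupP (maxBx j).
  rewrite -scalemxAl rowK (maxfix_orth (maxBx i) (maxBx j)) ?scaler0 ?nz_row_sub //.
  exact: injB.
by have := rank_leq_col M; rewrite (eqP rfM) leqNgt ltNl.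
Qed.

Lemma free_cyclic : mxfree A -> cyclic A.
Proof.
move=> frA; apply: (@div_ring_mul_group_cyclic _ A 'M['F_p]_N rH) => //.
- exact: repr_mx1.
- by move=> u v Au Av; apply: repr_mxM; apply: (subsetP sAH).
by move=> a /setD1P[nta Aa]; apply: frA.
Qed.

(** In a matrix ring a polynomial may have more roots than its degree. The bound survives for roots
    that commute and have invertible differences, and [a - b] is [b] times a free difference. *)
Lemma free_roots (P : {poly 'F_p}) (S : seq hT) : mxfree A -> P != 0 -> uniq S ->
  {in S, forall a, a \in A /\ horner_mx (rH a) P = 0} -> (size S < size P)%N.
Proof.
move=> frA nzP uS HS; rewrite -(size_map rH) -(size_map_poly (@scalar_mx _ N)).
apply: max_ring_poly_roots; first by rewrite map_poly_eq0.
  by apply/allP => _ /mapP[a Sa ->]; have [_ ra] := HS a Sa; apply/rootP.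
elim: S uS HS => //= a S IH /andP[Sa uS] HS; rewrite IH // ?andbT; last first.
  by move=> b Sb; apply: HS; rewrite inE Sb orbT.
have [Aa _] := HS a (mem_head _ _).
apply/allP => _ /mapP[b Sb ->]; have [Ab _] := HS b (mem_behead (s := a :: S) Sb).
have [Ha Hb] := (subsetP sAH _ Aa, subsetP sAH _ Ab).
rewrite /diff_roots -!repr_mxMr // (centsP cAA a Aa b Ab) eqxx /=.
have -> : rH b - rH a = rH a *m (rH (a^-1 * b)%g - 1%:M).
  by rewrite mulmxBr -repr_mxM ?groupM ?groupV // mulKVg mulmx1.
rewrite -[_ \is a GRing.unit]/(_ \in unitmx) unitmx_mul repr_mx_unit //=.
apply: frA; first by rewrite groupM ?groupV.
by apply: contraNneq Sa => ab1; rewrite -(mulKVg a b) ab1 mulg1 in Sb *.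
Qed.

Lemma horner_mx_repr_conj (P : {poly 'F_p}) a h : a \in H -> h \in H ->
  horner_mx (rH a) P = 0 -> horner_mx (rH (a ^ h)%g) P = 0.
Proof.
move=> Ha Hh P0; rewrite conjgE !repr_mxM ?groupM ?groupV // mulmxA.
rewrite repr_mxV // horner_mx_uconjC ?P0 ?mulmx0 ?mul0mx //.
exact: repr_mx_unitr.
Qed.

(* The conjugates under [x] of a generator of [A] are roots of its
   characteristic polynomial, hence fewer than [l]. *)
Lemma irr_cents l x : x \in H -> x \in 'N(A) -> irr_elt x -> prime l -> #[x] = l -> (N < l)%N ->
  x \in 'C(A).
Proof.
move=> Hx nAx irr pr_l ox ltNl; have frA := free_of_irr Hx nAx irr pr_l ox ltNl.
have /cyclicP[a DA] := free_cyclic frA; rewrite DA cent_cycle.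
have Aa : a \in A by rewrite DA cycle_id.
have Ha := subsetP sAH _ Aa.
apply: contraLR ltNl => ncx; rewrite -leqNgt -ltnS.
rewrite -[X in (_ < X)%N](size_char_poly (rH a)).
have -> : l = size [seq (a ^ (x ^+ i))%g | i <- iota 0 l] by rewrite size_map size_iota.
apply: free_roots => //; first by rewrite monic_neq0 ?char_poly_monic.
  rewrite map_inj_in_uniq ?iota_uniq // => i j; rewrite !mem_iota !add0n /=.
  wlog leij : i j / (i <= j)%N.
    by move=> IH il jl E; case: (leqP i j) => [|/ltnW] le; [|apply/esym]; apply: IH.
  move=> _ ltj E; apply: contraNeq ncx => nij.
  have ltij : (i < j)%N by rewrite ltn_neqAle nij.
  have ck : (x ^+ (j - i))%g \in 'C[a].
    rewrite cent1C; apply/cent1P/commgP/conjg_fixP.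
    by apply: (can_inj (conjgK (x ^+ i)%g)); rewrite -conjgM -expgD subnK.
  have := @prime_meetG _ <[x]>%G 'C[a]%G; rewrite -orderE ox => /(_ pr_l); rewrite cycle_subG; apply.
  apply: contraNneq (_ : (x ^+ (j - i))%g != 1%g) => [I1|].
    by rewrite -in_set1 -[[set 1%g]]I1 inE mem_cycle.
  rewrite -order_dvdn ox gtnNdvd ?subn_gt0 //.
  by apply: leq_ltn_trans (leq_subr _ _) _.
move=> _ /mapP[i _ ->]; split; first by rewrite memJ_norm // groupX.
by apply: horner_mx_repr_conj; rewrite ?groupX //; apply: Cayley_Hamilton.
Qed.

End AbelianSub.

End FaithfulModule.

Lemma conj_fix_mod (gT : finGroupType) (A Y : {group gT}) (q : nat) :
  q.-group Y -> Y \subset 'N(A) -> #|A| = #|'C_A(Y)| %[mod q].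
Proof.
move=> qY nAY; have aY : [acts Y, on A | 'J] by rewrite astabsJ.
have := pgroup_fix_mod qY aY; rewrite afixJ => ->; by rewrite setIC setIC.
Qed.

(** From [p ^ (2 * i) = 1] modulo [l], [2 * i] is a multiple of the order [N] of [p], and it lies
    strictly between 0 and [2 * N]. *)
Lemma prim_half p n' l n i : prime p -> primitive_prime p n'.+1 l -> n'.+1 = n.*2 ->
  2 < l -> i < n'.+1 -> l %| (p ^ i).+1 -> i = n.
Proof.
move=> pr_p pl DN l_gt2 iN li.
have l2i : p ^ (i + i) = 1 %[mod l].
  apply/eqP; rewrite eqn_mod_dvd ?expn_gt0 ?prime_gt0 // expnD -[1%N]/(1 ^ 2)%N mulnn subn_sqr.
  by rewrite addn1 dvdn_mull.
have i_gt0 : 0 < i.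
  rewrite lt0n; apply: contraL li => /eqP->; rewrite expn0 gtnNdvd //.
case: (leqP (i + i) n'.+1) => [le|gt].
  have := @prim_eq_mod p n' l pr_p pl 0 (i + i); rewrite le => /(_ isT l2i).
  by clear -DN i_gt0; case=> [|[_]]; lia.
have E : p ^ (i + i - n'.+1) = p ^ 0 %[mod l].
  have pN : p ^ n'.+1 = 1 %[mod l].
    by apply/eqP; rewrite eqn_mod_dvd ?expn_gt0 ?prime_gt0 //; case: pl.
  by rewrite -l2i -{2}(subnK (ltnW gt)) expnD -[in RHS]modnMmr pN modnMmr muln1.
have := @prim_eq_mod p n' l pr_p pl 0 (i + i - n'.+1) _ E.
have -> : 0 <= i + i - n'.+1 <= n'.+1 by clear -iN; lia.
by move=> /(_ isT); clear -gt iN; case=> [|[_]]; lia.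
Qed.

Section PrimitiveCentralizer.
Local Open Scope ring_scope.
Variables (p n' : nat).
Local Notation N := n'.+1.
Variables (hT : finGroupType) (H : {group hT}) (rH : mx_representation 'F_p H N).
Hypotheses (pr_p : prime p) (ffulH : mx_faithful rH).

(** Coefficients in ['F_p] are fixed by the Frobenius map, so p-th powers of roots are roots. *)
Lemma horner_mx_Frobenius (M : 'M['F_p]_N) (P : {poly 'F_p}) :
  horner_mx (M ^+ p) P = horner_mx M P ^+ p.
Proof.
rewrite -rmorphXn /=; elim/poly_ind: P => [|P c IH].
  by rewrite expr0n gtn_eqF ?prime_gt0 // !rmorph0.
have pch : p \in [pchar {poly 'F_p}] by rewrite pchar_poly pchar_Fp.
have -> : (P * 'X + c%:P) ^+ p = P ^+ p * 'X ^+ p + c%:P.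
  transitivity ((P * 'X) ^+ p + c%:P ^+ p).
    exact: (pFrobenius_autD_comm pch (mulrC _ _)).
  rewrite exprMn -polyC_exp.
  by have := expf_card c; rewrite card_Fp // => ->.
by rewrite !rmorphD !rmorphM /= IH !horner_mx_C [horner_mx M 'X^p]rmorphXn /= !horner_mx_X.
Qed.

Lemma horner_mx_tr (M : 'M['F_p]_N) (P : {poly 'F_p}) :
  horner_mx M^T P = (horner_mx M P)^T.
Proof.
elim/poly_ind: P => [|P c IH]; first by rewrite !rmorph0 trmx0.
rewrite !rmorphD !rmorphM /= !horner_mx_C !horner_mx_X IH.
rewrite linearD /= tr_scalar_mx; congr (_ + _).
rewrite -[M^T](horner_mx_X) -IH -[LHS]rmorphM /= mulrC rmorphM /= horner_mx_X IH.
exact/esym/trmx_mul.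
Qed.

(** Some [M] in the enveloping algebra of [<[x]>] agrees with [rH c] on a nonzero vector [u]. The
    difference commutes with [x] and is singular, so it is 0 by Schur's lemma; and [M] commutes with
    [rH d]. *)
Lemma irr_cent_comm x c d : x \in H -> irr_elt rH x -> c \in 'C_H[x] -> d \in 'C_H[x] ->
  commute c d.
Proof.
move=> Hx irr /setIP[Hc /cent1P cx] /setIP[Hd /cent1P dx].
have sXH : <[x]> \subset H by rewrite cycle_subG.
set rX := subg_repr rH sXH.
have comX y : commute y x -> y \in H -> centgmx rX (rH y).
  move=> yx Hy; apply/centgmxP => z Xz /=; have Hz := subsetP sXH z Xz.
  rewrite -!repr_mxM //; congr (rH _); have: y \in 'C[x] by apply/cent1P.
  by rewrite -cent_cycle => /centP/(_ z Xz).
pose u : 'M['F_p]_(1, N) := delta_mx 0 0.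
have nzu : u != 0.
  by apply/eqP => /matrixP/(_ 0 0); rewrite !mxE !eqxx => /eqP; rewrite oner_eq0.
have full : row_full (cyclic_mx rX u).
  apply: irr; last by rewrite cyclic_mx_eq0.
  by have /mxmoduleP/(_ x (cycle_id x)) := cyclic_mx_module rX u.
have /cyclic_mxP[M EM DM] : (u *m rH c <= cyclic_mx rX u)%MS by rewrite submx_full.
have Mc y : commute y x -> y \in H -> comm_mx M (rH y).
  move=> yx Hy; have := comX y yx Hy; rewrite -memmx_cent_envelop => /cent_mxP.
  by move/(_ M EM).
have MD : M - rH c = 0.
  have cMc : comm_mx (M - rH c) (rH x).
    have Mx : M *m rH x = rH x *m M := Mc x (commute_refl x) Hx.
    have cx' : rH c *m rH x = rH x *m rH c by rewrite -!repr_mxM // cx.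
    by rewrite /comm_mx mulmxBl mulmxBr Mx cx'.
  apply/eqP; apply: contraT => /(irr_cent_unit Hx irr cMc) un.
  have : u *m (M - rH c) = 0 by rewrite mulmxBr DM subrr.
  move/(congr1 (mulmx^~ (invmx (M - rH c)))); rewrite /= mulmxK // mul0mx => u0.
  by rewrite u0 eqxx in nzu.
have E : rH c = M by apply/eqP; rewrite eq_sym -subr_eq0 MD.
apply: (rH_inj ffulH); rewrite ?groupM // !repr_mxM // E.
exact: Mc.
Qed.

Lemma irr_cent_abelian x : x \in H -> irr_elt rH x -> abelian 'C_H[x].
Proof. by move=> Hx irr; apply/centsP => c Cc d Cd; apply: (irr_cent_comm Hx irr). Qed.

Lemma irr_cent_free x : x \in H -> irr_elt rH x -> mxfree rH 'C_H[x].
Proof.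
move=> Hx irr c /setIP[Hc /cent1P cx] ntc.
have cx' : rH c *m rH x = rH x *m rH c by rewrite -!repr_mxM // cx.
apply: (irr_cent_unit Hx irr).
  by rewrite /comm_mx mulmxBl mulmxBr mul1mx mulmx1 cx'.
rewrite subr_eq0 -(repr_mx1 rH); apply: contra ntc => /eqP/(rH_inj ffulH) -> //.
Qed.

(** Invariance of [J] says that the inverse of [rH c] is conjugate, through [J], to the transpose of
    [rH c]. *)
Lemma invmx_root c (P : {poly 'F_p}) (J : 'M['F_p]_N) : J \in unitmx ->
  rH c *m J *m (rH c)^T = J -> c \in H -> horner_mx (rH c) P = 0 -> horner_mx (rH c^-1%g) P = 0.
Proof.
move=> uJ cJ Hc P0; rewrite repr_mxV //.
have -> : invmx (rH c) = J *m (rH c)^T *m invmx J.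
  have uc := repr_mx_unit rH Hc.
  by apply: (can_inj (mulKmx uc)); rewrite mulmxV // !mulmxA cJ mulmxV.
by rewrite horner_mx_uconj // horner_mx_tr P0 trmx0 mulmx0 mul0mx.
Qed.

Section NormalPrimCycle.
Variables (J : 'M['F_p]_N) (l n : nat) (z : hT).
Hypotheses (uJ : J \in unitmx) (invJ : forall h, h \in H -> rH h *m J *m (rH h)^T = J).
Hypotheses (DN : N = n.*2) (n_gt1 : (1 < n)%N) (pl : primitive_prime p N l).
Hypotheses (Hz : z \in H) (oz : #[z] = l) (nz : H \subset 'N(<[z]>)).
Hypothesis cardH : (p ^ N - 1 %| #|H|)%N.

Let irr : irr_elt rH z := prim_irr pr_p ffulH pl Hz oz.
Let C := 'C_H[z].
Let pr_l := prim_prime pl.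

Let cCC : abelian C := irr_cent_abelian Hz irr.
Let frC : mxfree rH C := irr_cent_free Hz irr.

(* With [c] a generator of [C], the [c ^+ (p ^ i)] are [N] roots of the
   characteristic polynomial of [c], and [c^-1] is a root as [rH c] preserves
   a form; so [c^-1 = c ^+ (p ^ i)] for some [i]. *)
Lemma cent_irr_card : (#|C| <= (p ^ n).+1)%N.
Proof.
have sCH : C \subset H by apply: subsetIl.
have cycC : cyclic C := free_cyclic (A := [group of C]) sCH cCC frC.
have [c DC] := cyclicP cycC.
have Cc : c \in C by rewrite DC cycle_id.
have Hc : c \in H := subsetP sCH c Cc.
have lC : (l %| #[c])%N.
  by rewrite -oz !orderE -DC cardSg // cycle_subG inE Hz cent1id.
have P0 : horner_mx (rH c) (char_poly (rH c)) = 0 by apply: Cayley_Hamilton.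
have root_pow i : horner_mx (rH (c ^+ (p ^ i))%g) (char_poly (rH c)) = 0.
  elim: i => [|i IH]; first by rewrite expg1.
  rewrite expnSr expgM repr_mxX ?groupX // horner_mx_Frobenius IH.
  by rewrite expr0n gtn_eqF ?prime_gt0.
have inj : {in iota 0 N &, injective (fun i => c ^+ (p ^ i))%g}.
  move=> i j; rewrite !mem_iota !add0n /=.
  wlog leij : i j / (i <= j)%N.
    by move=> IH il jl E; case: (leqP i j) => [|/ltnW] le; [|apply/esym]; apply: IH.
  move=> iN jN /eqP; rewrite eq_expg_mod_order => /eqP E.
  have E' : (p ^ j = p ^ i %[mod l])%N.
    by rewrite -(modn_dvdm _ lC) -E modn_dvdm.
  have := prim_eq_mod pr_p pl _ E'; rewrite leij (ltnW jN) => /(_ isT) [//|[_ jN']].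
  by rewrite jN' ltnn in jN.
pose S := [seq (c ^+ (p ^ i))%g | i <- iota 0 N].
have VS : c^-1%g \in S.
  apply: contraT => nVS.
  have uS : uniq (c^-1%g :: S) by rewrite cons_uniq nVS map_inj_in_uniq ?iota_uniq.
  have nzP : char_poly (rH c) != 0 by rewrite monic_neq0 ?char_poly_monic.
  have := @free_roots p n' hT H rH [group of C] sCH cCC _ _ frC nzP uS.
  rewrite size_char_poly [size _]/= size_map size_iota ltnn; apply.
  move=> a; rewrite inE => /orP[/eqP->|/mapP[i _ ->]].
    by rewrite groupV; split=> //; apply: (invmx_root uJ (invJ Hc)).
  by split; [rewrite groupX | apply: root_pow].
have [i] := mapP VS; rewrite mem_iota add0n => /andP[_ iN] /eqP.
rewrite eq_invg_mul -expgS -order_dvdn => ci.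
have li : (l %| (p ^ i).+1)%N := dvdn_trans lC ci.
have l_gt2 : (2 < l)%N.
  by apply: leq_trans (prim_gtN pr_p pl); rewrite DN; case: (n) n_gt1 => [|[|k]].
have iN2 : i = n := prim_half pr_p pl DN l_gt2 iN li.
by rewrite DC -orderE -iN2 dvdn_leq.
Qed.

(** The conjugates of [z] lie in [<[z]>] and are roots of the characteristic polynomial of [z], of
    degree [N]. *)
Lemma index_irr_card : (#|H : C| <= N)%N.
Proof.
have sZ : <[z]> \subset H by rewrite cycle_subG.
have frZ : mxfree rH <[z]>.
  move=> a Za; apply: frC; rewrite inE (subsetP sZ) //=.
  by rewrite -cent_cycle (subsetP (cycle_abelian z)).
rewrite index_cent1 cardE -ltnS -[X in (_ < X)%N](size_char_poly (rH z)).
apply: (free_roots sZ (cycle_abelian z) frZ).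
- by rewrite monic_neq0 ?char_poly_monic.
- exact: enum_uniq.
move=> a; rewrite mem_enum => /imsetP[h Hh ->]; split.
  by rewrite memJ_norm ?cycle_id // (subsetP nz).
by apply: horner_mx_repr_conj => //; apply: Cayley_Hamilton.
Qed.

(** Now [|H|] is at most [2n (p ^ n + 1)] and divisible by [(p ^ n - 1) (p ^ n + 1)], so
    [p = n = 2]. There [l = 5] and [|C| = 5], while 3 divides [|H|]; an element of order 3 acts
    trivially on the group [<[z]>] of order 5, hence lies in [C]. *)
Lemma normal_prim_cycle_false : False.
Proof.
have le1 := cent_irr_card; have le2 := index_irr_card.
have sCH : C \subset H by apply: subsetIl.
have EH : #|H| = (#|C| * #|H : C|)%N by rewrite Lagrange.
have p2 : (p ^ N - 1 = (p ^ n - 1) * (p ^ n).+1)%N.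
  by rewrite DN -addnn expnD -[1%N]/(1 ^ 2)%N mulnn subn_sqr addn1.
have leH : (p ^ N - 1 <= (p ^ n).+1 * N)%N.
  by apply: leq_trans (leq_mul le1 le2); rewrite -EH dvdn_leq.
have le3 : (p ^ n <= n.*2.+1)%N.
  by move: leH; rewrite p2 mulnC leq_pmul2l // leq_subLR add1n DN.
have p_gt1 := prime_gt1 pr_p.
have [p2' n2] : p = 2%N /\ n = 2%N.
  have : (2 ^ n <= p ^ n)%N by rewrite leq_exp2r // (ltnW n_gt1).
  move/leq_trans/(_ le3) => le4.
  have n2 : n = 2%N.
    apply/eqP; rewrite eqn_leq n_gt1 andbT leqNgt; apply/negP => n3.
    move: le4; rewrite leqNgt => /negP[].
    elim: (n) n3 => // k IH; rewrite ltnS leq_eqVlt => /orP[/eqP<- //|/IH].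
    rewrite expnS; move: (2 ^ k)%N => y; lia.
  split=> //; move: le3; rewrite n2; case: (p) p_gt1 => [|[|[|k]]] // _.
  by rewrite !expnS expn0; nia.
have N4 : N = 4%N by rewrite DN n2.
have l5 : l = 5%N.
  have [_ l15 _] := pl; have := prim_gtN pr_p pl; rewrite N4 in l15 * => l4.
  rewrite p2' -[(2 ^ 4 - 1)%N]/(3 * 5)%N Euclid_dvdM // in l15.
  case/orP: l15 => /dvdn_leq => /(_ isT) le; first by move: (leq_trans l4 le).
  by apply/eqP; rewrite eqn_leq le.
have C5 : #|C| = 5%N.
  apply/eqP; rewrite eqn_leq; rewrite p2' n2 in le1; rewrite le1 /= dvdn_leq //.
  by rewrite -l5 -oz cardSg // cycle_subG inE Hz cent1id.
have H3 : (3 %| #|H|)%N by apply: dvdn_trans cardH; rewrite p2' N4.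
have [//|y Hy oy] := Cauchy _ H3.
have cy : y \in C.
  have Y3 : 3.-group <[y]> by rewrite /pgroup -orderE oy.
  have nY : <[y]> \subset 'N(<[z]>) by rewrite cycle_subG (subsetP nz).
  have := conj_fix_mod Y3 nY; rewrite -orderE oz l5.
  have : (#|'C_<[z]>(<[y]>)| %| 5)%N by rewrite -l5 -oz cardSg // subsetIl.
  have /primeP[_ H5] : prime 5 by []; move/H5 => /orP[/eqP-> //|/eqP E _].
  rewrite inE Hy; have /setIidPl : 'C_<[z]>(<[y]>) = <[z]>.
    by apply/eqP; rewrite eqEcard subsetIl -orderE oz l5 E.
  by rewrite cycle_subG => /centP/(_ y (cycle_id y))/commute_sym/cent1P.
have : (#[y] %| #|C|)%N by rewrite order_dvdG.
by rewrite oy C5.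
Qed.

End NormalPrimCycle.

End PrimitiveCentralizer.

(** Coprime action gives [G = [~: G, A] * 'C_G(A)]; for [g = d * c] in this product, [[~ g, a]] is
    the commutator of a conjugate of [d] with [a]. *)
Lemma coprime_commGid (gT : finGroupType) (A G : {group gT}) :
  A \subset 'N(G) -> coprime #|G| #|A| -> solvable G -> [~: G, A, A] = [~: G, A].
Proof.
move=> nGA coGA solG; apply/eqP; rewrite eqEsubset commSg ?commg_subl //=.
rewrite gen_subG; apply/subsetP => _ /imset2P[g a Gg Aa ->].
have nRA : A \subset 'N([~: G, A]) by rewrite commg_normr.
have sRG : [~: G, A] \subset G by rewrite commg_subl.
have nRG : G \subset 'N([~: G, A]) by rewrite commg_norml.
have : G \subset [~: G, A] * 'C_G(A).
  rewrite -quotientSK // coprime_quotient_cent // subsetI subxx /=.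
  exact: quotient_cents2r.
move/subsetP/(_ g Gg).
case/mulsgP => d c Rd /setIP[Gc /centP cA] ->.
rewrite commMgJ (_ : [~ c, a] = 1%g) ?mulg1; last exact/eqP/commgP/cA.
have -> : [~ d, a] ^ c = [~ d ^ c, a] by rewrite conjRg [a ^ c]conjgE -(cA a Aa) mulKg.
by rewrite mem_commg // memJ_norm // (subsetP nRG).
Qed.

(** * Extraspecial groups normalised by an element of primitive prime order *)

Section PrimeToCharSubgroups.
Local Open Scope ring_scope.
Variables (p n' : nat).
Local Notation N := n'.+1.
Variables (hT : finGroupType) (H : {group hT}) (rH : mx_representation 'F_p H N).
Hypotheses (pr_p : prime p) (ffulH : mx_faithful rH).

Section ClassTwo.
Variable T : {group hT}.
Hypotheses (sTH : T \subset H) (p'T : p^'.-group T) (T'Z : T^`(1)%g \subset 'Z(T)) (frZ : mxfree rH 'Z(T)).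

(** A nontrivial commutator [[~ t, y]] is central, and multiplying by it permutes the summands.
    Hence [rH [~ t, y] - 1], which is invertible, kills the sum. *)
Lemma class_sum0 t : t \in T -> t \notin 'Z(T) -> \sum_(g in T) rH (t ^ g)%g = 0.
Proof.
move=> Tt nZt; set S := (X in X = _).
have [y Ty nty] : exists2 y, y \in T & [~ t, y] != 1%g.
  apply/exists_inP; apply: contraNT nZt; rewrite negb_exists_in => /forall_inP nt.
  rewrite inE Tt; apply/centP => y Ty; apply/commgP.
  by have := nt y Ty; rewrite negbK.
have Zz : [~ t, y] \in 'Z(T) by rewrite (subsetP T'Z) // mem_commg.
have [Tz /centP cz] := setIP Zz.
have ES : S = S *m rH [~ t, y].
  rewrite {1}/S (reindex_inj (mulgI y)) /= mulmx_suml.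
  apply: eq_big => [g|g]; first by rewrite groupMl.
  rewrite groupMl // => Tg.
  rewrite -repr_mxM ?(subsetP sTH) ?groupJ //; congr (rH _).
  rewrite conjgM (_ : t ^ y = t * [~ t, y])%g; last by rewrite commgEl mulKVg.
  by rewrite conjMg; congr (_ * _)%g; rewrite conjgE (cz g Tg) mulKg.
have : S *m (rH [~ t, y] - 1%:M) = 0 by rewrite mulmxBr mulmx1 -ES subrr.
have un := frZ Zz nty.
by move/(congr1 (mulmx^~ (invmx (rH [~ t, y] - 1%:M)))); rewrite /= mulmxK // mul0mx.
Qed.

Definition center_reps := [set repr c | c in rcosets 'Z(T) T].

Definition center_reps_mx := \matrix_(i < #|center_reps|) mxvec (rH (enum_val i)).

Lemma center_reps_sub : center_reps \subset T.
Proof.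
apply/subsetP => _ /imsetP[_ /rcosetsP[t Tt ->] ->].
have := mem_repr_rcoset 'Z(T) t; case/rcosetP=> z Zz ->.
by rewrite groupM // (subsetP (center_sub T)).
Qed.

Lemma card_center_reps : #|center_reps| = #|T : 'Z(T)|.
Proof.
rewrite card_in_imset //; move=> _ _ /rcosetsP[s Ts ->] /rcosetsP[t Tt ->] E.
by rewrite -(rcoset_repr 'Z(T) s) E rcoset_repr.
Qed.

(** Multiply a linear relation by the inverse of the j-th representative and sum over the conjugates
    by [T]. By [class_sum0] only the j-th term survives, with the factor [#|T|], which is prime to
    [p]. *)
Lemma center_reps_free : row_free center_reps_mx.
Proof.
apply: inj_row_free => u uB; apply/rowP => j; rewrite mxE.
have E : \sum_i u 0 i *: rH (enum_val i) = 0.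
  apply: (can_inj mxvecK); rewrite linear0 -uB mulmx_sum_row linear_sum.
  by apply: eq_bigr => i _; rewrite linearZ /= rowK.
have Tq (i : 'I_#|center_reps|) : enum_val i \in T by apply: (subsetP center_reps_sub); apply: enum_valP.
have Hq (i : 'I_#|center_reps|) : enum_val i \in H by apply: (subsetP sTH).
pose q := enum_val j.
have E2 : \sum_i u 0 i *: (\sum_(g in T) rH ((enum_val i * q^-1) ^ g)%g) = 0.
  transitivity (\sum_(g in T) rH g^-1%g *m (\sum_i u 0 i *: rH (enum_val i)) *m rH (q^-1 * g)%g).
    under eq_bigr => i _ do rewrite scaler_sumr.
    rewrite exchange_big /=; apply: eq_bigr => g Tg; rewrite mulmx_sumr mulmx_suml.
    have Hg := subsetP sTH g Tg.
    apply: eq_bigr => i _; rewrite -scalemxAr -scalemxAl; congr (_ *: _).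
    rewrite -!repr_mxM ?groupM ?groupV ?Hq //.
    by rewrite conjgE !mulgA.
  by rewrite E big1 // => g _; rewrite mulmx0 mul0mx.
have := E2; rewrite (bigD1 j) //= [X in _ + X]big1 => [|i nij]; last first.
  have Tij : (enum_val i * q^-1)%g \in T by rewrite groupM ?groupV // Tq.
  rewrite class_sum0 ?scaler0 //.
  apply: contra nij => Zij; apply/eqP/enum_val_inj.
  have /imsetP[ci cosi Di] := enum_valP i; have /imsetP[cj cosj Dj] := enum_valP j.
  have Ei : ci = 'Z(T) :* enum_val i.
    by have [s _ Es] := rcosetsP cosi; rewrite Di Es rcoset_repr.
  have Ej : cj = 'Z(T) :* enum_val j.
    by have [s _ Es] := rcosetsP cosj; rewrite Dj Es rcoset_repr.
  by rewrite Di Dj Ei Ej; congr (repr _); apply/rcoset_eqP; rewrite mem_rcoset.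
rewrite addr0 mulgV => /eqP; rewrite (eq_bigr (fun=> 1%:M)) => [|g Tg]; last first.
  by rewrite conj1g repr_mx1.
rewrite sumr_const scaler_eq0 => /orP[/eqP //|].
rewrite -scaler_nat scaler_eq0 -(dvdn_pcharf (pchar_Fp pr_p)) => /orP[pT|].
  by move: p'T; rewrite /pgroup p'natE // pT.
by rewrite oner_eq0.
Qed.

Lemma class2_card_le : (#|T : 'Z(T)| <= N * N)%N.
Proof. by rewrite -card_center_reps -(eqP center_reps_free) rank_leq_col. Qed.

Lemma class2_abs_irr : #|T : 'Z(T)| = (N * N)%N -> mx_absolutely_irreducible (subg_repr rH sTH).
Proof.
move=> cT; rewrite /mx_absolutely_irreducible /=.
have sub : (center_reps_mx <= enveloping_algebra_mx (subg_repr rH sTH))%MS.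
  apply/row_subP => i; rewrite rowK.
  by apply: (envelop_mx_id (subg_repr rH sTH)); rewrite (subsetP center_reps_sub) ?enum_valP.
rewrite /row_full eqn_leq rank_leq_col /=.
by rewrite -[X in (X <= _)%N]cT -card_center_reps -(eqP center_reps_free) mxrankS.
Qed.

End ClassTwo.

Section PrimOnPgroup.
Variables (l r : nat) (x : hT) (R : {group hT}).
Hypotheses (pl : primitive_prime p N l) (Hx : x \in H) (ox : #[x] = l).
Hypotheses (N_gt1 : (1 < N)%N) (rR : r.-group R) (pr_r : prime r) (nrp : r != p) (nrl : r != l).
Hypotheses (sRH : R \subset H) (nRx : x \in 'N(R)) (ncRx : x \notin 'C(R)).
Let T := [~: R, <[x]>]%G.

(** By [irr_cents], [x] centralises the characteristic abelian subgroups of [T], so [T] is special;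
    its centre is free, hence cyclic, of order [r]. With [|T| = r ^ (2k + 1)], independence of coset
    representatives gives [r ^ k <= N], while [l] divides [(r ^ k - 1) (r ^ k + 1)]. So
    [N < l <= r ^ k + 1 <= N + 1] are equalities, and [l] odd forces [r] even. *)
Lemma prim_coprime_extraspecial : [/\ r = 2%N, l = N.+1, extraspecial T, #|T| = (2 * (N * N))%N & 'C_T[x] = 'Z(T)].
Proof.
have pr_l := prim_prime pl.
have irr : irr_elt rH x := prim_irr pr_p ffulH pl Hx ox.
have ltNl := prim_gtN pr_p pl.
have nRX : <[x]> \subset 'N(R) by rewrite cycle_subG.
have sTR : T \subset R by rewrite commg_subl.
have sTH := subset_trans sTR sRH.
have rT : r.-group T := pgroupS sTR rR.
have p'r (Y : {group hT}) : r.-group Y -> p^'.-group Y.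
  by apply: sub_pgroup => q /eqP ->; rewrite !inE.
have coR : coprime #|R| #|<[x]>|.
  by rewrite -orderE ox (pnat_coprime rR) // pnatE // !inE eq_sym.
have coT : coprime #|T| #|<[x]>| by apply: coprimeSg coR.
have nTx : x \in 'N(T) by rewrite -cycle_subG commg_normr.
have TT : [~: T, <[x]>] = T.
  by apply: coprime_commGid => //; apply: (pgroup_sol rR).
have cents (Y : {group hT}) : Y \subset T -> x \in 'N(Y) -> abelian Y -> x \in 'C(Y).
  move=> sYT nYx cYY; have sYH := subset_trans sYT sTH.
  by apply: (irr_cents pr_p ffulH sYH cYY (p'r _ (pgroupS sYT rT)) Hx nYx irr pr_l ox).
have ntT : T :!=: 1%g.
  apply: contra ncRx => /eqP/commG1P; rewrite centsC cycle_subG.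
  by [].
have [] := @abelian_charsimple_special _ r <[x]>%G T rT coT TT.
  apply/bigcupsP => Y /andP[chY cYY]; rewrite centsC cycle_subG.
  by apply: cents; rewrite ?(char_sub chY) // -cycle_subG (char_norm_trans chY) // cycle_subG.
move=> spT CTx.
have abT : ~~ abelian T.
  apply: contra ntT => cTT; rewrite -TT; apply/eqP/commG1P.
  by rewrite centsC cycle_subG cents.
have nZx : x \in 'N('Z(T)) by rewrite -cycle_subG (char_norm_trans (center_char T)) // cycle_subG.
have sZT := center_sub T; have sZH := subset_trans sZT sTH.
have rZ := pgroupS sZT rT.
have frZ : mxfree rH 'Z(T).
  exact: (free_of_irr pr_p ffulH sZH (center_abelian T) (p'r _ rZ) Hx nZx irr pr_l ox).
have cycZ : cyclic 'Z(T) := free_cyclic (A := 'Z(T)%G) sZH (center_abelian T) frZ.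
have oZ : #|'Z(T)| = r.
  have abZ := center_special_abelem rT spT.
  have : logn r #|'Z(T)| = 1%N.
    apply/eqP; rewrite eqn_leq -(abelem_cyclic abZ) cycZ logn_gt0 /=.
    have ntZ : 'Z(T) != 1%g by rewrite center_nil_eq1 // (pgroup_nil rT).
    by have [_ dv _] := pgroup_pdiv rZ ntZ; rewrite mem_primes pr_r cardG_gt0.
  by move=> lgZ; rewrite (card_pgroup rZ) lgZ.
have esT : extraspecial T by split; rewrite ?oZ.
have [k k_gt0 oT] := card_extraspecial rT esT.
have [[PhiZ T'Z] _] := esT.
have T'sZ : T^`(1)%g \subset 'Z(T) by rewrite T'Z.
have iTZ : #|T : 'Z(T)| = (r ^ k * r ^ k)%N.
  by rewrite -divgS // oZ oT expnS mulKn ?prime_gt0 // -addnn expnD.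
have leN := class2_card_le sTH (p'r _ rT) T'sZ frZ.
rewrite iTZ in leN.
have rkN : (r ^ k <= N)%N.
  by rewrite leqNgt; apply: contraL leN => lt; rewrite -ltnNge ltn_mul.
have CT1 : 'C_T[x] = 'Z(T) by rewrite -cent_cycle.
have lX : l.-group <[x]> by rewrite /pgroup -orderE ox pnat_id.
have modl : (l %| (r ^ k - 1) * (r ^ k).+1)%N.
  have nTX : <[x]> \subset 'N(T) by rewrite cycle_subG.
  have := conj_fix_mod lX nTX; rewrite cent_cycle CT1 oZ oT => /eqP.
  have rk1 : (0 < r ^ k.*2)%N by rewrite expn_gt0 prime_gt0.
  rewrite eqn_mod_dvd; last by rewrite expnS leq_pmulr.
  rewrite expnS -[X in (_ - X)%N]muln1 -mulnBr Gauss_dvdr; last first.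
    by rewrite prime_coprime // dvdn_prime2 // eq_sym.
  by rewrite -addnn expnD -[1%N]/(1 ^ 2)%N mulnn subn_sqr addn1.
have rk_gt1 : (1 < r ^ k)%N by rewrite -(expn0 r) ltn_exp2l ?prime_gt1.
have lle : (l <= (r ^ k).+1)%N.
  move: modl; rewrite Euclid_dvdM // => /orP[] /dvdn_leq.
    rewrite subn_gt0 rk_gt1 => /(_ isT) le; apply: leq_trans le _.
    exact: leq_trans (leq_subr _ _) (leqnSn _).
  by move/(_ isT).
have rkN' : (r ^ k)%N = N by apply/eqP; rewrite eqn_leq rkN -ltnS (leq_trans ltNl).
have lN : l = N.+1 by apply/eqP; rewrite eqn_leq ltNl -rkN' lle.
have r2 : r = 2%N.
  case: (even_prime pr_l) => [l2|odd_l]; first by rewrite l2 in lN; case: (n') N_gt1 lN.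
  case: (even_prime pr_r) => // odd_r.
  by move: odd_l; rewrite lN -rkN' /= oddX odd_r orbT.
split=> //; rewrite oT -rkN' expnS -addnn expnD r2 //.
Qed.

End PrimOnPgroup.
End PrimeToCharSubgroups.

(** For [d = e + k] with [0 < e < k], [2 ^ e * (2 ^ k + 1)] is [2 ^ d - 1] plus [2 ^ e + 1], and the
    latter is too small to be a multiple of [2 ^ k + 1]. *)
Lemma order_2_mod_Fermat k d : 0 < d < k.*2 -> ~~ ((2 ^ k).+1 %| 2 ^ d - 1).
Proof.
case/andP=> d_gt0 dk; have pow_gt1 e : 0 < e -> 1 < 2 ^ e by move=> e0; rewrite -(expn0 2) ltn_exp2l.
case: (leqP d k) => [dlek|kd].
  rewrite gtnNdvd ?subn_gt0 ?pow_gt1 //.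
  by rewrite ltnS (leq_trans (leq_subr _ _)) // leq_exp2l.
pose e := d - k; have De : d = e + k by rewrite subnK // ltnW.
have e_gt0 : 0 < e by rewrite subn_gt0.
have ek : e < k by rewrite -(ltn_add2r k) -De addnn.
apply/negP => dv; have : ((2 ^ k).+1 %| 2 ^ e * (2 ^ k).+1)%N by rewrite dvdn_mull.
have -> : (2 ^ e * (2 ^ k).+1 = 2 ^ d - 1 + (2 ^ e).+1)%N.
  rewrite mulnS -expnD -De addnS -addSn subn1 prednK ?expn_gt0 //.
  by rewrite addnC.
rewrite dvdn_addr //; apply/negP; rewrite gtnNdvd // ltnS ltn_exp2l //.
Qed.

(** * Solvable groups preserving a form and transitive on nonzero vectors *)

Section TransitiveSymplectic.
Local Open Scope ring_scope.
Variables (p n' n : nat).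
Local Notation N := n'.+1.
Variables (hT : finGroupType) (H : {group hT}) (rH : mx_representation 'F_p H N) (J : 'M['F_p]_N).
Hypotheses (pr_p : prime p) (ffulH : mx_faithful rH) (solH : solvable H).
Hypothesis transH : forall u v : 'rV['F_p]_N, u != 0 -> v != 0 -> exists2 h, h \in H & v = u *m rH h.
Hypotheses (uJ : J \in unitmx) (invJ : forall h, h \in H -> rH h *m J *m (rH h)^T = J).
Hypothesis DN : N = n.*2.

Lemma trans_irr : mx_irreducible rH.
Proof.
apply/mx_irrP; split=> // U mU nzU; rewrite -sub1mx; apply/row_subP => i.
pose u := nz_row U; have nzu : u != 0 by rewrite nz_row_eq0.
have nzi : row i (1%:M : 'M['F_p]_N) != 0.
  apply/eqP => /rowP/(_ i); rewrite !mxE eqxx => /eqP; by rewrite oner_eq0.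
have [h Hh ->] := transH nzu nzi.
by apply: (mxmodule_trans mU Hh); apply: nz_row_sub.
Qed.

Lemma trans_pcore1 : 'O_p(H) = 1%g.
Proof. exact: (pcore_faithful_mx_irr_pchar (pchar_Fp pr_p) trans_irr ffulH). Qed.

Lemma trans_card : (p ^ N - 1 %| #|H|)%N.
Proof.
pose u : 'rV['F_p]_N := delta_mx 0 0.
have nzu : u != 0.
  by apply/eqP => /matrixP/(_ 0 0); rewrite !mxE !eqxx => /eqP; rewrite oner_eq0.
have -> : (p ^ N - 1)%N = #|orbit ('MR rH)%act H u|.
  have -> : orbit ('MR rH)%act H u = [set~ 0].
    apply/setP => v; rewrite !inE; apply/orbitP/idP => [[h Hh <-]|nzv].
      rewrite /= mx_repr_actE //; apply: contraNneq nzu => uh0.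
      by rewrite -(repr_mxK rH Hh u) uh0 mul0mx.
    by have [h Hh ->] := transH nzu nzv; exists h; rewrite //= mx_repr_actE.
  by rewrite cardsC1 card_mx mul1n card_Fp // subn1.
by rewrite card_orbit_in // dvdn_indexg.
Qed.

Lemma scalar_pm1 h a : h \in H -> rH h = a%:M -> a ^+ 2 = 1.
Proof.
move=> Hh Da; have := invJ Hh; rewrite Da tr_scalar_mx mul_scalar_mx mul_mx_scalar scalerA.
rewrite -expr2 => E; apply/eqP; rewrite -subr_eq0.
have : (a ^+ 2 - 1) *: J = 0 by rewrite scalerBl E scale1r subrr.
move/eqP; rewrite scaler_eq0 => /orP[//|/eqP J0].
by move: uJ; rewrite J0 unitmxE det0 unitr0.
Qed.

(** Otherwise the centre of ['O_l(H)] contains an element of order [l], which is irreducible; the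
    centre is then cyclic, and this element generates a normal subgroup of [H]. *)
Lemma pcore_prim1 l : primitive_prime p N l -> (1 < n)%N -> 'O_l(H) = 1%g.
Proof.
move=> pl n_gt1; have pr_l := prim_prime pl.
apply/eqP; apply: contraT => ntL; set L := 'O_l(H)%G.
have lL : l.-group L := pcore_pgroup l H.
have sLH : L \subset H := pcore_sub l H.
have ntZ : 'Z(L) != 1%g by rewrite center_nil_eq1 // (pgroup_nil lL).
have lZ : l.-group 'Z(L) := pgroupS (center_sub L) lL.
have [_ dv _] := pgroup_pdiv lZ ntZ.
have [z Zz oz] := Cauchy pr_l dv.
have Hz : z \in H by rewrite (subsetP sLH) // (subsetP (center_sub L)).
have irr := prim_irr pr_p ffulH pl Hz oz.
have sZH : 'Z(L) \subset H by apply: subset_trans sLH; apply: center_sub.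
have frZ : mxfree rH 'Z(L).
  move=> a Za; apply: (irr_cent_free ffulH Hz irr); rewrite inE (subsetP sZH) //=.
  by apply/cent1P; apply: (centsP (center_abelian L)).
have /cyclicP[y Dy] := free_cyclic (A := 'Z(L)%G) sZH (center_abelian L) frZ.
have nz : H \subset 'N(<[z]>).
  have chz : <[z]> \char 'Z(L).
    by rewrite Dy; apply: cycle_subgroup_char; rewrite -Dy cycle_subG.
  apply: char_norm_trans (char_trans chz (center_char L)) _.
  exact: gFnorm.
by have := normal_prim_cycle_false pr_p ffulH uJ invJ DN n_gt1 pl Hz oz nz trans_card.
Qed.

Section PrimElt.
Variables (l : nat) (x : hT).
Hypotheses (n_gt1 : (1 < n)%N) (pl : primitive_prime p N l) (Hx : x \in H) (ox : #[x] = l).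

(** If [x] centralised ['F(H)], it would lie in ['F(H)], hence in ['O_l(H) = 1]. *)
Lemma prim_pcore_ncent : exists r, [/\ prime r, r != p, r != l & x \notin 'C('O_r(H))].
Proof.
have pr_l := prim_prime pl.
case: (boolP (x \in 'C('F(H)))) => [cFx|].
  have Fx : x \in 'F(H) by rewrite (subsetP (sub_cent_Fitting solH)) // inE Hx.
  have : x \in 'O_l('F(H)).
    rewrite (mem_normal_Hall (nilpotent_pcore_Hall l (Fitting_nil H))) ?pcore_normal //.
    by rewrite /p_elt ox pnat_id.
  rewrite p_core_Fitting pcore_prim1 // inE => /eqP x1.
  by move: pr_l; rewrite -ox x1 order1.
move=> ncF; have [r pr_r ncr] : exists2 r, prime r & x \notin 'C('O_r(H)).
  case: (boolP [exists r : 'I_#|H|.+1, prime r && (x \notin 'C('O_r(H)))]) => [/existsP[r /andP[? ?]]|].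
    by exists r.
  rewrite negb_exists => /forallP cen; case/negP: ncF.
  rewrite -sub_cent1 FittingEgen gen_subG; apply/bigcupsP => r.
  rewrite mem_primes => /and3P[pr_r _ _].
  by have := cen r; rewrite pr_r negbK sub_cent1.
exists r; split=> //; apply: contraNneq ncr => ->.
  by rewrite -sub_cent1 trans_pcore1 sub1G.
by rewrite -sub_cent1 pcore_prim1 // sub1G.
Qed.

Lemma prim_pcore2_extraspecial (T := 'O_2(H)%G) :
  [/\ l = N.+1, p != 2%N, extraspecial T, #|T| = (2 * (N * N))%N & 'C_T[x] = 'Z(T)]
  /\ 'C_H(T) = 'Z(T).
Proof.
have [r [pr_r nrp nrl ncx]] := prim_pcore_ncent.
have rR := pcore_pgroup r H; have sRH := pcore_sub r H.
have nRx : x \in 'N('O_r(H)) by rewrite (subsetP (gFnorm _ _)).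
have N_gt1 : (1 < N)%N by rewrite DN; case: (n) n_gt1 => [|[|k]].
have [r2 lN esT0 oT0 CT0] := prim_coprime_extraspecial pr_p ffulH pl Hx ox N_gt1 rR pr_r nrp nrl sRH nRx ncx.
subst r; set R := 'O_2(H)%G in rR sRH nRx ncx esT0 oT0 CT0 T *.
set T0 := [~: R, <[x]>]%G in esT0 oT0 CT0.
have nRX : <[x]> \subset 'N(R) by rewrite cycle_subG.
have sT0R : T0 \subset R by rewrite commg_subl.
have sT0H := subset_trans sT0R sRH.
have r2T := pgroupS sT0R rR.
have p'T : p^'.-group T0 by apply: sub_pgroup r2T => q /eqP ->; rewrite !inE.
have oZ : #|'Z(T0)| = 2%N := card_center_extraspecial r2T esT0.
have [[PhiZ T'Z] _] := esT0.
have frZ : mxfree rH 'Z(T0).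
  move=> a Za; apply: (irr_cent_free ffulH Hx (prim_irr pr_p ffulH pl Hx ox)).
  rewrite inE (subsetP (subset_trans (center_sub _) sT0H)) //=.
  by move: Za; rewrite -CT0 => /setIP[].
have [k k_gt0 oTk] := card_extraspecial r2T esT0.
have Nk : N = (2 ^ k)%N.
  move: oTk; rewrite oT0 expnS => /eqP; rewrite eqn_pmul2l // -addnn expnD => /eqP E.
  by apply/eqP; rewrite -(@eqn_exp2r _ _ 2) // -!mulnn E.
have absT : mx_absolutely_irreducible (subg_repr rH sT0H).
  apply: class2_abs_irr => //; first by rewrite T'Z.
  by rewrite -divgS ?center_sub // oZ oT0 mulKn.
(* [|T0 : 'Z(T0)|] is [N ^ 2], so [T0] spans all matrices. Its centraliser is scalar, and a scalar
   preserving [J] is 1 or -1. *)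
have CHT : 'C_H(T0) = 'Z(T0).
  apply/eqP; rewrite eq_sym eqEcard setSI //= oZ.
  have sc c : c \in 'C_H(T0) -> exists2 a, rH c = a%:M & a ^+ 2 = 1.
    case/setIP=> Hc /centP cT; have : centgmx (subg_repr rH sT0H) (rH c).
      apply/centgmxP => t Tt /=; have Ht := subsetP sT0H t Tt.
      by rewrite -!repr_mxM // cT.
    move/(mx_abs_irr_cent_scalar absT)/is_scalar_mxP => [a Da].
    by exists a => //; apply: scalar_pm1 Da.
  have inj2 : {in 'C_H(T0) &, injective (fun c => rH c 0 0)}.
    move=> c d Cc Cd; have [a Da _] := sc c Cc; have [b Db _] := sc d Cd.
    rewrite Da Db !mxE eqxx !mulr1n => ab; apply: (rH_inj ffulH).
    - by case/setIP: Cc.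
    - by case/setIP: Cd.
    by rewrite Da Db ab.
  rewrite -(card_in_imset inj2).
  apply: (@leq_trans #|[set 1; -1 : 'F_p]|); last by rewrite cards2; case: (_ != _).
  apply: subset_leq_card; apply/subsetP => _ /imsetP[c Cc ->].
  have [a -> a2] := sc c Cc; rewrite !mxE eqxx mulr1n !inE -eqf_sqr.
  by rewrite a2 expr1n.
(* If [[~: T0, R]], a proper subgroup of [T0] stable under [x], were larger than ['Z(T0)], then
   [l = 2 ^ k + 1] would divide some [2 ^ d - 1] with [0 < d < 2k]. So it is central, and [R] is the
   product of [T0] and its centraliser in [R]. *)
have TR : T0 :=: R.
  pose K := [~: T0, R]%G.
  have nT0R : R \subset 'N(T0) by rewrite commg_norml.
  have ntT0 : T0 :!=: 1%g by rewrite -cardG_gt1 oT0; case: (n').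
  have prK : K \proper T0 by apply: (nil_comm_properl (pgroup_nil rR)); rewrite // subsetI subxx.
  have sKT := proper_sub prK.
  have nKx : <[x]> \subset 'N(K) by rewrite normsR // cycle_subG -cycle_subG commg_normr.
  have sKZ : K \subset 'Z(T0).
    case: (eqVneq (K : {set hT}) 1%g) => [->|ntK]; first by rewrite sub1G.
    have nKT : K <| T0 by rewrite /normal sKT commg_norml.
    have ntKZ : K :&: 'Z(T0) != 1%g by apply: meet_center_nil (pgroup_nil r2T) nKT ntK.
    have sZK : 'Z(T0) \subset K.
      apply/setIidPr; apply/eqP; rewrite eqEcard subsetIr /= oZ.
      by rewrite ltnNge -trivg_card_le1.
    have CK : 'C_K[x] = 'Z(T0).
      rewrite -(setIidPl sKT) -setIA CT0; exact/setIidPr.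
    have [a oK] : exists a, #|K| = (2 ^ a)%N.
      by case/p_natP: (pgroupS sKT r2T) => a Da; exists a.
    have lX : l.-group <[x]> by rewrite /pgroup -orderE ox pnat_id ?(prim_prime pl).
    have := conj_fix_mod lX nKx; rewrite cent_cycle CK oZ oK => /eqP.
    have a_gt0 : (0 < a)%N.
      by move: ntK; rewrite -cardG_gt1 oK; case: (a).
    have le2a : (2 <= 2 ^ a)%N by rewrite (@leq_exp2l 2 1 a).
    rewrite eqn_mod_dvd //.
    rewrite -{1}(prednK a_gt0) expnS -[X in (_ * _ - X)%N]muln1 -mulnBr Gauss_dvdr; last first.
      by rewrite prime_coprime ?(prim_prime pl) // dvdn_prime2 ?(prim_prime pl) // eq_sym.
    case: (posnP a.-1) => [a1 _|a1 dv].
      have a1' : a = 1%N by rewrite -(prednK a_gt0) a1.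
      have EKZ : 'Z(T0) = K by apply/eqP; rewrite eqEcard sZK oZ oK a1'.
      by rewrite EKZ.
    have lta : (a.-1 < k.*2)%N.
      rewrite -ltnS prednK // -(@ltn_exp2l 2) // -oK -oTk; exact: proper_card.
    have := @order_2_mod_Fermat k a.-1; rewrite a1 lta => /(_ isT).
    by rewrite -Nk -lN dv.
  have := critical_extraspecial rR sT0R esT0; rewrite T'Z => /(_ sKZ).
  case/cprodP=> _ <- _; apply/esym/mulGidPl.
  by apply: subset_trans (center_sub T0); rewrite -CHT setSI.
have ET : T0 = R by apply: group_inj.
rewrite /T -ET; split=> //; split=> //; by rewrite eq_sym.
Qed.

End PrimElt.

(* A subgroup of order divisible by [l ^ 2] would act semiregularly on
   ['O_2(H) / 'Z('O_2(H))], of order [(l - 1) ^ 2]. *)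
Lemma prim_Sylow_order l : (1 < n)%N -> primitive_prime p N l -> (logn l #|H| <= 1)%N.
Proof.
move=> n_gt1 pl; have pr_l := prim_prime pl; rewrite leqNgt; apply/negP => l2.
have [S sylS] := Sylow_exists l H; have [sSH lS _] := and3P sylS.
have l_dv : (l %| #|H|)%N by have := ltnW l2; rewrite logn_gt0 mem_primes => /and3P[].
have [x Hx ox] := Cauchy pr_l l_dv.
have [[lN p2 esT oT _] CHT] := prim_pcore2_extraspecial n_gt1 pl Hx ox.
set T := 'O_2(H)%G in esT oT CHT.
have r2T : 2.-group T := pcore_pgroup _ H.
have oZ : #|'Z(T)| = 2%N := card_center_extraspecial r2T esT.
have nTH : H \subset 'N(T) := gFnorm _ _.
have nZH : H \subset 'N('Z(T)) by apply: char_norm_trans nTH; apply: center_char.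
have odd_l : odd l.
  case: (even_prime pr_l) => // l2'; move: lN; rewrite l2' DN.
  by case: (n) n_gt1 => [|[|j]].
have coTS : coprime #|T| #|S|.
  by rewrite (pnat_coprime r2T) // (pi_pnat lS) // !inE; case: eqP odd_l => // ->.
have sr : semiregular (T / 'Z(T)) (S / 'Z(T)).
  move=> sb /setD1P[ntsb /morphimP[s nZs Ss Ds]]; rewrite {}Ds in ntsb *.
  have ls : l.-elt s := mem_p_elt lS Ss.
  have nts : s != 1%g by apply: contraNneq ntsb => ->; rewrite morph1.
  have [y Yy oy] : exists2 y, y \in <[s]> & #[y] = l.
    have nt : <[s]> != 1%g by rewrite cycle_eq1.
    by have [_ dv _] := pgroup_pdiv ls nt; have [y Yy oy] := Cauchy pr_l dv; exists y.
  have Sy : y \in S by apply: (subsetP _ _ Yy); rewrite cycle_subG.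
  have Hy := subsetP sSH y Sy.
  have [[_ _ _ _ CTy] _] := prim_pcore2_extraspecial n_gt1 pl Hy oy.
  apply/trivgP; rewrite /= -cent_cycle -quotient_cycle //.
  have sys : <[y]> \subset <[s]> by rewrite cycle_subG.
  apply: subset_trans (_ : 'C_(T / 'Z(T))(<[y]> / 'Z(T)) \subset _); first by rewrite setIS // centS // quotientS.
  have nZy : <[y]> \subset 'N('Z(T)) by rewrite cycle_subG (subsetP nZH).
  rewrite -coprime_quotient_cent ?center_sub ?(pgroup_sol r2T) //.
    by rewrite cent_cycle CTy trivg_quotient.
  by apply: coprimegS coTS; rewrite cycle_subG.
have oTZ : #|(T / 'Z(T))%g| = (N * N)%N.
  rewrite card_quotient ?(subset_trans (pcore_sub _ H)) // -divgS ?center_sub //.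
  by rewrite oZ oT mulKn.
have oSZ : #|(S / 'Z(T))%g| = #|S|.
  rewrite card_quotient ?(subset_trans sSH) // -divgI.
  rewrite (_ : S :&: 'Z(T) = 1%g) ?cards1 ?divn1 //.
  by rewrite setIC coprime_TIg // (coprimeSg (center_sub T)).
have nTS : (S / 'Z(T) \subset 'N(T / 'Z(T)))%g by rewrite quotient_norms // (subset_trans sSH).
have := regular_norm_dvd_pred nTS sr; rewrite oTZ oSZ.
have l2S : (l ^ 2 %| #|S|)%N by rewrite (card_Hall sylS) p_part dvdn_exp2l.
move/(dvdn_trans l2S).
have -> : (N * N).-1 = (l * (l - 2))%N by rewrite lN; clear; nia.
rewrite expnS expn1 dvdn_pmul2l ?prime_gt0 //.
have l_gt2 := odd_prime_gt2 odd_l pr_l.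
move/dvdn_leq; rewrite subn_gt0 l_gt2 => /(_ isT).
by clear -l_gt2; lia.
Qed.

Hypothesis exc : ~~ ((p == 2%N) && (N == 6%N)).

Lemma trans_symplectic_dim_gt2 (T := 'O_2(H)%G) : (1 < n)%N ->
  [/\ p = 3%N, N = 4%N, extraspecial T, #|T| = 32%N & 'C_H(T) = 'Z(T)]
  /\ (forall x, x \in H -> #[x] = 5%N -> 'C_T[x] = 'Z(T)).
Proof.
move=> n_gt1; have N_gt3 : (3 < N)%N by rewrite DN; case: (n) n_gt1 => [|[|k]] // _; rewrite !doubleS.
have [l pl] := Zsigmondy pr_p N_gt3 exc.
have pr_l := prim_prime pl.
have primC q : primitive_prime p N q -> exists2 x, x \in H & #[x] = q.
  by case=> pr_q qN _; have [y Hy oy] := Cauchy pr_q (dvdn_trans qN trans_card); exists y.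
have [x Hx ox] := primC l pl.
have [[lN p2 esT oT _] CHT] := prim_pcore2_extraspecial n_gt1 pl Hx ox.
have odd_p : odd p by case: (even_prime pr_p) => // p2'; rewrite p2' in p2.
have [k k_gt0 oTk] := card_extraspecial (pcore_pgroup _ H) esT.
have Nk : N = (2 ^ k)%N.
  move: oTk; rewrite oT expnS => /eqP; rewrite eqn_pmul2l // -addnn expnD => /eqP E.
  by apply/eqP; rewrite -(@eqn_exp2r _ _ 2) // -!mulnn E.
have nk : n = (2 ^ k.-1)%N.
  apply: double_inj; rewrite -DN Nk -{1}(prednK k_gt0) expnS mul2n //.
have even_n : ~~ odd n.
  rewrite nk oddX negb_or andbT -lt0n; move: n_gt1; rewrite nk.
  by case: (k.-1).
(* As [n] is even, [p ^ n] is an odd square, so [p ^ n + 1] is 2 modulo 4. *)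
have pn_mod : (~~ (4 %| (p ^ n).+1))%N.
  have -> : n = (n./2 * 2)%N by rewrite muln2 halfK (negPf even_n) subn0.
  rewrite expnM; have : odd (p ^ n./2) by rewrite oddX odd_p orbT.
  move: (p ^ n./2)%N => y odd_y; rewrite -(odd_double_half y) odd_y -muln2.
  rewrite (_ : ((true + y./2 * 2) ^ 2).+1 = (y./2 + y./2 ^ 2) * 4 + 2)%N; last first.
    by rewrite -[nat_of_bool true]/1%N; ring.
  by rewrite /dvdn modnMDl.
have odd_primes q : prime q -> odd q -> (q %| (p ^ n).+1)%N -> primitive_prime p N q.
  move=> pr_q odd_q qn; split=> //.
    have -> : (p ^ N - 1 = (p ^ n - 1) * (p ^ n).+1)%N.
      by rewrite DN -addnn expnD -[1%N]/(1 ^ 2)%N mulnn subn_sqr addn1.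
    exact: dvdn_mull.
  move=> j /andP[j_gt0 jN]; apply/negP => qj.
  have qN : (q %| p ^ N - 1)%N.
    by rewrite DN -addnn expnD -[1%N]/(1 ^ 2)%N mulnn subn_sqr addn1 dvdn_mull.
  have qd := dvdn_exp_sub1_gcd (prime_gt0 pr_p) j_gt0 qj qN.
  (* [N = 2n] is a power of 2, so every proper divisor of it divides [n]. Then [q] divides both
     [p ^ n - 1] and [p ^ n + 1], hence 2. *)
  have dn : (gcdn j N %| n)%N.
    have : (gcdn j N %| 2 ^ k)%N by rewrite -Nk dvdn_gcdr.
    case/(dvdn_pfactor _ _ (isT : prime 2)) => i ik Di; rewrite Di nk dvdn_Pexp2l //.
    have : (gcdn j N < N)%N by apply: leq_ltn_trans jN; rewrite dvdn_leq // dvdn_gcdl.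
    by rewrite Di Nk ltn_exp2l // -(prednK k_gt0) ltnS prednK.
  have qn1 : (q %| p ^ n - 1)%N.
    case/dvdnP: dn => c ->; rewrite mulnC expnM.
    apply: dvdn_trans qd _; set y := (p ^ _)%N.
    by rewrite -[X in (_ %| _ - X)%N](exp1n c) subn_exp dvdn_mulr.
  have : (q %| (p ^ n).+1 - (p ^ n - 1))%N by rewrite dvdn_sub.
  rewrite -addn1 subnBA ?expn_gt0 ?prime_gt0 // -addnA addKn dvdn_prime2 // => /eqP q2.
  by rewrite q2 in odd_q.
have lval q : primitive_prime p N q -> q = l.
  move=> pq; have [y Hy oy] := primC q pq.
  by have [[qN _ _ _ _] _] := prim_pcore2_extraspecial n_gt1 pq Hy oy; rewrite qN lN.
have mH : ((p ^ n).+1 %| #|H|)%N.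
  apply: dvdn_trans trans_card.
  by rewrite DN -addnn expnD -[1%N]/(1 ^ 2)%N mulnn subn_sqr addn1 dvdn_mull.
have dv2l : ((p ^ n).+1 %| 2 * l)%N.
  rewrite -(partnC 2%N (ltn0Sn (p ^ n)%N)) dvdn_mul //.
    rewrite p_part -[X in (_ %| X)%N]expn1 dvdn_Pexp2l // leqNgt.
    by rewrite -pfactor_dvdn.
  have lm : l.-nat ((p ^ n).+1`_2^')%N.
    apply/pnatP => // q pr_q qm.
    have q2 : q \in 2%N^' by apply: (pnatP _ _ (part_pnat _ _)) qm.
    rewrite inE; apply/eqP/lval/odd_primes => //.
      by case: (even_prime pr_q) q2 => // ->.
    exact: dvdn_trans qm (dvdn_part _ _).
  rewrite -(part_pnat_id lm) p_part -[X in (_ %| X)%N]expn1 dvdn_Pexp2l ?prime_gt1 //.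
  apply: leq_trans (prim_Sylow_order n_gt1 pl).
  by apply: dvdn_leq_log => //; apply: dvdn_trans (dvdn_part _ _) mH.
(* [p ^ n + 1] divides [2 * l] with [l = 2n + 1]; for odd [p] and [n > 1] this leaves only
   [3 ^ 2]. *)
have le : (p ^ n <= 4 * n + 1)%N.
  have := dvdn_leq _ dv2l; rewrite muln_gt0 (prime_gt0 pr_l) => /(_ isT).
  by rewrite lN DN -muln2; clear; lia.
have p_gt2 : (2 < p)%N := odd_prime_gt2 odd_p pr_p.
have n2 : n = 2%N.
  apply/eqP; rewrite eqn_leq n_gt1 andbT leqNgt; apply/negP => n3.
  have : (3 ^ n <= 4 * n + 1)%N by apply: leq_trans le; rewrite leq_exp2r // ltnW.
  rewrite leqNgt => /negP[].
  elim: {le}(n) n3 => // j IH; rewrite ltnS leq_eqVlt => /orP[/eqP<- //|/IH].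
  by rewrite expnS; move: (3 ^ j)%N => y; clear; lia.
have p3 : p = 3%N.
  apply/eqP; rewrite eqn_leq p_gt2 andbT -(@leq_exp2r _ _ 2) //.
  by move: le; rewrite n2.
have N4 : N = 4%N by rewrite DN n2.
have l5 : l = 5%N by rewrite lN N4.
split; first by split=> //; rewrite oT N4.
move=> y Hy oy; have py : primitive_prime p N 5%N by rewrite -l5.
by have [[_ _ _ _ ->] _] := prim_pcore2_extraspecial n_gt1 py Hy oy.
Qed.
End TransitiveSymplectic.

(** * Normal abelian subgroups of transitive linear groups *)

Section TransFree.
Local Open Scope ring_scope.
Variables (p n' : nat).
Local Notation N := n'.+1.
Variables (hT : finGroupType) (H : {group hT}) (rH : mx_representation 'F_p H N).
Hypotheses (pr_p : prime p) (ffulH : mx_faithful rH).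
Hypothesis transH : forall u v : 'rV['F_p]_N, u != 0 -> v != 0 -> exists2 h, h \in H & v = u *m rH h.

(** Suppose [h] moves a maximal [B] with a fixed vector [v != 0]. By transitivity [v + v *m rH h] is
    fixed by some conjugate [B :^ g]; its averages over [B] and [B :^ h] are [v] and [v *m rH h],
    both nonzero, so [B :^ g] equals both groups. Hence [B] is normal, and irreducibility makes its
    fixed space everything. *)
Lemma trans_abelian_free (A : {group hT}) : A <| H -> abelian A -> p^'.-group A -> mxfree rH A.
Proof.
move=> nsAH cAA p'A a Aa nt_a; apply: contraT => /negbTE nunit.
have [sAH nAH] := andP nsAH.
have [B maxB Ba] := maxfix_exists sAH Aa nunit.
have [/= /andP[sBA nzB] _] := maxgroupP maxB; have sBH := subset_trans sBA sAH.
have maxBh h : h \in H -> maxfix rH A (B :^ h)%G.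
  by move=> Hh; apply: maxfix_conj => //; apply: (subsetP nAH).
pose v := nz_row (rfix_mx rH B).
have nzv : v != 0 by rewrite nz_row_eq0.
have fv : (v <= rfix_mx rH B)%MS by apply: nz_row_sub.
have fvh h : h \in H -> (v *m rH h <= rfix_mx rH (B :^ h)%G)%MS.
  by move=> Hh; rewrite /= (rfix_mx_conjsg rH Hh sBH) submxMr.
have orth (C D : {group hT}) (w : 'rV_N) : maxfix rH A C -> maxfix rH A D -> C :!=: D ->
    (w <= rfix_mx rH C)%MS -> w *m avg rH D = 0 by apply: maxfix_orth.
have avgE (C : {group hT}) (w : 'rV_N) : maxfix rH A C -> (w <= rfix_mx rH C)%MS -> w *m avg rH C = w.
  exact: maxfix_avg.
have nsBH : B <| H.
  rewrite /normal sBH; apply/subsetP => h Hh; apply/normP/eqP; apply: contraT => nBh.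
  have nzw : v *m rH h != 0.
    by apply: contraNneq nzv => vh0; rewrite -(repr_mxK rH Hh v) vh0 mul0mx.
  have nBh' : B :!=: (B :^ h)%G by rewrite eq_sym.
  have E1 : (v + v *m rH h) *m avg rH B = v.
    by rewrite mulmxDl (avgE _ _ maxB fv) (orth _ _ _ (maxBh h Hh) maxB nBh (fvh h Hh)) addr0.
  have E2 : (v + v *m rH h) *m avg rH (B :^ h) = v *m rH h.
    rewrite mulmxDl (orth _ _ _ maxB (maxBh h Hh) nBh' fv) add0r.
    exact: avgE (maxBh h Hh) (fvh h Hh).
  have nz : v + v *m rH h != 0 by apply: contraNneq nzv => E; rewrite -E1 E mul0mx.
  have [g Hg Dg] := transH nzv nz.
  have fg := fvh g Hg; rewrite -Dg in fg.
  have gB : B :^ g = B.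
    apply/eqP; apply: contraT => ngB.
    by rewrite -E1 (orth _ _ _ (maxBh g Hg) maxB ngB fg) eqxx in nzv.
  case/eqP: nBh; rewrite -{2}gB; apply/esym/eqP; apply: contraT => ngh.
  by rewrite -E2 (orth _ _ _ (maxBh g Hg) (maxBh h Hh) ngh fg) eqxx in nzw.
have fullB : row_full (rfix_mx rH B).
  by have /mx_irrP[_] := trans_irr transH; apply => //; apply: normal_rfix_mx_module.
by move: nt_a; rewrite -in_set1 -[[set 1%g]](rfix_eq0_trivial ffulH sBH fullB) Ba.
Qed.

End TransFree.

Lemma card_dvd_GL (F : finFieldType) (gT : finGroupType) (G : {group gT}) n'
  (rG : mx_representation F G n'.+1) : mx_faithful rG -> #|G| %| #|'GL_n'.+1[F]|.
Proof.
move=> ffulG; have inj : 'injm (reprGLm rG) by rewrite ker_reprGLm.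
by rewrite -(card_injm inj (subxx G)) cardSg // subsetT.
Qed.

(** * The exceptional case p = 2, 2n = 6 *)

Section Dim6NormalSylow7.
Local Open Scope ring_scope.
Local Notation p := 2%N.
Local Notation N := 6%N.
Variables (hT : finGroupType) (H : {group hT}) (rH : mx_representation 'F_p H N) (J : 'M['F_p]_N).
Hypotheses (ffulH : mx_faithful rH) (solH : solvable H).
Hypothesis transH : forall u v : 'rV['F_p]_N, u != 0 -> v != 0 -> exists2 h, h \in H & v = u *m rH h.
Hypotheses (uJ : J \in unitmx) (invJ : forall h, h \in H -> rH h *m J *m (rH h)^T = J).

Let P1 : {poly 'F_2} := 'X^3 + 'X + 1.
Let P2 : {poly 'F_2} := 'X^3 + 'X^2 + 1.

(* ['X^7 - 1] factors over ['F_2] as [('X - 1) * P1 * P2].  Conjugates of [b]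
   are powers of [b], so that a vector conjugate to [v + w], with [v] and [w]
   in the kernels of [P1] and [P2], cannot lie in either kernel. *)
Lemma normal7_false b : b \in H -> #[b] = 7%N -> H \subset 'N(<[b]>) -> False.
Proof.
move=> Hb ob nb; have sBH : <[b]> \subset H by rewrite cycle_subG.
have frB : mxfree rH <[b]>.
  apply: (trans_abelian_free (isT : prime 2) ffulH transH); rewrite /normal ?sBH ?cycle_abelian //.
  by rewrite /pgroup -orderE ob.
set M := rH b; have M7 : M ^+ 7 = 1 by rewrite -repr_mxX // -ob expg_order repr_mx1.
have two0 : 2%:R = 0 :> 'M['F_2]_6.
  by rewrite -(scaler_nat 2 1) (_ : 2%:R = 0 :> 'F_2) ?scale0r //; apply/eqP.
have uM : M \is a GRing.unit := repr_mx_unitr rH Hb.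
have uM1 : M - 1 \is a GRing.unit.
  apply: frB; rewrite ?cycle_id //; apply: contraTneq isT => b1.
  by rewrite b1 order1 in ob.
have hP1 X : horner_mx X P1 = X ^+ 3 + X + 1 :> 'M['F_2]_6.
  by rewrite /P1 !rmorphD !rmorphXn /= horner_mx_X rmorph1.
have hP2 X : horner_mx X P2 = X ^+ 3 + X ^+ 2 + 1 :> 'M['F_2]_6.
  by rewrite /P2 !rmorphD !rmorphXn /= horner_mx_X rmorph1.
have add2 (X : 'M['F_2]_6) : X + X = 0 by rewrite -mulr2n -mulr_natl two0 mul0r.
have poly2 : 2%:R = 0 :> {poly 'F_2}.
  by rewrite -polyC_natr (_ : 2%:R = 0 :> 'F_2) //; apply/eqP.
have P12 : horner_mx M P1 * horner_mx M P2 = 0.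
  apply: (mulrI uM1); rewrite mulr0.
  have E : ('X - 1) * (P1 * P2) = 'X^7 - 1.
    have -> : ('X - 1) * (P1 * P2) = 'X^7 - 1 + 2%:R * ('X^3 * ('X - 1)) by rewrite /P1 /P2; ring.
    by rewrite poly2 mul0r addr0.
  have := congr1 (horner_mx M) E; rewrite !rmorphM !rmorphB !rmorph1 rmorphXn /= horner_mx_X.
  by rewrite M7 subrr.
have comP (P Q : {poly 'F_2}) : horner_mx M P * horner_mx M Q = horner_mx M Q * horner_mx M P.
  by rewrite -!rmorphM mulrC.
have coker (A B : 'M['F_2]_6) (u : 'rV['F_2]_6) k : A * B = B * A -> B - A \is a GRing.unit ->
    u *m A = 0 -> u *m B ^+ k = 0 -> u = 0.
  move=> cAB uAB; elim: k u => [|k IH] u u1; first by rewrite expr0 mulmx1.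
  rewrite exprS mulmxA => u2; have u2' : u *m B = 0.
    apply: IH => //; rewrite -mulmxA -[B *m A]/(B * A) -cAB.
    by rewrite -[A * B]/(A *m B) mulmxA u1 mul0mx.
  have uBA0 : u *m (B - A) = 0 by rewrite mulmxBr u2' u1 subrr.
  move: (congr1 (mulmx^~ (B - A)^-1) uBA0); rewrite /= mul0mx -mulmxA.
  by rewrite -[_ *m _^-1]/(_ * _) mulrV // mulmx1.
have D12 : horner_mx M P2 - horner_mx M P1 = M * (M - 1).
  have E : P2 - P1 = 'X * ('X - 1) by rewrite /P1 /P2; ring.
  have := congr1 (horner_mx M) E; rewrite !rmorphM !rmorphB !rmorph1 /= horner_mx_X.
  by [].
have u12 : horner_mx M P2 - horner_mx M P1 \is a GRing.unit by rewrite D12 unitrMr.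
have u21 : horner_mx M P1 - horner_mx M P2 \is a GRing.unit by rewrite -opprB unitrN.
have M3 : horner_mx (M ^+ 3) P1 = horner_mx M P2.
  rewrite hP1 hP2 -exprM -[(3 * 3)%N]/(7 + 2)%N exprD M7 mul1r.
  by rewrite [_ + M ^+ 3]addrC.
have Fr X : horner_mx (X ^+ 2) P1 = horner_mx X P1 ^+ 2 := horner_mx_Frobenius (isT : prime 2) X P1.
(* The exponents 1, 2, 4, squares modulo 7, keep [P1] up to Frobenius; the nonsquares 3, 5, 6 turn
   it into [P2]. *)
have conjP h : h \in H -> exists k, horner_mx (rH (b ^ h)%g) P1 = horner_mx M P1 ^+ k.+1 \/
    horner_mx (rH (b ^ h)%g) P1 = horner_mx M P2 ^+ k.+1.
  move=> Hh; have : (b ^ h)%g \in <[b]> by rewrite memJ_norm ?cycle_id // (subsetP nb).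
  case/cyclePmin=> i; rewrite ob => i7 Di; rewrite Di repr_mxX //.
  case: i i7 Di => [|[|[|[|[|[|[|i]]]]]]] // _ Di.
  - by case/eqP: (isT : 7 != 1)%N; rewrite -ob -(orderJ b h) Di order1.
  - by exists 0%N; left; rewrite !expr1.
  - by exists 1%N; left; rewrite Fr.
  - by exists 0%N; right; rewrite M3 expr1.
  - by exists 3%N; left; rewrite (exprM M 2 2) Fr Fr -exprM.
  - exists 3%N; right; rewrite (_ : rH b ^+ 5 = ((M ^+ 3) ^+ 2) ^+ 2); last first.
      have -> : M ^+ 3 ^+ 2 ^+ 2 = M ^+ (7 + 5) by rewrite -!exprM; congr (_ ^+ _).
      by rewrite exprD M7 mul1r.
    by rewrite Fr Fr M3 -exprM.
  by exists 1%N; right; rewrite (exprM M 3 2) Fr M3.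
(* [J] makes [M] and its inverse annihilated by the same polynomials, and inversion exchanges [P1]
   and [P2], whose difference at [M] is invertible. *)
have both0 : horner_mx M P1 = 0 \/ horner_mx M P2 = 0 -> False.
  have inv c P : c \in H -> horner_mx (rH c) P = 0 -> horner_mx (rH c^-1%g) P = 0.
    by move=> Hc; apply: (invmx_root uJ (invJ Hc)).
  have b6 : rH b^-1%g = (M ^+ 3) ^+ 2.
    rewrite -exprM -repr_mxX //; congr (rH _); apply/eqP; rewrite eq_invg_mul -expgS -ob.
    by rewrite expg_order.
  have z : horner_mx M P1 = 0 -> False.
    move=> e; have := inv _ _ Hb e; rewrite b6 Fr M3 => e2.
    move: u12; rewrite e subr0 => u2; have := unitrX 2 u2.
    by rewrite e2 unitr0.
  case=> e; apply: z => //; rewrite /M -(invgK b); apply: inv; rewrite ?groupV //.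
  by rewrite b6 Fr M3 e expr0n.
case: (boolP (horner_mx M P1 \is a GRing.unit)) => [un|nun1].
  by apply: both0; right; apply: (mulrI un); rewrite P12 mulr0.
case: (boolP (horner_mx M P2 \is a GRing.unit)) => [un|nun2].
  by apply: both0; left; apply: (mulIr un); rewrite P12 mul0r.
have kerv (A : 'M['F_2]_6) : A \isn't a GRing.unit -> exists2 u : 'rV_6, u != 0 & u *m A = 0.
  move=> nA; have nk : kermx A != 0 by apply: contra nA => /eqP/unitmx_ker.
  exists (nz_row (kermx A)); rewrite ?nz_row_eq0 //.
  by apply/eqP; rewrite -sub_kermx nz_row_sub.
have [v nzv v1] := kerv _ nun1; have [w nzw w2] := kerv _ nun2.
have nzvw : v + w != 0.
  apply: contraNneq nzv => vw0; apply/eqP; apply: (coker _ _ v 1%N (comP P1 P2) u12) => //.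
  by rewrite expr1 (_ : v = - w) ?mulNmx ?w2 ?oppr0 //; apply/eqP; rewrite -addr_eq0 vw0.
have [g Hg Dg] := transH nzv nzvw.
have gk : (v + w) *m horner_mx (rH (b ^ g)%g) P1 = 0.
  rewrite Dg conjgE !repr_mxM ?groupM ?groupV // mulmxA repr_mxV //.
  rewrite horner_mx_uconjC ?repr_mx_unitr // !mulmxA mulmxK ?repr_mx_unit //.
  by rewrite v1 mul0mx.
have [k [Ek|Ek]] := conjP g Hg; rewrite Ek mulmxDl in gk.
  rewrite exprS !mulmxA [v *m _]v1 mul0mx add0r in gk.
  case/eqP: nzw; apply: (coker _ _ w k.+1 (comP P2 P1) u21) => //.
  by rewrite exprS mulmxA.
rewrite exprS !mulmxA [w *m _]w2 mul0mx addr0 in gk.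
case/eqP: nzv; apply: (coker _ _ v k.+1 (comP P1 P2) u12) => //.
by rewrite exprS mulmxA.
Qed.

End Dim6NormalSylow7.

Section Dim6Char2.
Local Open Scope ring_scope.
Variables (hT : finGroupType) (H : {group hT}) (rH : mx_representation 'F_2 H 6) (J : 'M['F_2]_6).
Hypotheses (ffulH : mx_faithful rH) (solH : solvable H).
Hypothesis transH : forall u v : 'rV['F_2]_6, u != 0 -> v != 0 -> exists2 h, h \in H & v = u *m rH h.
Hypotheses (uJ : J \in unitmx) (invJ : forall h, h \in H -> rH h *m J *m (rH h)^T = J).

(** Stabilisers of nonzero vectors have index 63, prime to [|H : D|] for a Hall {3, 7}-subgroup [D],
    so [D] is still transitive. The number of its Sylow 7-subgroups is [3 ^ i] with [i <= 4], the
    exponent of 3 in the order of GL(6, 2); as 3 has order 6 modulo 7, this number is 1. *)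
Lemma trans_symplectic_dim6_char2 : False.
Proof.
have cH : (63 %| #|H|)%N := trans_card (isT : prime 2) transH.
pose pi : nat_pred := [pred q : nat | (q == 3%N) || (q == 7%N)].
have [D hallD] := Hall_exists pi solH.
have [sDH piD pi'HD] := and3P hallD.
pose rD := subg_repr rH sDH.
have ffulD : mx_faithful rD := subg_mx_faithful sDH ffulH.
have solD := solvableS sDH solH.
have transD : forall v w : 'rV['F_2]_6, v != 0 -> w != 0 -> exists2 h, h \in D & w = v *m rD h.
  move=> v w nzv nzw; set Hv := 'C_H[v | 'MR rH]%G.
  have sHv : Hv \subset H by apply: subsetIl.
  have iHv : #|H : Hv| = 63%N.
    rewrite -card_orbit_in //; have -> : orbit ('MR rH)%act H v = [set~ 0].
      apply/setP => y; rewrite !inE; apply/orbitP/idP => [[h Hh <-]|nzy].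
        rewrite /= mx_repr_actE //; apply: contraNneq nzv => uh0.
        by rewrite -(repr_mxK rH Hh v) uh0 mul0mx.
      by have [h Hh ->] := transH nzv nzy; exists h; rewrite //= mx_repr_actE.
    by rewrite cardsC1 card_mx mul1n card_Fp.
  have co : coprime #|H : Hv| #|H : D|.
    by rewrite iHv (@pnat_coprime pi).
  have [h Hh Dw] := transH nzv nzw; have := coprime_index_mulG sHv sDH co.
  move/(congr1 (fun X : {set hT} => h \in X)); rewrite Hh => /mulsgP[s d Hvs Dd Dh].
  exists d => //; rewrite Dw Dh repr_mxM ?(subsetP sHv _ Hvs) ?(subsetP sDH) // mulmxA.
  congr (_ *m _); have Hs := subsetP sHv _ Hvs.
  by case/setIP: Hvs => _ sv; have := astab_act sv (set11 v); rewrite /= mx_repr_actE.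
have invD h : h \in D -> rD h *m J *m (rD h)^T = J by move=> Dh; apply: invJ; apply: (subsetP sDH).
have cD : (63 %| #|D|)%N := trans_card (isT : prime 2) transD.
have logn3 : (logn 3 #|D| <= 4)%N.
  apply: (@leq_trans (logn 3 #|'GL_6['F_2]|)).
    by apply: dvdn_leq_log; rewrite ?cardG_gt0 ?(card_dvd_GL ffulD).
  rewrite card_GL // card_Fp // /index_iota /= !big_cons big_nil.
  by rewrite !lognM // lognX.
have [S sylS] := Sylow_exists 7 D; have [sSD S7 _] := and3P sylS.
have nsSD : S <| D.
  rewrite /normal sSD; have [_ _ /(_ S sylS) cS _] := Sylow's_theorem 7 D.
  have := card_Syl_mod D (isT : prime 7); rewrite cS => k7.
  set k := #|D : _| in k7.
  have kD : (k %| #|D|)%N by apply: dvdn_indexg.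
  have k_gt0 : (0 < k)%N := indexg_gt0 _ _.
  have k3 : (3%N).-nat k.
    apply/pnatP => // q pr_q qk; have := pnatP _ (cardG_gt0 D) piD q pr_q (dvdn_trans qk kD).
    rewrite !inE => /orP[-> //|/eqP q7]; move: k7.
    by rewrite q7 in qk; move/eqP: qk => ->.
  have [i Di] := p_natP k3.
  have : (i <= 4)%N.
    apply: leq_trans logn3; rewrite -(pfactorK i (isT : prime 3)) -Di.
    by apply: dvdn_leq_log; rewrite ?cardG_gt0.
  move: k7; rewrite Di; case: i Di => [|[|[|[|[|i]]]]] // Dk _ _.
  by rewrite -subsetIidl -indexg_eq1 -/k Dk.
have ntS : S :!=: 1%g.
  rewrite -cardG_gt1 (card_Hall sylS) p_part -(expn0 7) ltn_exp2l // logn_gt0 mem_primes cardG_gt0 /=.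
  by apply: dvdn_trans cD.
have ntZ : 'Z(S) != 1%g by rewrite center_nil_eq1 // (pgroup_nil S7).
have Z7 := pgroupS (center_sub S) S7.
have [_ dv _] := pgroup_pdiv Z7 ntZ.
have [b Zb ob] := Cauchy (isT : prime 7) dv.
have nsZD : 'Z(S) <| D := char_normal_trans (center_char S) nsSD.
have frZ : mxfree rD 'Z(S).
  apply: (trans_abelian_free (isT : prime 2) ffulD transD) => //; first exact: center_abelian.
  by apply: sub_pgroup Z7 => q /eqP->.
have /cyclicP[y Dy] := free_cyclic (A := 'Z(S)%G) (normal_sub nsZD) (center_abelian S) frZ.
apply: (normal7_false ffulD transD uJ invD _ ob).
  by rewrite (subsetP (normal_sub nsZD)).
have chb : <[b]> \char 'Z(S).
  by rewrite Dy; apply: cycle_subgroup_char; rewrite -Dy cycle_subG.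
exact: char_norm_trans chb (normal_norm nsZD).
Qed.

End Dim6Char2.

(** * Dimension 2 in odd characteristic *)

Section Matrix22.
Local Open Scope ring_scope.
Variable F : fieldType.
Implicit Types M X Y : 'M[F]_2.

Lemma ord2P (k : 'I_2) : k = 0 \/ k = 1.
Proof. by case: k => [[|[|k]]] //= lk; [left|right]; apply: val_inj. Qed.

Lemma mx2P M X : [/\ M 0 0 = X 0 0, M 0 1 = X 0 1, M 1 0 = X 1 0 & M 1 1 = X 1 1] -> M = X.
Proof.
case=> e00 e01 e10 e11; apply/matrixP => i j.
by case: (ord2P i) => ->; case: (ord2P j) => ->.
Qed.

Lemma mulmx2E M X i j : (M *m X) i j = M i 0 * X 0 j + M i 1 * X 1 j.
Proof.
rewrite !mxE !big_ord_recl big_ord0 addr0.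
by have -> : lift ord0 ord0 = 1 :> 'I_2 by apply: val_inj.
Qed.

(** In dimension 2, [M *m J *m M^T] is the determinant of [M] times the skew matrix [J]. *)
Lemma det1_of_form M J : J^T = - J -> 2%:R != 0 :> F -> J \in unitmx -> M *m J *m M^T = J ->
  M 0 0 * M 1 1 - M 0 1 * M 1 0 = 1.
Proof.
move=> skew two uJ inv.
have sk i j : J j i = - J i j by have := congr1 (fun A : 'M_2 => A i j) skew; rewrite !mxE.
have d0 i : J i i = 0.
  have /eqP := sk i i; rewrite -subr_eq0 opprK -mulr2n -mulr_natl mulf_eq0 (negPf two).
  by move/eqP.
have nz : J 0 1 != 0.
  apply: contraTneq uJ => j01; have -> : J = 0.
    by apply: mx2P; rewrite !mxE !d0 (sk 0 1) j01 oppr0.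
  by rewrite unitmxE det0 unitr0.
have := congr1 (fun A : 'M_2 => A 0 1) inv; rewrite /= !mulmx2E ![M^T _ _]mxE !d0 (sk 0 1).
move=> E; apply: (mulIf nz); rewrite mul1r -[RHS]E; ring.
Qed.

Lemma det_mx22 M : \det M = M 0 0 * M 1 1 - M 0 1 * M 1 0.
Proof.
have E : lift ord0 ord0 = 1 :> 'I_2 by apply: val_inj.
have E' : lift 1 (0 : 'I_1) = 0 :> 'I_2 by apply: val_inj.
rewrite (expand_det_row _ 0) !big_ord_recl big_ord0 addr0 E /cofactor !det_mx11 !mxE /= E E'.
by rewrite expr0 expr1 mul1r mulN1r mulrN.
Qed.

Lemma cayley2 M : M 0 0 * M 1 1 - M 0 1 * M 1 0 = 1 ->
  M *m M = (M 0 0 + M 1 1) *: M - 1%:M.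
Proof.
move=> d1; apply: mx2P; rewrite !mulmx2E !mxE /= !mulr1n !mulr0n -d1; split; ring.
Qed.

(** Both (u, v, w) and (u', v', w') have zero cross product with the nonzero vector (a, b, c), so
    they are proportional. *)
Lemma cross_products_eq (a b c u v w u' v' w' : F) : [|| a != 0, b != 0 | c != 0] ->
  v * c = b * w -> u * b = v * a -> u * c = w * a ->
  v' * c = b * w' -> u' * b = v' * a -> u' * c = w' * a ->
  [/\ v * w' = w * v', u * v' = v * u' & u * w' = w * u'].
Proof.
have E0 (k y z y' z' : F) : k != 0 -> y * z' = y' * z -> k * y = 0 -> y = 0.
  by move=> nk _ /eqP; rewrite mulf_eq0 (negPf nk) => /eqP.
move=> nz h1 h2 h3 h1' h2' h3'.
have D (k y z : F) : k != 0 -> k * (y - z) = 0 -> y = z.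
  by move=> nk /eqP; rewrite mulf_eq0 (negPf nk) subr_eq0 => /eqP.
have z1 : v * c - b * w = 0 by rewrite h1 subrr.
have z2 : u * b - v * a = 0 by rewrite h2 subrr.
have z3 : u * c - w * a = 0 by rewrite h3 subrr.
have z1' : v' * c - b * w' = 0 by rewrite h1' subrr.
have z2' : u' * b - v' * a = 0 by rewrite h2' subrr.
have z3' : u' * c - w' * a = 0 by rewrite h3' subrr.
case/or3P: nz => nk; split; apply: (D _ _ _ nk).
- transitivity (- (u * (v' * c - b * w')) - (w' * (u * b - v * a)) + v' * (u * c - w * a)).
    ring.
  by rewrite z1' z2 z3 !mulr0 !addr0 !oppr0 ?addr0.
- transitivity (- (u * (u' * b - v' * a)) + u' * (u * b - v * a)); first ring.
  by rewrite z2 z2' !mulr0 oppr0 addr0.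
- transitivity (- (u * (u' * c - w' * a)) + u' * (u * c - w * a)); first ring.
  by rewrite z3 z3' !mulr0 oppr0 addr0.
- transitivity (- (v * (v' * c - b * w')) + v' * (v * c - b * w)); first ring.
  by rewrite z1 z1' !mulr0 oppr0 addr0.
- transitivity (- (v * (u' * b - v' * a)) + v' * (u * b - v * a)); first ring.
  by rewrite z2 z2' !mulr0 oppr0 addr0.
- transitivity (w' * (u * b - v * a) + u' * (v * c - b * w) - v * (u' * c - w' * a)); first ring.
  by rewrite z2 z1 z3' !mulr0 oppr0 !addr0.
- transitivity (- (w * (v' * c - b * w')) * 1 + w' * (v * c - b * w)); first ring.
  by rewrite z1 z1' !mulr0 oppr0 mul0r addr0.
- have vw : w * v' - v * w' = 0.
    apply/eqP; rewrite subr_eq0; apply/eqP/(D _ _ _ nk).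
    transitivity (w * (v' * c - b * w') - w' * (v * c - b * w)); first ring.
    by rewrite z1 z1' !mulr0 oppr0 addr0.
  transitivity (v' * (u * c - w * a) - v * (u' * c - w' * a) + a * (w * v' - v * w')); first ring.
  by rewrite z3 z3' vw !mulr0 oppr0 !addr0.
- transitivity (- (w * (u' * c - w' * a)) + w' * (u * c - w * a)); first ring.
  by rewrite z3 z3' !mulr0 oppr0 addr0.
Qed.

(** Two 2 by 2 matrices commute when their triples (difference of the diagonal entries, two
    off-diagonal entries) are proportional, and the triple of [M] is nonzero. *)
Lemma nonscalar_cent_comm M X Y : ~~ is_scalar_mx M -> X *m M = M *m X -> Y *m M = M *m Y ->
  X *m Y = Y *m X.
Proof.
move=> nsM XM YM.
have nz : [|| M 0 0 - M 1 1 != 0, M 0 1 != 0 | M 1 0 != 0].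
  apply: contraR nsM; rewrite !negb_or !negbK subr_eq0 => /and3P[/eqP ad /eqP b0 /eqP c0].
  by apply/is_scalar_mxP; exists (M 0 0); apply: mx2P; rewrite !mxE /= b0 c0 ad.
have e A i j : A *m M = M *m A -> (A *m M) i j - (M *m A) i j = 0 by move->; rewrite subrr.
have S0 (y z t : F) : t = 0 -> y - z = t -> y = z by move=> -> /eqP; rewrite subr_eq0 => /eqP.
have N0 (t : F) : t = 0 -> - t = 0 by move->; rewrite oppr0.
have H A : A *m M = M *m A -> [/\ A 0 1 * M 1 0 = M 0 1 * A 1 0,
     (A 0 0 - A 1 1) * M 0 1 = A 0 1 * (M 0 0 - M 1 1)
   & (A 0 0 - A 1 1) * M 1 0 = A 1 0 * (M 0 0 - M 1 1)].
  move=> AM; split; [apply: (S0 _ _ _ (e A 0 0 AM)) | apply: (S0 _ _ _ (e A 0 1 AM))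
                   | apply: (S0 _ _ _ (N0 _ (e A 1 0 AM)))]; rewrite !mulmx2E; ring.
have [h1 h2 h3] := H X XM; have [h1' h2' h3'] := H Y YM.
have [c1 c2 c3] := cross_products_eq nz h1 h2 h3 h1' h2' h3'.
have d (y z : F) : y = z -> y - z = 0 by move->; rewrite subrr.
apply: mx2P; rewrite !mulmx2E; split; apply: (S0 _ _ _ _).
- by apply: (d _ _ c1).
- ring.
- by apply: (d _ _ c2).
- ring.
- by apply: (N0 _ (d _ _ c3)).
- ring.
- by apply: (N0 _ (d _ _ c1)).
- ring.
Qed.
End Matrix22.

Lemma uniq_involution_pgroup (gT : finGroupType) (T : {group gT}) : 2.-group T -> T :!=: 1%g ->
  {in T &, forall a b, #[a] = 2 -> #[b] = 2 -> a = b} ->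
  cyclic T \/ exists2 n, n > 2 & T \isog 'Q_(2 ^ n).
Proof.
move=> pT ntT uT; have [_ d2T _] := pgroup_pdiv pT ntT.
have [//|z Tz oz] := Cauchy _ d2T.
have : #|'Ohm_1(T)| = 2.
  have -> : 'Ohm_1(T) = <[z]>.
    apply/eqP; rewrite eqEsubset (OhmE _ pT) gen_subG; apply/andP; split.
      apply/subsetP => t; rewrite !inE => /andP[Tt t2].
      have [->|nt] := eqVneq t 1; first exact: group1.
      by rewrite (uT t z) ?cycle_id // (@nt_prime_order _ 2 _ _ _ nt) //; apply/eqP.
    by rewrite cycle_subG mem_gen // !inE Tz -oz expg_order eqxx.
  by rewrite -orderE.
move/(prime_Ohm1P pT ntT) => /orP[|/andP[_ /eqP/quaternion_classP]]; by [left|right].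
Qed.

Lemma quaternion_gens (gT : finGroupType) (T : {group gT}) : T \isog 'Q_8 ->
  exists x y, [/\ #|T| = 8, x \in T /\ y \in T, #[x] = 4 /\ #[y] = 4,
    [/\ y \notin <[x]>, x ^ y = x^-1, y ^+ 2 = x ^+ 2 & <[x]> * <[y]> = T :> {set gT}]
    & [/\ forall u, u \in T -> #[u] = 2 -> u = x ^+ 2, 'Z(T) = <[x ^+ 2]> & cyclic T^`(1)] ].
Proof.
move=> iQ; have [[x y] genT [oy y2 xy]] := generators_quaternion (n := 3) isT iQ.
have [[DT _ _] [DT' _ _ _] [DZ _ invo _ _] _ _] := quaternion_structure (n := 3) isT genT iQ.
case: genT => oT Tx ox /setDP[Ty nXy].
exists x, y; split=> //.
  by split=> //; have [] := pprodP DT.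
by split=> //; rewrite DT' cycle_cyclic.
Qed.

(** Conjugation sends [x] to one of 6 elements of order 4, and its stabiliser sends [y] to one of
    the 4 elements outside [<[x]>]; what fixes both lies in ['Z(T)], of order 2. *)
Lemma normal_quaternion_bound (gT : finGroupType) (H T : {group gT}) : T <| H -> T \isog 'Q_8 ->
  'C_H(T) \subset T -> #|H| <= 48.
Proof.
case/andP=> sTH nTH iT cT.
have [x [y [oT [Tx Ty] [ox oy] [nXy xy y2 DT] [_ DZ _]]]] := quaternion_gens iT.
have Hx := subsetP sTH x Tx.
have T1 : 1 \in T := group1 T; have Tx2 : x ^+ 2 \in T by rewrite groupX.
have b1 : #|x ^: H| <= 6.
  have : x ^: H \subset T :\: [set 1; x ^+ 2].
    apply/subsetP => _ /imsetP[h Hh ->]; rewrite !inE memJ_norm ?(subsetP nTH) // Tx andbT.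
    apply/negP => /orP[]/eqP /(congr1 (@order gT)); rewrite orderJ ox ?order1 //.
    by rewrite orderXdiv ox.
  move/subset_leq_card/leq_trans; apply.
  rewrite cardsD (setIidPr _) ?oT ?cards2; last by apply/subsetP => t /set2P[]->.
  by rewrite eq_sym -order_dvdn ox.
have b2 : #|y ^: 'C_H[x]| <= 4.
  have : y ^: 'C_H[x] \subset T :\: <[x]>.
    apply/subsetP => _ /imsetP[c /setIP[Hc /cent1P cx] ->].
    rewrite in_setD (memJ_norm _ (subsetP nTH _ Hc)) Ty andbT memJ_norm //.
    by rewrite (subsetP (cent_sub _)) // cent_cycle; apply/cent1P.
  move/subset_leq_card/leq_trans; apply.
  by rewrite cardsD (setIidPr _) ?oT -?orderE ?ox // cycle_subG.
have b3 : #|'C_H[x] :&: 'C[y]| <= 2.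
  have : 'C_H[x] :&: 'C[y] \subset 'Z(T).
    apply/subsetP => c /setIP[/setIP[Hc cx] cy].
    have cTc : c \in 'C(T).
      by rewrite -DT centM !cent_cycle inE cx.
    by rewrite inE cTc (subsetP cT) // inE Hc.
  move/subset_leq_card/leq_trans; apply.
  by rewrite DZ -orderE orderXdiv ox.
have E1 := LagrangeI H 'C[x]; have E2 := LagrangeI 'C_H[x] 'C[y].
rewrite -[#|H|]E1 -[#|H :&: 'C[x]|]E2 -[#|_ : 'C[x]|]indexgI -[#|_ : 'C[y]|]indexgI !index_cent1.
by have := leq_mul (leq_mul b3 b2) b1.
Qed.

Section Dim2.
Local Open Scope ring_scope.
Variable p : nat.
Variables (hT : finGroupType) (H : {group hT}) (rH : mx_representation 'F_p H 2) (J : 'M['F_p]_2).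
Hypotheses (pr_p : prime p) (p_odd : odd p) (ffulH : mx_faithful rH) (solH : solvable H).
Hypothesis transH : forall u v : 'rV['F_p]_2, u != 0 -> v != 0 -> exists2 h, h \in H & v = u *m rH h.
Hypotheses (uJ : J \in unitmx) (invJ : forall h, h \in H -> rH h *m J *m (rH h)^T = J).
Hypothesis skewJ : J^T = - J.

Let two : 2%:R != 0 :> 'F_p.
Proof.
rewrite -(dvdn_pcharf (pchar_Fp pr_p)) dvdn_prime2 //.
by apply: contraL p_odd => /eqP->.
Qed.

Lemma dim2_det1 h : h \in H -> rH h 0 0 * rH h 1 1 - rH h 0 1 * rH h 1 0 = 1.
Proof. by move=> Hh; apply: (det1_of_form skewJ two uJ (invJ Hh)). Qed.

Lemma dim2_sqr h : h \in H -> rH (h ^+ 2)%g = (rH h 0 0 + rH h 1 1) *: rH h - 1%:M.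
Proof. by move=> Hh; rewrite repr_mxX // -(cayley2 (dim2_det1 Hh)). Qed.

(** By Cayley-Hamilton, [h ^+ 2 = 1] says that the trace times [rH h] is 2, so [rH h] is scalar. *)
Lemma dim2_involution h : h \in H -> #[h]%g = 2%N -> rH h = - 1%:M.
Proof.
move=> Hh oh; have := dim2_sqr Hh;
have -> : (h ^+ 2)%g = 1%g by rewrite -[2%N]oh expg_order.
rewrite repr_mx1.
move/eqP; rewrite -subr_eq opprK => /eqP E.
have ns : ~~ is_scalar_mx (rH h) \/ rH h = - 1%:M.
  case: (boolP (is_scalar_mx _)) => [/is_scalar_mxP[a Da]|]; [right|by left].
  have /eqP := scalar_pm1 (rH := rH) uJ invJ Hh Da; rewrite -subr_eq0 subr_sqr_1 mulf_eq0.
  case/orP=> [|]; last by rewrite addr_eq0 Da => /eqP->; rewrite rmorphN.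
  rewrite subr_eq0 => /eqP a1; have : h = 1%g.
    by apply: (rH_inj ffulH); rewrite // repr_mx1 Da a1.
  by move=> h1; rewrite h1 order1 in oh.
case: ns => // /negP[]; apply/is_scalar_mxP.
have [t0|nt] := eqVneq (rH h 0 0 + rH h 1 1) 0.
  exfalso; move: E; rewrite t0 scale0r => /matrixP/(_ 0 0); rewrite !mxE /= -mulr2n.
  by move/eqP; rewrite (negPf two).
exists ((rH h 0 0 + rH h 1 1)^-1 *+ 2); apply: (can_inj (scalerK nt)).
by rewrite -E -[in RHS]scalemx1 scalerA mulrnAr divff // scaler_nat mulr2n.
Qed.

Lemma dim2_uniq_involution : {in H &, forall a b, #[a]%g = 2%N -> #[b]%g = 2%N -> a = b}.
Proof.
by move=> a b Ha Hb oa ob; apply: (rH_inj ffulH) => //; rewrite !dim2_involution.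
Qed.

Lemma dim2_scalar a : a \in H -> is_scalar_mx (rH a) -> (#[a]%g %| 2)%N.
Proof.
move=> Ha /is_scalar_mxP[c Dc]; rewrite order_dvdn; apply/eqP; apply: (rH_inj ffulH).
- by rewrite groupX.
- exact: group1.
rewrite repr_mx1 repr_mxX // Dc -rmorphXn /= (scalar_pm1 (rH := rH) uJ invJ Ha Dc) //.
Qed.

(** [A = <[a]>] is free, cyclic and not scalar, and ['C_H(A) = <[c]>] is abelian, free and cyclic as
    well. Its index is at most 2, the number of roots available to the conjugates of [a]. Among the
    roots [c], [c^-1], [c ^+ p] of a quadratic polynomial two coincide, so its order is at most
    [p + 1]. Then [p ^ 2 - 1 <= 2 (p + 1)]. *)
Lemma dim2_abelian_normal (A : {group hT}) : A <| H -> abelian A -> (2 < #|A|)%N -> p = 3%N.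
Proof.
move=> nsA cAA A_gt2; have [sAH nAH] := andP nsA.
have pc1 : 'O_p(H) = 1%g := trans_pcore1 pr_p ffulH transH.
have p'n (B : {group hT}) : B <| H -> abelian B -> p^'.-group B.
  move=> nsB cB; have nB := abelian_nil cB.
  have : 'O_p(B) \subset 'O_p(H).
    by apply: pcore_max; [apply: pcore_pgroup | apply: char_normal_trans (pcore_char _ _) nsB].
  rewrite pc1 subG1 => /eqP B1.
  have [_ DB _ _] := dprodP (nilpotent_pcoreC p nB); rewrite -DB B1 mul1g.
  exact: pcore_pgroup.
have frA := trans_abelian_free pr_p ffulH transH nsA cAA (p'n A nsA cAA).
have [a DA] := cyclicP (free_cyclic sAH cAA frA).
have Aa : a \in A by rewrite DA cycle_id.
have Ha := subsetP sAH a Aa.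
have nsa : ~~ is_scalar_mx (rH a).
  apply: contraL A_gt2 => /(dim2_scalar Ha)/dvdn_leq le; rewrite -leqNgt DA; exact: le.
have DC : 'C_H(A) = 'C_H[a] by rewrite DA cent_cycle.
have cCC : abelian 'C_H(A).
  rewrite DC; apply/centsP => c /setIP[Hc /cent1P ca] d /setIP[Hd /cent1P da].
  apply: (rH_inj ffulH); rewrite ?groupM // !repr_mxM //.
  by apply: (nonscalar_cent_comm nsa); rewrite -!repr_mxM // ?ca ?da.
have nsC : 'C_H(A) <| H by rewrite /normal subsetIl normsI ?normG ?norms_cent.
have sCH := normal_sub nsC.
have frC := trans_abelian_free pr_p ffulH transH nsC cCC (p'n _ nsC cCC).
have [c Dc] := cyclicP (free_cyclic sCH cCC frC).
have Cc : c \in 'C_H(A) by rewrite Dc cycle_id.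
have Hc := subsetP sCH c Cc.
have oc2 : (2 < #[c]%g)%N.
  rewrite orderE -Dc; apply: leq_trans A_gt2 _; rewrite subset_leq_card // subsetI sAH.
  exact: cAA.
have le1 : (#|H : 'C_H(A)| <= 2)%N.
  rewrite DC index_cent1 cardE -ltnS -[X in (_ < X)%N](size_char_poly (rH a)).
  apply: (free_roots sAH cAA frA).
  - by rewrite monic_neq0 ?char_poly_monic.
  - exact: enum_uniq.
  move=> b; rewrite mem_enum => /imsetP[h Hh ->]; split.
    by rewrite memJ_norm // (subsetP nAH).
  by apply: horner_mx_repr_conj => //; apply: Cayley_Hamilton.
have le2 : (#|'C_H(A)| <= p.+1)%N.
  pose S := [:: c; c^-1; c ^+ p]%g.
  have HS : {in S, forall b, b \in 'C_H(A) /\ horner_mx (rH b) (char_poly (rH c)) = 0}.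
    have P0 : horner_mx (rH c) (char_poly (rH c)) = 0 by apply: Cayley_Hamilton.
    move=> b; rewrite mem_seq3 => /or3P[]/eqP->; split=> //.
    - by rewrite groupV.
    - by apply: (invmx_root uJ (invJ Hc)).
    - by rewrite groupX.
    by rewrite repr_mxX // horner_mx_Frobenius // P0 expr0n gtn_eqF ?prime_gt0.
  have nuS : ~~ uniq S.
    apply/negP => uS.
    have nzP : char_poly (rH c) != 0 by rewrite monic_neq0 ?char_poly_monic.
    by have := free_roots sCH cCC frC nzP uS HS; rewrite size_char_poly.
  move: nuS; rewrite /S /= !inE andbT negb_and !negbK -orbA.
  rewrite Dc -orderE => /or3P[]/eqP.
  - move/esym/eqP; rewrite eq_invg_mul -(expgS c 1) -order_dvdn => /dvdn_leq => /(_ isT).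
    by rewrite leqNgt oc2.
  - move=> E; have : (#[c]%g %| p - 1)%N.
      rewrite -eqn_mod_dvd ?prime_gt0 // -eq_expg_mod_order -E expg1 //.
    by move/dvdn_leq; rewrite subn_gt0 prime_gt1 // => /(_ isT); clear; lia.
  - by move/eqP; rewrite eq_invg_mul -expgS -order_dvdn => /dvdn_leq => /(_ isT).
have := dvdn_leq (cardG_gt0 H) (trans_card pr_p transH); rewrite -(Lagrange sCH) => le3.
have le4 := leq_trans le3 (leq_mul le2 le1).
have := prime_gt1 pr_p; move: p_odd le4; clear.
case: p => [|[|[|[|k]]]] // _; rewrite expnS expn1; nia.
Qed.

(** Normal abelian subgroups have order at most 2. So the centre of the Fitting subgroup of the odd
    core is trivial, and ['F(H) = T]. An abelian [T] would be central in [H], making [H = T] too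
    small; having a unique involution, [T] is generalised quaternion, and its cyclic derived
    subgroup of order at most 2 leaves order 8. *)
Lemma dim2_quaternion (T := 'O_2(H)) : (p != 3)%N -> T \isog 'Q_8 /\ 'C_H(T) \subset T.
Proof.
move=> p3.
have small (A : {group hT}) : A <| H -> abelian A -> (#|A| <= 2)%N.
  by move=> nsA cA; rewrite leqNgt; apply: contra p3 => /(dim2_abelian_normal nsA cA)/eqP.
have nsT : T <| H by apply: pcore_normal.
have DF : 'F(H) = T.
  apply: Fitting_eq_pcore; apply/eqP; set K := 'O_(2%N : nat_pred)^'(H).
  have solK : solvable K := solvableS (pcore_sub _ _) solH.
  have oK : (2%N : nat_pred)^'.-group K := pcore_pgroup _ _.
  rewrite -trivg_Fitting // -(center_nil_eq1 (Fitting_nil _)).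
  have nsZ : 'Z('F(K)) <| H.
    apply: char_normal_trans (pcore_normal _ H).
    exact: char_trans (center_char _) (Fitting_char _).
  have := small _ nsZ (center_abelian _).
  have odd' : odd #|'Z('F(K))|.
    have : (2%N : nat_pred)^'.-group 'Z('F(K)).
      by apply: pgroupS oK; apply: subset_trans (center_sub _) (Fitting_sub _).
    by rewrite /pgroup -odd_2'nat.
  rewrite trivg_card1; move: odd'; have := cardG_gt0 'Z('F(K)).
  by case: #|_| => [|[|[|k]]].
have cT : 'C_H(T) \subset T by rewrite -DF; apply: sub_cent_Fitting.
have H8 : (8 <= #|H|)%N.
  have := dvdn_leq (cardG_gt0 H) (trans_card pr_p transH); apply: leq_trans.
  have := prime_gt1 pr_p; move: p_odd; clear.
  by case: p => [|[|[|k]]] // _ _; rewrite expnS expn1; nia.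
have uT : {in T &, forall a b, #[a]%g = 2%N -> #[b]%g = 2%N -> a = b}.
  by move=> a b Ta Tb; apply: dim2_uniq_involution; apply: (subsetP (normal_sub nsT)).
have nabT : ~~ abelian T.
  apply/negP => cTT; have le := small _ nsT cTT.
  have : H \subset 'C(T).
    apply/centsP => h Hh t Tt; apply/esym/commgP/conjg_fixP.
    have [->|nt] := eqVneq t 1%g; first by rewrite conj1g.
    have ot : #[t]%g = 2%N.
      apply/eqP; rewrite eqn_leq order_gt1 nt andbT; apply: leq_trans le.
      by rewrite orderE subset_leq_card // cycle_subG.
    by apply: uT; rewrite ?orderJ // memJ_norm // (subsetP (normal_norm nsT)).
  move=> cHT; have /subset_leq_card : H \subset T.
    by apply: subset_trans cT; rewrite subsetI subxx.
  by move/(leq_trans H8)/leq_trans/(_ le).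
have ntT : T != 1%g by apply: contraNneq nabT => ->; apply: abelian1.
have [cyc|[m m_gt2 iT]] := uniq_involution_pgroup (pcore_pgroup _ H) ntT uT.
  by rewrite (cyclic_abelian cyc) in nabT.
split=> //; have [[x y] genT _] := generators_quaternion m_gt2 iT.
have [_ [DT' _ oT' _] _ _ _] := quaternion_structure m_gt2 genT iT.
have : (#|T^`(1)%g| <= 2)%N.
  apply: small; last by change (abelian 'O_2(H)^`(1)%g); rewrite [_^`(1)%g]DT' cycle_abelian.
  by apply: char_normal_trans (der_char _ _) nsT.
rewrite [#|T^`(1)%g|]oT'; case: m m_gt2 iT {genT oT'} => [|[|[|[|m]]]] // _ iT.
by rewrite /= expnS (@leq_pmul2l 2 _ 1) // leqNgt -{1}(expn0 2) ltn_exp2l.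
Qed.

(** The trace of [x] works: [x ^+ 4] is -1, so [x ^+ 2] has trace 0, and this trace is
    [t ^+ 2 - 2]. *)
Lemma dim2_order8 x : x \in H -> #[x]%g = 8%N -> exists t : 'F_p, t ^+ 2 = 2%:R.
Proof.
move=> Hx ox; exists (rH x 0 0 + rH x 1 1).
have Hx2 : (x ^+ 2)%g \in H by rewrite groupX.
have inv : rH (x ^+ 4)%g = - 1%:M.
  by apply: dim2_involution; rewrite ?groupX // orderXdiv ox.
have tr2 : rH (x ^+ 2)%g 0 0 + rH (x ^+ 2)%g 1 1 = 0.
  apply/eqP; apply: contraT => nt.
  have : rH ((x ^+ 2) ^+ 2)%g + 1%:M = (rH (x ^+ 2)%g 0 0 + rH (x ^+ 2)%g 1 1) *: rH (x ^+ 2)%g.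
    by rewrite (dim2_sqr Hx2) subrK.
  rewrite -expgM inv addNr => /esym/eqP; rewrite scaler_eq0 (negPf nt) => /eqP E.
  by have := repr_mx_unit rH Hx2; rewrite E unitmxE det0 unitr0.
have := dim2_sqr Hx => /matrixP E; move: tr2; rewrite !E !mxE /= !mulr1n => tr2.
apply/eqP; rewrite -subr_eq0 -tr2; apply/eqP; ring.
Qed.

Lemma dim2_exists_order8 : (16 %| #|H|)%N -> exists2 x, x \in H & #[x]%g = 8%N.
Proof.
move=> dv; have [S sylS] := Sylow_exists 2 H; have [sSH pS _] := and3P sylS.
have dS : (16 %| #|S|)%N.
  by rewrite (card_Hall sylS) p_part (@dvdn_exp2l 2 4) // -(pfactor_dvdn 4).
have S_gt : (16 <= #|S|)%N := dvdn_leq (cardG_gt0 S) dS.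
have ntS : S :!=: 1%g by rewrite -cardG_gt1 (leq_trans _ S_gt).
have [x Sx [k [oxk]]] : exists2 x, x \in S & exists k, #[x]%g = (2 ^ k)%N /\ (2 < k)%N.
  case: (uniq_involution_pgroup pS ntS) => [a b Sa Sb|/cyclicP[x Dx]|[n n_gt2 iS]].
  - by apply: dim2_uniq_involution; apply: (subsetP sSH).
  - exists x; first by rewrite Dx cycle_id.
    exists (logn 2 #|S|); split; first by rewrite orderE -Dx -p_part part_pnat_id.
    by apply: (@leq_trans 4); rewrite // -pfactor_dvdn.
  have [[x y] genS _] := generators_quaternion n_gt2 iS.
  case: genS => oS Sx ox _; exists x => //; exists n.-1; split=> //.
  move: S_gt; rewrite oS -[16%N]/(2 ^ 4)%N leq_exp2l //.
  by case: n {n_gt2 iS oS ox} => [|[|[|[|n]]]].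
move=> k_gt2; exists (x ^+ (2 ^ (k - 3)))%g; first by rewrite groupX // (subsetP sSH).
rewrite orderXdiv oxk ?dvdn_exp2l ?leq_subr //.
by rewrite -{1}(subnK k_gt2) expnD mulKn ?expn_gt0.
Qed.

Lemma dim2_SL : exists2 K : {group {'GL_2['F_p]}}, K \subset SL 2 'F_p & H \isog K.
Proof.
exists (reprGLm rH @* H)%G.
  apply/subsetP => _ /morphimP[h Hh _ ->]; rewrite inE val_reprGLm //.
  by rewrite det_mx22 dim2_det1.
apply/isogP; exists [morphism of reprGLm rH] => //; by rewrite ker_reprGLm.
Qed.
End Dim2.

Lemma card_SL_2_3 : #|SL 2 'F_3| = 24.
Proof.
have c48 : #|'GL_2['F_3]| = 48 by rewrite card_GL_2 card_Fp.
pose A : 'M['F_3]_2 := (\matrix_(i, j) (if i == j then if i == 0 then -1 else 1 else 0))%R.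
have dA : (\det A = -1)%R by rewrite det_mx22 !mxE /= mulr1 mul0r subr0.
have ud : (A \is a GRing.unit)%R by change (A \in unitmx); rewrite unitmxE dA unitrN1.
pose d : {'GL_2['F_3]} := FinRing.unit _ ud.
have dd : (\det (GLval d) = -1)%R by [].
have det3 (u : {'GL_2['F_3]}) : ((\det (GLval u) == 1) || (\det (GLval u) == -1))%R.
  have := GL_unitmx u; rewrite unitmxE; case: (\det _)%R => [[|[|[]]]] //.
have Sd (u : {'GL_2['F_3]}) : (u \in SL 2 'F_3) = (\det (GLval u) == 1)%R by rewrite inE.
have D : ~: SL 2 'F_3 = d *: SL 2 'F_3.
  apply/setP => u; rewrite inE mem_lcoset !Sd GL_ME GL_VE det_mulmx det_inv dd.
  by case/orP: (det3 u) => /eqP->.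
have := cardsC (SL 2 'F_3); rewrite D card_lcoset addnn => E.
by apply: double_inj; rewrite E -[24.*2]c48 cardsE; apply: eq_card => u; rewrite inE.
Qed.

Section Dim2Transitive.
Local Open Scope ring_scope.
Variable p : nat.
Variables (hT : finGroupType) (H : {group hT}) (rH : mx_representation 'F_p H 2) (J : 'M['F_p]_2).
Hypotheses (pr_p : prime p) (p_odd : odd p) (ffulH : mx_faithful rH) (solH : solvable H).
Hypothesis transH : forall u v : 'rV['F_p]_2, u != 0 -> v != 0 -> exists2 h, h \in H & v = u *m rH h.
Hypotheses (uJ : J \in unitmx) (invJ : forall h, h \in H -> rH h *m J *m (rH h)^T = J).
Hypothesis skewJ : J^T = - J.

(** [p ^ 2 - 1] divides [|H|], which divides 24 if [p = 3] and is at most 48 otherwise. Since 2 is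
    not a square modulo 3 or 5, there is no element of order 8 for these primes: [H] is not cyclic
    of order 8 if [p = 3], nor of order 48 if [p = 5]. *)
Lemma trans_symplectic_dim2 (T := 'O_2(H)) : [\/ p = 3%N /\ (H \isog 'Q_8 \/ H \isog SL 2 'F_3),
  [/\ p = 5%N, #|H| = 24%N, T \isog 'Q_8 & 'C_H(T) \subset T]
  | [/\ p = 7%N, #|H| = 48%N, T \isog 'Q_8, 'C_H(T) \subset T
     & {in H &, forall a b, #[a]%g = 2%N -> #[b]%g = 2%N -> a = b}]].
Proof.
have dvH := trans_card pr_p transH.
have no8 x : x \in H -> #[x]%g = 8%N -> p != 3%N /\ p != 5%N.
  move=> Hx ox; have [t Ht] := dim2_order8 pr_p p_odd ffulH uJ invJ skewJ Hx ox.
  split; apply/eqP => Dp; move: t Ht; rewrite Dp.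
    have /forallP E : [forall t : 'F_3, t ^+ 2 != 2%:R] by apply/forallP; case=> [[|[|[]]]].
    by move=> t /eqP; rewrite (negPf (E t)).
  have /forallP E : [forall t : 'F_5, t ^+ 2 != 2%:R] by apply/forallP; case=> [[|[|[|[|[]]]]]].
  by move=> t /eqP; rewrite (negPf (E t)).
have uinv := dim2_uniq_involution pr_p p_odd ffulH uJ invJ skewJ.
have [p3|p3] := eqVneq p 3%N.
  constructor 1; split=> //.
  have [K sK isoK] := dim2_SL pr_p p_odd ffulH uJ invJ skewJ.
  subst p.
  have d24 : (#|H| %| 24)%N by rewrite (card_isog isoK) -card_SL_2_3 cardSg.
  have [k Dk] := dvdnP dvH; have : (k %| 3)%N by rewrite -(@dvdn_pmul2r 8) // -Dk.
  have /primeP[_ P3] : prime 3 by [].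
  case/P3/orP => /eqP kE; rewrite kE in Dk; last first.
    right; have E : K = SL_group 2 'F_3.
      by apply/val_inj/eqP; rewrite eqEcard [in X in X && _]sK [#|SL 2 'F_3|]card_SL_2_3 -(card_isog isoK) Dk.
    by rewrite E in isoK.
  have pH : 2.-group H by rewrite /pgroup Dk.
  left; case: (uniq_involution_pgroup pH) => [|//|/cyclicP[x Dx]|[n n_gt2 iH]].
  - by rewrite -cardG_gt1 Dk.
  - have [||//] := no8 x; first by rewrite Dx cycle_id.
    by rewrite orderE -Dx Dk.
  have := card_isog iH; rewrite card_quaternion // Dk => /eqP.
  rewrite -[X in X == _]/(2 ^ 3)%N eqn_exp2l // => /eqP n3; by move: iH; rewrite -n3.
have [iT cT] := dim2_quaternion pr_p p_odd ffulH solH transH uJ invJ skewJ p3.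
have le48 := normal_quaternion_bound (pcore_normal 2%N H) iT cT.
have leH := dvdn_leq (cardG_gt0 H) dvH.
have p57 : p = 5%N \/ p = 7%N.
  have le7 : (p <= 7)%N.
    have := leq_trans leH le48; clear; rewrite leqNgt => h; rewrite leqNgt; apply: contra h => p8.
    by apply: (@leq_trans (8 ^ 2 - 1)%N) => //; rewrite leq_sub2r // leq_exp2r.
  move: p_odd p3 le7 (prime_gt1 pr_p); clear.
  by case: p => [|[|[|[|[|[|[|[|k]]]]]]]] //= _ _ _ _; by [left | right].
case: p57 => Dp; subst p; [constructor 2 | constructor 3].
  have [k Dk] := dvdnP dvH; rewrite -[(5 ^ 2 - 1)%N]/24%N in Dk.
  split=> //; have := cardG_gt0 H; rewrite Dk in le48 *.
  move: le48; rewrite (@leq_pmul2r 24 _ 2) //; case: k Dk => [|[|[|k]]] // Dk _ _.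
  have [|x Hx ox] := dim2_exists_order8 pr_p isT ffulH uJ invJ skewJ.
    by rewrite Dk.
  by have [_] := no8 x Hx ox.
split=> //; apply/eqP; rewrite eqn_leq le48; exact: leH.
Qed.
End Dim2Transitive.

(** * From the character to a symplectic representation of G / E *)

Section ChiConj.
Local Open Scope ring_scope.
Variables (gT : finGroupType) (G : {group gT}) (chi alpha : 'CF(G)) (m : nat).
Hypotheses (irr_chi : chi \in irr G) (ffchi : cfaithful chi) (irr_alpha : alpha \in irr G).
Hypothesis m_gt0 : (0 < m)%N.
Hypothesis chi_conj : chi * chi^*%CF = 1 + m%:R *: alpha.

Let m_neq0 : m%:R != 0 :> algC. Proof. by rewrite pnatr_eq0 -lt0n. Qed.

Let chiN : chi \is a character. Proof. exact: irrWchar. Qed.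

Lemma chi_center : 'Z(chi)%CF = 'Z(G).
Proof. by have [i Di] := irrP irr_chi; rewrite Di cfcenter_fful_irr -?Di. Qed.

Lemma alpha_conj (x : gT) : x \in G -> `|chi x| ^+ 2 = 1 + m%:R * alpha x.
Proof.
move=> Gx; have /cfunP/(_ x) := chi_conj.
by rewrite !cfunE cfun1E Gx normCK.
Qed.

Lemma ker_alpha : cfker alpha \subset 'Z(G).
Proof.
apply/subsetP => x Kx; have Gx := subsetP (cfker_sub alpha) x Kx.
rewrite -chi_center char_cfcenterE //.
have : `|chi x| ^+ 2 = chi 1%g ^+ 2.
  rewrite alpha_conj // cfker1 // -alpha_conj // ger0_norm ?char1_ge0 //.
by move/eqP; rewrite eqrXn2 ?char1_ge0.
Qed.

(** The norm of the restriction is the multiplicity of the principal character in [chi * chi^*] on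
    [N]. If [alpha] contributed to it, [N] would lie in [cfker alpha], which is central. *)
Lemma Res_irr_normal (N : {group gT}) : N <| G -> ~~ (N \subset 'Z(G)) -> 'Res[N] chi \in irr N.
Proof.
move=> nsN nN; have sNG := normal_sub nsN.
have [i Di] := irrP irr_alpha.
have a0 : '['Res[N] alpha, 1] = 0.
  apply/eqP; apply: contraR nN => nz; apply: subset_trans ker_alpha.
  have := @constt0_Res_cfker _ G N i nsN; rewrite Di; apply.
  by rewrite irr_consttE irr0 -Di.
have : '['Res[N] chi] = 1.
  transitivity '['Res[N] (chi * chi^*%CF), 1].
    rewrite !cfdotE; congr (_ * _); apply: eq_bigr => x Nx.
    by rewrite !cfResE // !cfunE cfun1E Nx conjC1 mulr1.
  rewrite chi_conj linearD linearZ /= cfdotDl cfdotZl a0 mulr0 addr0.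
  by rewrite cfRes_cfun1 cfnorm1.
by move=> E1; rewrite irrEchar cfRes_char // E1 eqxx.
Qed.

Lemma chi1_gt0 : 0 < chi 1%g.
Proof. by have [i ->] := irrP irr_chi; apply: irr1_gt0. Qed.

(** On the centre this is the linear character of which the restriction of [chi] is a multiple. *)
Definition zeta (z : gT) : algC := chi z / chi 1%g.

Lemma chi_repr : exists n (rG : mx_representation algC G n),
  [/\ mx_irreducible rG, chi = cfRepr rG, (0 < n)%N, mx_faithful rG
    & forall z, z \in G -> is_scalar_mx (rG z) = (z \in 'Z(G))].
Proof.
have /irr_reprP[[n rG] irrG Dchi] := irr_chi.
have n_gt0 : (0 < n)%N by have := chi1_gt0; rewrite Dchi cfRepr1 ltr0n.
exists n, rG; split=> //.
  by move: ffchi; rewrite /cfaithful Dchi cfker_repr.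
by move=> z Gz; rewrite -chi_center Dchi cfcenter_repr inE Gz.
Qed.

Lemma chi_mulZ (x z : gT) : x \in G -> z \in 'Z(G) -> chi (x * z)%g = chi x * zeta z.
Proof.
move=> Gx Zz; have Gz := subsetP (center_sub G) z Zz.
have [n [rG [_ Dchi n_gt0 _ sc]]] := chi_repr.
have /is_scalar_mxP[c Dc] : is_scalar_mx (rG z) by rewrite sc.
rewrite /zeta Dchi !cfunE groupM // Gx Gz group1 repr_mxM // Dc repr_mx1 mul_mx_scalar.
by rewrite !mulr1n linearZ /= !mxtrace_scalar -mulr_natr mulfK ?pnatr_eq0 -?lt0n // mulrC.
Qed.

Lemma zetaM : {in 'Z(G) &, {morph zeta : x y / (x * y)%g >-> x * y}}.
Proof.
move=> x y Zx Zy; rewrite {1}/zeta chi_mulZ // ?(subsetP (center_sub G) x Zx) //.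
by rewrite mulrAC.
Qed.

Lemma zeta1 : zeta 1%g = 1. Proof. by rewrite /zeta divff // gt_eqF // chi1_gt0. Qed.

Lemma zeta_eq1 z : z \in 'Z(G) -> zeta z = 1 -> z = 1%g.
Proof.
move=> Zz E; have Gz := subsetP (center_sub G) z Zz.
have : chi z = chi 1%g by rewrite -[z]mul1g chi_mulZ // E mulr1.
move=> Ez; have : z \in cfker chi by rewrite cfkerEchar // inE Gz Ez eqxx.
by move/(subsetP ffchi)/set1P.
Qed.

Variable E : {group gT}.
Hypotheses (solG : solvable G) (chiefE : chief_factor G 'Z(G) E).
Local Notation Z := 'Z(G).

Lemma chief_facts : [/\ E <| G, Z \proper E, E \subset G, Z <| E & abelian (E / Z)].
Proof.
have /andP[maxZ nsE] := chiefE; have [/andP[ltZE nZ] _] := maxgroupP maxZ.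
have sEG := normal_sub nsE.
split=> //; first by rewrite /normal (proper_sub ltZE) (subset_trans sEG).
have minE := chief_factor_minnormal chiefE.
by have [_ _ /is_abelemP[p _ /abelem_abelian]] :=
  minnormal_solvable minE (subxx _) (quotient_sol _ (solvableS sEG solG)).
Qed.

Let nsE : E <| G. Proof. by case: chief_facts. Qed.
Let sEG : E \subset G := normal_sub nsE.
Let sZE : Z \subset E. Proof. by case: chief_facts => _ /proper_sub. Qed.
Let nZE : ~~ (E \subset Z). Proof. by case: chief_facts => _ /andP[]. Qed.

(** The restriction of [chi] to [E] is irreducible, so by Schur's lemma what centralises [E] is
    scalar, hence central. *)
Lemma cent_chief : 'C_G(E) = Z.
Proof.
apply/eqP; rewrite eqEsubset subsetI center_sub andbC; apply/andP; split.
  by rewrite (subset_trans (subsetIr _ _)) // centS.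
apply/subsetP=> c /setIP[Gc cc].
have [n [rG [irrG Dchi n_gt0 _ sc]]] := chi_repr.
rewrite -sc //.
have irE : mx_irreducible (subg_repr rG sEG).
  have /irr_reprP[[n' rE] irrE DE] := Res_irr_normal nsE nZE.
  apply: mx_rsim_irr irrE; apply: cfRepr_inj; rewrite cfRepr_sub -Dchi //.
have absE : mx_absolutely_irreducible (subg_repr rG sEG).
  by apply: (@groupC _ E).
apply: (mx_abs_irr_cent_scalar absE).
apply/centgmxP => x Ex; have Gx := subsetP sEG x Ex; rewrite /= -!repr_mxM //.
by rewrite (centP cc).
Qed.

Lemma zeta_comm (x y : gT) : x \in E -> y \in E -> [~ x, y]%g \in Z.
Proof.
move=> Ex Ey; have [_ _ _ nsZ cEZ] := chief_facts.
have nZ := normal_norm nsZ; have : [~: E, E] \subset Z by rewrite -quotient_cents2.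
by move/subsetP; apply; apply: mem_commg.
Qed.

(* A commutator that lies in the centre twists the value of chi by a nontrivial scalar. *)
Lemma chi_vanish (x y : gT) : x \in G -> y \in G -> [~ x, y]%g \in Z -> [~ x, y]%g != 1%g -> chi x = 0.
Proof.
move=> Gx Gy Zxy nt; apply/eqP; apply: contraR nt => nz.
apply/eqP/zeta_eq1 => //; apply: (mulfI nz); rewrite mulr1 -chi_mulZ //.
by rewrite -conjg_mulR cfunJ.
Qed.

Lemma chi_vanish_chief x : x \in E -> x \notin Z -> chi x = 0.
Proof.
move=> Ex nZx; have Gx := subsetP sEG x Ex.
have : x \notin 'C(E) by apply: contra nZx => cx; rewrite -cent_chief inE Gx.
rewrite -sub_cent1 => /subsetPn[y Ey nxy].
apply: (chi_vanish Gx (subsetP sEG y Ey) (zeta_comm Ex Ey)).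
by apply: contra nxy => /commgP xy; apply/cent1P.
Qed.

Lemma normZ_chi z : z \in Z -> `|chi z| = chi 1%g.
Proof.
move=> Zz; have Gz := subsetP (center_sub G) z Zz.
by apply/eqP; rewrite -char_cfcenterE // chi_center.
Qed.

(** The restriction to [D] has norm 1, and only the elements of [Z], where [chi] has modulus
    [chi 1], contribute to it. *)
Lemma chi_degree (D : {group gT}) : D <| G -> Z \subset D -> ~~ (D \subset Z) ->
  {in D, forall x, x \notin Z -> chi x = 0} -> chi 1%g ^+ 2 = #|D : Z|%:R.
Proof.
move=> nsD sZD nD van; have := Res_irr_normal nsD nD; have sDG := normal_sub nsD.
rewrite irrEchar => /andP[_ /eqP]; rewrite cfdotE (bigID (mem Z)) /=.
rewrite [X in _ + X]big1 ?addr0 => [|x /andP[Dx nZx]]; last by rewrite cfResE // van // mul0r.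
rewrite (eq_bigl (mem Z)) => [|x]; last by apply: andb_idl; apply: (subsetP sZD).
rewrite (eq_bigr (fun _ => chi 1%g ^+ 2)) => [|x Zx]; last first.
  by rewrite cfResE ?(subsetP sZD) // -normCK normZ_chi.
rewrite sumr_const -(Lagrange sZD) natrM => EE.
have nzZ : #|Z|%:R != 0 :> algC by rewrite pnatr_eq0 -lt0n cardG_gt0.
have nzD : #|D : Z|%:R != 0 :> algC by rewrite pnatr_eq0 -lt0n indexg_gt0.
move/(congr1 ( *%R (#|Z|%:R * #|D : Z|%:R))): EE; rewrite ?mulr1 /= mulVKf ?mulf_neq0 // ?mulr1 -[_ *+ _]mulr_natl.
exact: (mulfI nzZ).
Qed.

Lemma chi1_sqr : chi 1%g ^+ 2 = #|E : Z|%:R.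
Proof. by apply: chi_degree => // x Ex; apply: chi_vanish_chief. Qed.

(** At an element of [E] outside [Z], where [chi] vanishes, [alpha] takes the value -1/m, a rational
    algebraic integer. *)
Lemma m_eq1 : m = 1%N.
Proof.
have /subsetPn[x Ex nZx] := nZE; have Gx := subsetP sEG x Ex.
have := alpha_conj Gx; rewrite chi_vanish_chief // normr0 expr0n /=.
move/esym/eqP; rewrite addrC addr_eq0 => /eqP E1.
have Ia : alpha x \in Num.int.
  rewrite Cint_rat_Aint //; last by have [i ->] := irrP irr_alpha; apply: Aint_irr.
  have -> : alpha x = - (m%:R)^-1 by apply: (mulfI m_neq0); rewrite E1 mulrN mulfV.
  by rewrite rpredN rpredV rpred_nat.
have [k Dk] := intrP Ia; rewrite Dk in E1.
have /(intr_inj) : (m%:Z * k)%:~R = (-1)%:~R :> algC by rewrite intrM E1.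
move/(congr1 absz); rewrite abszM /= => /eqP; rewrite muln_eq1 => /andP[/eqP-> _] //.
Qed.

Lemma centerJ z g : z \in Z -> g \in G -> (z ^ g)%g = z.
Proof. by case/setIP=> _ cz Gg; apply/conjg_fixP/commgP; apply: (centP cz). Qed.

Section Lambda.
Variable e : gT.
Hypothesis Ee : e \in E.

Definition lambda_mx (y : gT) : 'M[algC]_1 := (zeta [~ e, y]%g)%:M.

Lemma comm_morph x y : x \in E -> y \in E -> [~ e, x * y]%g = ([~ e, x] * [~ e, y])%g.
Proof.
move=> Ex Ey; rewrite commgMJ centerJ ?zeta_comm ?(subsetP sEG) //.
have /setIP[Gz cz] := zeta_comm Ee Ey.
by apply: (centP cz); rewrite groupR ?(subsetP sEG).
Qed.

Lemma lambda_mx_repr : mx_repr E lambda_mx.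
Proof.
split=> [|x y Ex Ey]; first by rewrite /lambda_mx commg1 zeta1.
by rewrite /lambda_mx comm_morph // zetaM ?zeta_comm // scalar_mxM.
Qed.

Definition lambda : 'CF(E) := cfRepr (MxRepresentation lambda_mx_repr).

Lemma lambdaE y : y \in E -> lambda y = zeta [~ e, y]%g.
Proof. by move=> Ey; rewrite cfunE Ey mulr1n mxtrace_scalar. Qed.

Lemma lambda_irr : lambda \in irr E.
Proof. by apply: lin_char_irr; rewrite qualifE /= cfRepr_char cfRepr1 eqxx. Qed.

(** [chi] vanishes on [E] outside [Z], where [lambda] is 1, so the product of [chi * chi^*] with
    [lambda] is [chi(1) ^ 2 |Z| / |E| = 1]; and [lambda] is not principal, as [e] does not
    centralise [E]. *)
Lemma lambda_constt : e \notin Z -> '['Res[E] alpha, lambda] = 1.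
Proof.
move=> nZe; have -> : alpha = chi * chi^*%CF - 1.
  by rewrite chi_conj m_eq1 scale1r addrC addKr.
rewrite linearB /= cfdotBl cfRes_cfun1.
have /irrP[j Dj] := lambda_irr.
have -> : '[1, lambda] = 0.
  rewrite Dj -irr0 cfdot_irr; case: eqP => // j0; case/negP: nZe.
  rewrite -cent_chief inE (subsetP sEG) //; apply/centP => y Ey.
  apply/commgP/eqP/zeta_eq1; first exact: zeta_comm.
  by rewrite -lambdaE // Dj -j0 irr0 cfun1E Ey.
rewrite subr0 cfdotE (bigID (mem Z)) /=.
rewrite [X in _ + X]big1 ?addr0 => [|x /andP[Ex nZx]]; last first.
  by rewrite cfResE // cfunE chi_vanish_chief // !mul0r.
rewrite (eq_bigl (mem Z)) => [|x]; last by apply: andb_idl; apply: (subsetP sZE).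
rewrite (eq_bigr (fun _ => chi 1%g ^+ 2)) => [|x Zx]; last first.
  have Ex := subsetP sZE x Zx.
  rewrite cfResE // [X in X * _]cfunE [cfAut _ _ _]cfunE -normCK normZ_chi // lambdaE //.
  have -> : [~ e, x]%g = 1%g.
    by apply/eqP/commgP/esym; have /setIP[_ /centP] := Zx; apply; apply: (subsetP sEG).
  by rewrite zeta1 conjC1 mulr1.
rewrite sumr_const chi1_sqr -[X in _ * X]mulr_natl -natrM Lagrange //.
by rewrite mulVf // pnatr_eq0 -lt0n cardG_gt0.
Qed.
End Lambda.

(** By Clifford's theorem the characters of [f] and of some [e ^ g] coincide. As [zeta] is injective
    on [Z], [f] and [e ^ g] have the same commutators with [E], so they agree modulo
    ['C_G(E) = Z]. *)
Lemma chief_trans e f : e \in E -> e \notin Z -> f \in E -> f \notin Z ->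
  exists2 g, g \in G & (f^-1 * e ^ g)%g \in Z.
Proof.
move=> Ee nZe Ef nZf.
have /irrP[i Di] := irr_alpha.
have /irrP[j Dj] := lambda_irr Ee; have /irrP[k Dk] := lambda_irr Ef.
have Cj : j \in irr_constt ('Res[E] 'chi_i).
  by rewrite irr_consttE -Di -Dj lambda_constt // oner_eq0.
have /cfclassP[g Gg Dg] : lambda Ef \in (lambda Ee ^: G)%CF.
  apply: contraT => nf; have := lambda_constt Ef nZf.
  rewrite Di (Clifford_Res_sum_cfclass nsE Cj) cfdotZl reindex_cfclass // cfdot_suml.
  rewrite big1 ?mulr0 => [/esym/eqP|l]; first by rewrite oner_eq0.
  rewrite Dk cfdot_irr; case: eqP => // -> cl.
  by rewrite Dk Dj cl in nf.
exists g => //; have nEg : g \in 'N(E) by rewrite (subsetP (normal_norm nsE)).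
have Eeg : (e ^ g)%g \in E by rewrite memJ_norm.
suff: (f^-1 * e ^ g)%g \in 'C_G(E) by rewrite cent_chief.
apply/setIP; split; first by apply: (subsetP sEG); apply: groupM => //; rewrite groupV.
apply/centP => y Ey.
have Eyg : (y ^ g^-1)%g \in E by rewrite memJ_norm ?groupV.
have E1 : [~ f, y]%g = [~ e ^ g, y]%g.
  have : zeta [~ f, y]%g = zeta [~ e ^ g, y]%g.
    rewrite -[LHS](lambdaE Ef Ey) Dg cfConjgE // lambdaE //; congr zeta.
    by rewrite -{2}[y](conjgKV g) -conjRg (centerJ (zeta_comm Ee Eyg) Gg).
  have [Zf Ze] := (zeta_comm Ef Ey, zeta_comm Eeg Ey).
  move=> Ez; apply/eqP; rewrite eq_mulgV1; apply/eqP/zeta_eq1; first by rewrite groupM ?groupV.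
  by rewrite zetaM ?groupV // Ez -zetaM ?groupV // mulgV zeta1.
apply/commgP/conjg_fixP; rewrite conjMg conjVg (conjg_mulR f) (conjg_mulR (e ^ g)) E1 invMg.
have /setIP[_ cz] := zeta_comm Eeg Ey.
rewrite -mulgA (mulgA f^-1%g) -conjgE; apply/conjg_fixP/commgP/esym/(centP cz).
by apply: (subsetP sEG); apply: groupM => //; rewrite groupV.
Qed.

Lemma cent_quotient_chief g : g \in G -> (forall e, e \in E -> [~ e, g]%g \in Z) -> g \in E.
Proof.
move=> Gg cg; pose D := (coset Z @*^-1 'C_(G / Z)(E / Z))%G.
have nZG : G \subset 'N(Z) by apply: normal_norm (center_normal G).
have nsD : D <| G.
  suff: D <| coset Z @*^-1 (G / Z) by rewrite quotientGK ?center_normal.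
  rewrite cosetpre_normal /normal subsetIl.
  by rewrite normsI ?normG // (subset_trans (quotient_norms _ (normal_norm nsE))) ?cent_norm
    ?norms_cent ?quotient_norms ?normal_norm.
have DP d : d \in G -> (d \in D) = (coset Z d \in 'C(E / Z)).
  move=> Gd; apply/idP/idP => [/morphpreP[_ /setIP[]] //|cd]; apply/morphpreP.
    by split; [apply: (subsetP nZG) | apply/setIP; split=> //; apply: mem_quotient].
have sED : E \subset D.
  have [_ _ _ _ cEZ] := chief_facts.
  apply/subsetP => x Ex; rewrite DP ?(subsetP sEG) // (subsetP cEZ) // mem_quotient //.
have vD : {in D, forall x, x \notin Z -> chi x = 0}.
  move=> x Dx nZx; have Gx := subsetP (normal_sub nsD) x Dx.
  have : x \notin 'C(E) by apply: contra nZx => cx; rewrite -cent_chief inE Gx.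
  rewrite -sub_cent1 => /subsetPn[y Ey nxy]; have Gy := subsetP sEG y Ey.
  apply: (chi_vanish Gx Gy).
    move: Dx; rewrite DP // => /centP/(_ _ (mem_quotient Z Ey)) cxy.
    rewrite coset_idr ?groupR ?(subsetP nZG) // morphR ?(subsetP nZG) //.
    by apply/eqP/commgP.
  by apply: contra nxy => /commgP xy; apply/cent1P.
have nDZ : ~~ (D \subset Z) by apply: contra nZE; apply: subset_trans.
have := chi_degree nsD (subset_trans sZE sED) nDZ vD; rewrite chi1_sqr => /eqP.
rewrite eqr_nat => /eqP iEQ.
have -> : E :=: D.
  apply/eqP; rewrite eqEcard sED -(Lagrange sZE) -(Lagrange (subset_trans sZE sED)) iEQ.
  exact: leqnn.
rewrite DP //; apply/centP => _ /morphimP[e Ne Ee ->].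
apply/esym/commgP; rewrite -morphR ?(subsetP nZG) //.
  by apply/eqP; apply: (coset_id (cg e Ee)).
exact: (subsetP sEG).
Qed.

End ChiConj.

(** * The commutator form on an elementary abelian section *)

Section CommForm.
Local Open Scope ring_scope.
Variables (gT : finGroupType) (G Z E : {group gT}) (p : nat) (z0 : gT).
Hypotheses (sZE : Z \subset E) (nsE : E <| G) (cZ : G \subset 'C(Z)) (sZG : Z \subset G).
Hypotheses (abV : p.-abelem (E / Z)) (ntV : (E / Z != 1)%g) (oz0 : #[z0]%g = p) (Zz0 : z0 \in Z).
Hypothesis commz0 : {in E &, forall x y, [~ x, y]%g \in <[z0]>}.
Hypothesis centE : forall x, x \in E -> (forall y, y \in E -> [~ x, y] = 1)%g -> x \in Z.
Hypothesis centG : forall g, g \in G -> (forall e, e \in E -> [~ e, g]%g \in Z) -> g \in E.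
Hypothesis transG : forall e f, e \in E -> e \notin Z -> f \in E -> f \notin Z ->
  exists2 g, g \in G & (f^-1 * e ^ g)%g \in Z.

Local Notation V := (E / Z)%G.
Local Notation n' := (abelem_dim' (gval V)).
Local Notation N := n'.+1.

Let sEG : E \subset G := normal_sub nsE.
Let nZG : G \subset 'N(Z) := cents_norm cZ.
Let nZE : E \subset 'N(Z) := subset_trans sEG nZG.
Let pr_p : prime p. Proof. by have [] := pgroup_pdiv (abelem_pgroup abV) ntV. Qed.

Let nV : (G / Z)%g \subset 'N(V). Proof. exact: quotient_norms (normal_norm nsE). Qed.

Definition chief_mx (g : gT) : 'M['F_p]_N := abelem_repr abV ntV nV (coset Z g).

Lemma chief_mx_repr : mx_repr G chief_mx.
Proof.
split=> [|x y Gx Gy]; first by rewrite /chief_mx morph1 repr_mx1.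
have [nx ny] := (subsetP nZG x Gx, subsetP nZG y Gy).
by rewrite /chief_mx morphM // repr_mxM ?mem_quotient.
Qed.

Definition chief_repr := MxRepresentation chief_mx_repr.

Definition vec (e : gT) : 'rV['F_p]_N := abelem_rV abV ntV (coset Z e).

Lemma vecM e f : e \in E -> f \in E -> vec (e * f)%g = vec e + vec f.
Proof.
move=> Ee Ef; rewrite /vec morphM ?(subsetP nZE) // abelem_rV_M // mem_quotient //.
Qed.

Lemma vec_surj v : exists2 e, e \in E & vec e = v.
Proof.
have := mem_rVabelem abV ntV v => /morphimP[e Ne Ee De]; exists e => //.
by rewrite /vec -De rVabelemK.
Qed.

Lemma vec_eq0 e : e \in E -> (vec e == 0) = (e \in Z).
Proof.
move=> Ee; have Ne := subsetP nZE e Ee.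
apply/eqP/idP=> [|Ze]; last by rewrite /vec coset_id // abelem_rV_1.
rewrite -(abelem_rV_1 abV ntV) => /(abelem_rV_inj _ (group1 _)) E1.
by apply: coset_idr => //; apply: E1; apply: mem_quotient.
Qed.

Lemma vecJ e g : e \in E -> g \in G -> vec (e ^ g)%g = vec e *m chief_repr g.
Proof.
move=> Ee Gg; have [ne ng] := (subsetP nZE e Ee, subsetP nZG g Gg); rewrite /vec morphJ //.
exact: (abelem_rV_J abV ntV nV (mem_quotient Z Ee) (mem_quotient Z Gg)).
Qed.

Lemma rker_chief : rker chief_repr = E.
Proof.
apply/setP=> g; apply/rkerP/idP => [[Gg g1]|Eg].
  apply: centG => // e Ee; have nEg := subsetP (normal_norm nsE) g Gg.
  have : vec (e ^ g)%g = vec e by rewrite vecJ // g1 mulmx1.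
  move=> E1; rewrite -vec_eq0; last by rewrite commgEl groupM ?groupV ?memJ_norm.
  have : vec (e * [~ e, g])%g = vec e by rewrite -conjg_mulR.
  rewrite vecM //; last by rewrite commgEl groupM ?groupV ?memJ_norm.
  by move/(canRL (addKr _)) => ->; rewrite addNr.
have Gg := subsetP sEG g Eg; split=> //.
apply/row_matrixP => i; rewrite !rowE mulmx1.
have [e Ee <-] := vec_surj (delta_mx 0 i); rewrite -vecJ // conjg_mulR vecM ?groupR //.
have -> : vec [~ e, g]%g = 0.
  apply/eqP; rewrite (vec_eq0 (groupR Ee Eg)); have sz : <[z0]>%g \subset Z by rewrite cycle_subG.
  by apply: (subsetP sz); apply: commz0.
by rewrite addr0.
Qed.

Lemma sub_rker_chief : E \subset rker chief_repr.
Proof. by rewrite rker_chief. Qed.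

Definition chief_quo_repr := quo_repr sub_rker_chief (normal_norm nsE).

Definition expz (k : 'F_p) : gT := (z0 ^+ k)%g.

Lemma expzD a b : expz (a + b) = (expz a * expz b)%g.
Proof.
rewrite /expz -expgD; apply: expg_mod.
by rewrite Fp_cast // -oz0 expg_order.
Qed.

Lemma expz_inj : injective expz.
Proof.
move=> a b /eqP; rewrite eq_expg_mod_order oz0 => /eqP E1; apply: val_inj.
by move: E1; rewrite !modn_small // -[X in (_ < X)%N](Fp_cast pr_p).
Qed.

(** Discrete logarithm to the base [z0], with default 0 outside [<[z0]>]; it turns commutators of
    [E] into scalars. *)
Definition dlog (z : gT) : 'F_p := odflt 0 [pick k | expz k == z].

Lemma dlogK z : z \in <[z0]>%g -> expz (dlog z) = z.
Proof.
case/cycleP=> i ->; rewrite /dlog; case: pickP => [k /eqP //|/(_ i%:R)].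
by rewrite /expz val_Fp_nat // -oz0 expg_mod_order eqxx.
Qed.

Lemma dlogM : {in <[z0]> &, forall x y, dlog (x * y)%g = dlog x + dlog y}.
Proof. by move=> x y Zx Zy; apply: expz_inj; rewrite expzD !dlogK ?groupM. Qed.

Lemma dlog1 : dlog 1%g = 0.
Proof. by apply: expz_inj; rewrite dlogK ?group1. Qed.

Lemma dlog_eq0 z : z \in <[z0]>%g -> dlog z = 0 -> z = 1%g.
Proof. by move=> Zz z1; rewrite -(dlogK Zz) z1. Qed.

Let sz0Z : <[z0]>%g \subset Z. Proof. by rewrite cycle_subG. Qed.

Lemma commMl e e' f : e \in E -> e' \in E -> f \in E -> [~ e * e', f]%g = ([~ e, f] * [~ e', f])%g.
Proof.
move=> Ee Ee' Ef; rewrite commMgJ; congr (_ * _)%g; apply/conjg_fixP/commgP/esym.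
have Ze := subsetP sz0Z _ (commz0 Ee Ef).
by apply: (centsP cZ) => //; apply: (subsetP sEG).
Qed.

Lemma dlogMl e e' f : e \in E -> e' \in E -> f \in E ->
  dlog [~ e * e', f]%g = dlog [~ e, f]%g + dlog [~ e', f]%g.
Proof. by move=> Ee Ee' Ef; rewrite commMl // dlogM ?commz0. Qed.

Lemma dlogC e f : e \in E -> f \in E -> dlog [~ f, e]%g = - dlog [~ e, f]%g.
Proof.
move=> Ee Ef; apply/eqP; rewrite -subr_eq0 opprK -dlogM ?commz0 //.
by rewrite -{1}invg_comm mulVg dlog1.
Qed.

Definition lift_vec (v : 'rV['F_p]_N) : gT := odflt 1%g [pick e in E | vec e == v].

Lemma lift_vecP v : lift_vec v \in E /\ vec (lift_vec v) = v.
Proof.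
rewrite /lift_vec; case: pickP => [e /andP[Ee /eqP] //|n].
by have [e Ee De] := vec_surj v; move: (n e); rewrite Ee De eqxx.
Qed.

Lemma dlog_vec e e' f : e \in E -> e' \in E -> f \in E -> vec e = vec e' ->
  dlog [~ e, f]%g = dlog [~ e', f]%g.
Proof.
move=> Ee Ee' Ef Dv; have Zd : (e'^-1 * e)%g \in Z.
  rewrite -vec_eq0 ?groupM ?groupV // vecM ?groupV // Dv -vecM ?groupV // mulVg vec_eq0 ?group1 //.
rewrite -[e](mulKVg e') dlogMl ?groupM ?groupV // (_ : [~ _ * e, f]%g = 1%g) ?dlog1 ?addr0 //.
by apply/eqP/commgP/esym; apply: (centsP cZ) => //; apply: (subsetP sEG).
Qed.

Definition beta (u v : 'rV['F_p]_N) := dlog [~ lift_vec u, lift_vec v]%g.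

Lemma betaE e f : e \in E -> f \in E -> beta (vec e) (vec f) = dlog [~ e, f]%g.
Proof.
move=> Ee Ef; have [El Dl] := lift_vecP (vec e); have [Er Dr] := lift_vecP (vec f).
rewrite /beta (dlog_vec El Ee Er Dl) -[LHS]opprK -dlogC // (dlog_vec Er Ef Ee Dr).
by rewrite -dlogC.
Qed.

Lemma betaC u v : beta v u = - beta u v.
Proof. by apply: dlogC; have [] := lift_vecP u; have [] := lift_vecP v. Qed.

Lemma betaDl u u' v : beta (u + u') v = beta u v + beta u' v.
Proof.
have [e Ee <-] := vec_surj u; have [e' Ee' <-] := vec_surj u'; have [f Ef <-] := vec_surj v.
by rewrite -vecM // !betaE ?groupM // dlogMl.
Qed.

Lemma beta0l v : beta 0 v = 0.
Proof. by apply: (addrI (beta 0 v)); rewrite -betaDl !addr0. Qed.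

Lemma betaZl a u v : beta (a *: u) v = a * beta u v.
Proof.
rewrite -[a]natr_Zp scaler_nat mulr_natl; elim: (a : nat) => [|k IH]; first by rewrite !mulr0n beta0l.
by rewrite !mulrS betaDl IH.
Qed.

Lemma beta_suml (I : finType) (F : I -> 'rV_N) v : beta (\sum_i F i) v = \sum_i beta (F i) v.
Proof. exact: (big_morph (beta^~ v) (fun u u' => betaDl u u' v) (beta0l v)). Qed.

Definition chief_form : 'M['F_p]_N := \matrix_(i, j) beta (delta_mx 0 i) (delta_mx 0 j).

Lemma chief_formE u v : u *m chief_form *m v^T = (beta u v)%:M.
Proof.
apply/matrixP => i j; rewrite !ord1 !mxE eqxx mulr1n.
rewrite {2}[v]row_sum_delta betaC beta_suml -sumrN; apply: eq_bigr => k _.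
rewrite betaZl [v^T _ _]mxE mulrC -mulrN -betaC; congr (_ * _).
by rewrite mxE [in RHS](row_sum_delta u) beta_suml; apply: eq_bigr => l _; rewrite betaZl !mxE.
Qed.

Lemma chief_form_skew : chief_form^T = - chief_form.
Proof. by apply/matrixP => i j; rewrite !mxE betaC. Qed.

(** A vector in the radical lifts to an element commuting with all of [E], hence in [Z]. *)
Lemma chief_form_unit : chief_form \in unitmx.
Proof.
apply: unitmx_ker; apply/row_matrixP => i; rewrite row0.
have : row i (kermx chief_form) *m chief_form = 0 by apply/sub_kermxP; apply: row_sub.
have [e Ee <-] := vec_surj (row i (kermx chief_form)) => e0.
apply/eqP; rewrite vec_eq0 //; apply: centE => // y Ey.
apply: dlog_eq0; first exact: commz0.
rewrite -betaE //; have := chief_formE (vec e) (vec y); rewrite e0 mul0mx.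
by move/matrixP/(_ 0 0); rewrite !mxE eqxx mulr1n.
Qed.

Lemma chief_form_inv g : g \in G -> chief_repr g *m chief_form *m (chief_repr g)^T = chief_form.
Proof.
move=> Gg; have nEg := subsetP (normal_norm nsE) g Gg.
have E1 u v : beta (u *m chief_repr g) (v *m chief_repr g) = beta u v.
  have [e Ee <-] := vec_surj u; have [f Ef <-] := vec_surj v.
  rewrite -!vecJ // !betaE ?memJ_norm // -conjRg; congr dlog.
  apply/conjg_fixP/commgP/esym; apply: (centsP cZ) => //.
  by apply: (subsetP sz0Z); apply: commz0.
apply/matrixP => i j; rewrite [in RHS]mxE -E1.
have /matrixP/(_ 0 0) := chief_formE (delta_mx 0 i *m chief_repr g) (delta_mx 0 j *m chief_repr g).
rewrite [in RHS]mxE eqxx mulr1n => <-.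
by rewrite trmx_mul trmx_delta -!mulmxA -rowE !mulmxA -colE !mxE.
Qed.

Lemma chief_trans_vec (u v : 'rV['F_p]_N) : u != 0 -> v != 0 ->
  exists2 h, h \in (G / E)%g & v = u *m chief_quo_repr h.
Proof.
have [e Ee <-] := vec_surj u; have [f Ef <-] := vec_surj v; rewrite !vec_eq0 // => ne nf.
have [g Gg Zfe] := transG Ee ne Ef nf; have nEg := subsetP (normal_norm nsE) g Gg.
exists (coset E g); first exact: mem_quotient.
rewrite quo_repr_coset // -vecJ //; have Ez := subsetP sZE _ Zfe.
have d0 : vec (f^-1 * e ^ g)%g = 0 by apply/eqP; rewrite vec_eq0.
by rewrite -(mulKVg f (e ^ g)%g) vecM // d0 addr0.
Qed.

Lemma chief_form_quo h : h \in (G / E)%g -> chief_quo_repr h *m chief_form *m (chief_quo_repr h)^T = chief_form.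
Proof. by case/morphimP=> g _ Gg ->; rewrite quo_repr_coset // chief_form_inv. Qed.

Lemma chief_quo_faithful : mx_faithful chief_quo_repr.
Proof. by rewrite /mx_faithful rker_quo rker_chief trivg_quotient. Qed.
End CommForm.

Lemma chief_symplectic_repr (gT : finGroupType) (G : {group gT}) (chi alpha : 'CF(G)) (m : nat) (E : {group gT})
    (solG : solvable G) (irr_chi : chi \in irr G) (ffchi : cfaithful chi)
    (irr_alpha : alpha \in irr G) (m_gt0 : (0 < m)%N)
    (chi_conj : (chi * chi^*%CF = 1 + m%:R *: alpha)%R)
    (chiefE : chief_factor G 'Z(G) E) :
  [/\ m = 1%N, (chi 1%g ^+ 2 = #|E : 'Z(G)|%:R)%R &
   exists p n' n : nat, exists rH : mx_representation 'F_p (G / E) n'.+1,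
   exists J : 'M['F_p]_n'.+1,
  [/\ prime p, n'.+1 = n.*2, chi 1%g = (p ^ n)%:R%R, mx_faithful rH &
   [/\ forall u v : 'rV['F_p]_n'.+1, u != 0%R -> v != 0%R -> exists2 h, h \in (G / E)%g & v = (u *m rH h)%R,
      J \in unitmx, forall h, h \in (G / E)%g -> (rH h *m J *m (rH h)^T = J)%R & (J^T = - J)%R]]].
Proof.
have sqr := chi1_sqr irr_chi ffchi irr_alpha chi_conj solG chiefE.
have m1 := m_eq1 irr_chi ffchi irr_alpha m_gt0 chi_conj solG chiefE.
split=> //.
have [nsE ltZE sEG nsZE cEZ] := chief_facts solG chiefE.
have minE := chief_factor_minnormal chiefE.
have [_ ntE /is_abelemP[p pr_p abE]] := minnormal_solvable minE (subxx _) (quotient_sol _ (solvableS sEG solG)).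
have cyc : cyclic 'Z(G) by have [i Di] := irrP irr_chi; apply: (@irr_faithful_center _ _ i); rewrite -Di.
have cZ : G \subset 'C('Z(G)) by rewrite centsC subsetIr.
have commZ := zeta_comm solG chiefE.
(* [x ^+ p] is central and commutators are central, so [[~ x, y] ^+ p] is [[~ x ^+ p, y] = 1]. *)
have commE x y : x \in E -> y \in E -> ([~ x, y] ^+ p = 1)%g.
  move=> Ex Ey; have Zxy := commZ x y Ex Ey; rewrite -commXg.
    apply/eqP/commgP; have Zxp : x ^+ p \in 'Z(G).
      have nx := subsetP (normal_norm nsZE) x Ex.
      rewrite coset_idr ?groupX // morphX //; have [_ _] := and3P abE.
      by move/exponentP; apply; apply: mem_quotient.
    by apply/commute_sym/(centsP cZ) => //; apply: (subsetP sEG).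
  by apply: (centsP cZ) => //; apply: (subsetP sEG).
have ltE : ~~ (E \subset 'Z(G)) by case/andP: ltZE.
have cE := cent_chief irr_chi ffchi irr_alpha chi_conj solG chiefE.
have [x [y [Ex Ey nxy]]] : exists x y, [/\ x \in E, y \in E & [~ x, y] != 1].
  have : ~~ (E \subset 'C(E)) by apply: contra ltE => cEE; rewrite -cE subsetI sEG.
  case/subsetPn=> x Ex; rewrite -sub_cent1 => /subsetPn[y Ey nxy].
  by exists x, y; split=> //; apply: contra nxy => /commgP xy; apply/cent1P.
have oz0 : #[[~ x, y]] = p by apply: nt_prime_order => //; apply: commE.
have Zz0 := commZ x y Ex Ey.
(* The centre is cyclic because [chi] is faithful and irreducible, so it has a single subgroup of
   order [p]. *)
have commz0 : {in E &, forall a b, [~ a, b] \in <[[~ x, y]]>}.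
  move=> a b Ea Eb; have [->|nab] := eqVneq [~ a, b] 1; first exact: group1.
  have oc : #[[~ a, b]] = p by apply: nt_prime_order => //; apply: commE.
  rewrite -cycle_subG; have /eqP-> : <[[~ a, b]]> == <[[~ x, y]]>.
    by rewrite (eq_subG_cyclic cyc) ?cycle_subG ?commZ // -!orderE oc oz0.
  exact: subxx.
have ntV : E / 'Z(G) != 1 by [].
have centE a : a \in E -> (forall b, b \in E -> [~ a, b] = 1) -> a \in 'Z(G).
  move=> Ea ab; rewrite -cE inE (subsetP sEG) //; apply/centP => b Eb.
  by apply/commgP/eqP/ab.
have centG := cent_quotient_chief irr_chi ffchi irr_alpha chi_conj solG chiefE.
have trG := chief_trans irr_chi ffchi irr_alpha m_gt0 chi_conj solG chiefE.
have sZG := center_sub G; have sZE := proper_sub ltZE.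
have oV : #|E / 'Z(G)| = (p ^ (abelem_dim' (E / 'Z(G))%G).+1)%N.
  by rewrite (dim_abelemE abE ntV) -p_part part_pnat_id //; apply: abelem_pgroup abE.
have [d Dd] : exists d, (chi 1%g = d%:R)%R.
  by have [i ->] := irrP irr_chi; exists (irr_degree (socle_of_Iirr i)); rewrite irr1_degree.
(* That [|E / Z|] is the square of the degree [d] makes the dimension even and [d] a power of
   [p]. *)
have d2 : (d ^ 2 = p ^ (abelem_dim' (E / 'Z(G))%G).+1)%N.
  move: sqr; rewrite Dd -natrX => /eqP; rewrite eqr_nat => /eqP->.
  by rewrite -oV card_quotient // normal_norm.
have [n Dn] : exists n, d = (p ^ n)%N.
  have /(dvdn_pfactor _ _ pr_p)[n _ ->] : (d %| p ^ (abelem_dim' (E / 'Z(G))%G).+1)%N.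
    by rewrite -d2 dvdn_exp.
  by exists n.
exists p, (abelem_dim' (E / 'Z(G))%G), n.
exists (chief_quo_repr nsE cZ abE ntV Zz0 commz0 centG).
exists (chief_form [~ x, y] abE ntV).
split=> //.
- apply/eqP; rewrite -(eqn_exp2l _ _ (prime_gt1 pr_p)) -d2 Dn -expnM muln2 //.
- by rewrite Dd Dn.
- exact: chief_quo_faithful.
split.
- exact: chief_trans_vec.
- by apply: (@chief_form_unit _ G 'Z(G)%G E p [~ x, y]).
- by move=> h Hh; apply: chief_form_quo.
- exact: (chief_form_skew abE ntV oz0 commz0).
Qed.

Lemma mul_cycle_card (gT : finGroupType) (M : {group gT}) (x : gT) (k : nat) :
  x \in 'N(M) -> x ^+ k \in M -> 0 < k -> #|M <*> <[x]>| <= #|M| * k.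
Proof.
move=> nMx Mxk k_gt0; rewrite norm_joinEr ?cycle_subG //.
have := mul_cardG M <[x]>; have sxk : <[x ^+ k]> \subset M :&: <[x]>.
  by rewrite cycle_subG inE Mxk mem_cycle.
have ox : #|<[x]>| <= #|<[x ^+ k]>| * k.
  rewrite -!orderE orderXgcd -{1}(divnK (dvdn_gcdl #[x] k)) leq_mul2l dvdn_leq ?orbT ?dvdn_gcdr //.
move=> E1; have I_gt0 : 0 < #|M :&: <[x]>| := cardG_gt0 _.
rewrite -(leq_pmul2r I_gt0) -E1 -mulnA leq_mul2l (leq_trans ox) ?orbT // mulnC leq_mul2l.
by rewrite subset_leq_card ?orbT.
Qed.

(** * Recognising SL(2, 3) and the binary octahedral group *)

Section Triples.
Variable R : forall gT : finGroupType, gT -> gT -> gT -> Prop.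
Variable N : nat.
Hypothesis RX : forall (gT rT : finGroupType) (a b c : gT) (a' b' c' : rT),
  R a b c -> R a' b' c' -> R (a, a') (b, b') (c, c').
Hypothesis RN : forall (gT : finGroupType) (a b c : gT), R a b c -> #|<<[set a; b; c]>>| <= N.

(* The diagonal triple generates a subgroup of the product which is mapped
   isomorphically onto the first factor by the bound on its order, and so is
   the graph of a homomorphism. *)
Lemma triple_homg (gT rT : finGroupType) (a b c : gT) (a' b' c' : rT) :
  R a b c -> R a' b' c' -> #|<<[set a; b; c]>>| = N ->
  <<[set a'; b'; c']>> \homg <<[set a; b; c]>>.
Proof.
move=> Rg Rr oN; pose D := <<[set (a, a'); (b, b'); (c, c')]>>%G.
have oD : #|D| <= N := RN (RX Rg Rr).
have im1 : [morphism of @fst gT rT] @* D = <<[set a; b; c]>>.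
  rewrite morphim_gen ?subsetT //; congr <<_>>.
  by rewrite !morphimU !morphim_set1 ?inE.
have im2 : [morphism of @snd gT rT] @* D = <<[set a'; b'; c']>>.
  rewrite morphim_gen ?subsetT //; congr <<_>>.
  by rewrite !morphimU !morphim_set1 ?inE.
have inj : 'injm (restrm (subsetT D) [morphism of @fst gT rT]).
  apply/injmP; apply/imset_injP; rewrite -morphimEdom morphim_restrm setIid im1 oN.
  apply/eqP/anti_leq; by rewrite oD andbT -oN -im1 leq_morphim.
have isoD : D \isog <<[set a; b; c]>>.
  by apply/isogP; exists (restrm_morphism (subsetT D) [morphism of @fst gT rT]); rewrite ?morphim_restrm ?setIid.
apply: homg_trans (isog_hom isoD); rewrite -im2.
exact: morphim_homg.
Qed.
End Triples.

Lemma cycle4P (gT : finGroupType) (a u : gT) : #[a] = 4 -> u \in <[a]> ->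
  [\/ u = 1, u = a, u = a ^+ 2 | u = a^-1].
Proof.
move=> oa /cyclePmin[k]; rewrite oa; case: k => [|[|[|[|k]]]] // _ ->.
- by constructor 1; rewrite expg0.
- by constructor 2; rewrite expg1.
- by constructor 3.
constructor 4; apply/esym/eqP; rewrite eq_invg_mul -expgS -[4]oa expg_order //.
Qed.

Section Q8.
Variables (gT : finGroupType) (T : {group gT}).
Hypothesis iT : T \isog 'Q_8.

Lemma Q8_order4 (a b : gT) : a \in T -> #[a] = 4 -> b \in T -> b \notin <[a]> ->
  [/\ a ^ b = a^-1, b ^+ 2 = a ^+ 2, #[b] = 4 & <[a]> * <[b]> = T :> {set gT}].
Proof.
move=> Ta oa Tb nab.
have [x [y [oT [Tx Ty] [ox oy] [nXy xy y2 DT] [inv DZ _]]]] := quaternion_gens iT.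
have nabT : ~~ abelian T.
  apply/negP => cTT; have := xy; rewrite (conjgE x y) (centsP cTT x Tx y Ty) mulKg.
  move/esym/eqP; rewrite eq_invg_mul -(expgS x 1) -order_dvdn ox //.
have pT : 2.-group T by rewrite /pgroup oT.
have iaT : #|T : <[a]>| = 2 by rewrite -divgS ?cycle_subG // -orderE oT oa.
have nsa : <[a]> <| T by apply: index2_normal; rewrite ?cycle_subG.
have nab' : <[b]> \subset 'N(<[a]>) by rewrite cycle_subG (subsetP (normal_norm nsa)).
have Dab : <[a]> * <[b]> = T.
  apply/eqP; rewrite eqEcard mul_subG ?cycle_subG // -(norm_joinEr nab').
  have lt : #|<[a]>| < #|<[a]> <*> <[b]>|.
    apply: proper_card; rewrite properE joing_subl; apply: contra nab => /subsetP; apply.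
    by rewrite mem_gen // inE cycle_id orbT.
  have dv : #|<[a]> <*> <[b]>| %| 8 by rewrite -oT cardSg // join_subG !cycle_subG Ta.
  have dv4 : 4 %| #|<[a]> <*> <[b]>| by rewrite -oa orderE cardSg // joing_subl.
  rewrite oT; move: lt; rewrite -orderE oa; case/dvdnP: dv4 dv => k ->.
  rewrite (@dvdn_pmul2r 4 k 2) // (@ltn_pmul2r 4 1 k) // (@leq_pmul2r 4 2 k) //.
have uinv u v : u \in T -> v \in T -> #[u] = 2 -> #[v] = 2 -> u = v.
  by move=> Tu Tv /(inv u Tu)-> /(inv v Tv)->.
have oa2 : #[a ^+ 2] = 2 by rewrite orderXdiv oa.
have ncab : a ^ b != a.
  apply: contra nabT => /eqP/conjg_fixP/commgP cab; rewrite -Dab abelianM !cycle_abelian /=.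
  by rewrite cent_cycle cycle_subG; apply/cent1P.
have aab : a ^ b = a^-1.
  have : a ^ b \in <[a]> by rewrite memJ_norm ?cycle_id // (subsetP (normal_norm nsa)).
  case/(cycle4P oa) => // ab; have := orderJ a b; rewrite ab oa.
  - by rewrite order1.
  - by rewrite ab eqxx in ncab.
  - by rewrite oa2.
have ob : #[b] = 4.
  have : #[b] %| (2 ^ 3)%N by rewrite -[(2 ^ 3)%N]oT order_dvdG.
  case/(dvdn_pfactor _ _ (isT : prime 2)) => [[|[|[|[|k]]]]] // _ ob.
  - by move/eqP: ob; rewrite order_eq1 => /eqP b1; rewrite b1 group1 in nab.
  - have E1 : b = a ^+ 2 by apply: uinv; rewrite ?groupX.
    by rewrite E1 mem_cycle in nab.
  case/negP: nabT; suff -> : T :=: <[b]> by apply: cycle_abelian.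
  by apply/esym/eqP; rewrite eqEcard cycle_subG Tb -orderE ob oT.
split=> //; apply: uinv; rewrite ?groupX // orderXdiv ?ob //.
Qed.

Variable z : gT.
Hypotheses (nTz : z \in 'N(T)) (z3 : z ^+ 3 = 1) (ncTz : z \notin 'C(T)).

(** If [z] normalised [<[i]>] it would fix [i], since inverting it has order 2. For [b] outside
    [<[i]>], [b ^ z = c * b] with [c] in [<[i]>]; then [c ^+ 3 = 1], so [c = 1] and [z] centralises
    [T]. *)
Lemma Q8_order3_notin (i : gT) : i \in T -> #[i] = 4 -> i ^ z \notin <[i]>.
Proof.
move=> Ti oi; apply/negP => iz; case/negP: ncTz.
have J3 u : ((u ^ z) ^ z) ^ z = u by rewrite -!conjgM -[RHS]conjg1 -z3.
have izi : i ^ z = i.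
  have oz := orderJ i z; case: (cycle4P oi iz) => // E1.
  - by move: oz; rewrite E1 order1 oi.
  - by move: oz; rewrite E1 orderXdiv oi.
  by have := J3 i; rewrite E1 conjVg E1 invgK E1.
have [oT _ _ _ _] : [/\ #|T| = 8, True, True, True & True].
  by have [x [y [oT _ _ _ _]]] := quaternion_gens iT.
have [b Tb nib] : exists2 b, b \in T & b \notin <[i]>.
  by apply/subsetPn; apply/negP => /subset_leq_card; rewrite oT -orderE oi.
have [ib b2 ob DT] := Q8_order4 Ti oi Tb nib.
have iJ u : u \in <[i]> -> u ^ z = u by case/cycleP=> k ->; rewrite conjXg izi.
have nbz : b ^ z \notin <[i]>.
  by apply: contra nib => bz; rewrite -(J3 b) (iJ _ bz) (iJ _ bz).
have : b ^ z \in <[i]> :* b.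
  have iiT : #|T : <[i]>| = 2 by rewrite -divgS ?cycle_subG // -orderE oT oi.
  have -> : <[i]> :* b = T :\: <[i]>.
    by apply: rcoset_index2; rewrite ?cycle_subG // inE nib.
  by rewrite inE nbz memJ_norm.
case/rcosetP=> c ic Db; have := J3 b.
rewrite Db (conjMg c b z) (iJ _ ic) Db mulgA (conjMg (c * c) b z) Db (iJ _ (groupM ic ic)) !mulgA.
rewrite -{2}[b]mul1g => /mulIg c3.
have c1 : c = 1.
  have : c ^+ 4 = 1 by case/cycleP: ic => k ->; rewrite -expgM mulnC expgM -[4]oi expg_order expg1n.
  by rewrite !expgS expg0 mulg1 !mulgA c3 mul1g.
rewrite -DT centM !cent_cycle; apply/setIP; split; apply/cent1P; apply/commute_sym/commgP/conjg_fixP => //.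
by rewrite Db c1 mul1g.
Qed.

(** [j ^ z] avoids both [<[i]>] and [<[j]>], which leaves two elements of the coset [<[i]> :* j].
    Replacing [i] by its inverse exchanges the two cases. *)
Lemma Q8_order3_rel (i : gT) (j := i ^ z) : i \in T -> #[i] = 4 ->
  [/\ j \in T, i ^ j = i^-1, j ^+ 2 = i ^+ 2, <[i]> * <[j]> = T :> {set gT}
    & j ^ z = i * j \/ j ^ z = i^-1 * j].
Proof.
move=> Ti oi; have nij : j \notin <[i]> := Q8_order3_notin Ti oi.
have Tj : j \in T by rewrite memJ_norm.
have [ij j2 oj DT] := Q8_order4 Ti oi Tj nij.
split=> //; have njz : j ^ z \notin <[j]> := Q8_order3_notin Tj oj.
have J3 u : ((u ^ z) ^ z) ^ z = u by rewrite -!conjgM -[RHS]conjg1 -z3.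
have njz' : j ^ z \notin <[i]>.
  apply: contra nij => jz; have oz : #[j ^ z] = 4 by rewrite orderJ.
  have [jz1|jz1] : j ^ z = i \/ j ^ z = i^-1.
    case: (cycle4P oi jz) => E1; [|by left| |by right].
      by move: oz; rewrite E1 order1.
    by move: oz; rewrite E1 orderXdiv oi.
  - by have := J3 i; rewrite -/j jz1 -/j => ->; apply: cycle_id.
  - by have := J3 i; rewrite -/j jz1 conjVg -/j => <-; rewrite cycleV cycle_id.
have [x [y [oT _ _ _ _]]] := quaternion_gens iT.
have : j ^ z \in <[i]> :* j.
  have iiT : #|T : <[i]>| = 2 by rewrite -divgS ?cycle_subG // -orderE oT oi.
  have -> : <[i]> :* j = T :\: <[i]>.
    by apply: rcoset_index2; rewrite ?cycle_subG // inE nij.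
  by rewrite inE njz' memJ_norm.
case/rcosetP=> c ic Dc; rewrite Dc.
case: (cycle4P oi ic) => E1; rewrite E1; [|by left| |by right].
  by rewrite Dc E1 mul1g cycle_id in njz.
by rewrite Dc E1 -j2 -expgSr mem_cycle in njz.
Qed.
End Q8.

(** Relations of the semidirect product of ['Q_8] by a group of order 3 permuting [i], [j], [i * j]
    cyclically. *)
Definition rel_SL23 (gT : finGroupType) (i j z : gT) :=
  [/\ i ^+ 4 = 1, j ^+ 2 = i ^+ 2, i ^ j = i^-1, z ^+ 3 = 1 & i ^ z = j /\ j ^ z = i * j].

Lemma expg_pair (gT rT : finGroupType) (a : gT) (b : rT) n : (a, b) ^+ n = (a ^+ n, b ^+ n).
Proof. by elim: n => // n IH; rewrite !expgS IH. Qed.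

Lemma rel_SL23_pair (gT rT : finGroupType) (a b c : gT) (a' b' c' : rT) :
  rel_SL23 a b c -> rel_SL23 a' b' c' -> rel_SL23 (a, a') (b, b') (c, c').
Proof.
case=> r1 r2 r3 r4 [r5 r6] [r1' r2' r3' r4' [r5' r6']]; split; rewrite ?expg_pair.
- by rewrite r1 r1'.
- by rewrite r2 r2'.
- by rewrite -[LHS]/(a ^ b, a' ^ b') r3 r3'.
- by rewrite r4 r4'.
by split; [rewrite -[LHS]/(a ^ c, a' ^ c') r5 r5' | rewrite -[LHS]/(b ^ c, b' ^ c') r6 r6'].
Qed.

Lemma rel_SL23_norm (gT : finGroupType) (i j z : gT) : rel_SL23 i j z ->
  #|<[i]> <*> <[j]>| <= 8 /\ z \in 'N(<[i]> <*> <[j]>).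
Proof.
case=> i4 j2 ij z3 [iz jz]; split.
  have nj : j \in 'N(<[i]>) by apply/normP; rewrite -cycleJ ij cycleV.
  have := @mul_cycle_card _ <[i]>%G j 2 nj; rewrite j2 mem_cycle => /(_ isT isT)/leq_trans; apply.
  by rewrite (@leq_pmul2r 2 _ 4) // -orderE dvdn_leq // order_dvdn i4.
rewrite inE conjYg -!cycleJ iz jz.
rewrite join_subG !cycle_subG groupM ?mem_gen // inE ?cycle_id ?orbT //.
Qed.

Lemma rel_SL23_card (gT : finGroupType) (i j z : gT) : rel_SL23 i j z ->
  #|<<[set i; j; z]>>| <= 24.
Proof.
move=> R; have [T8 nz] := rel_SL23_norm R; have [_ _ _ z3 _] := R.
have := @mul_cycle_card _ (<[i]> <*> <[j]>)%G z 3 nz; rewrite z3 group1 => /(_ isT isT) le.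
apply: leq_trans (leq_trans le (@leq_mul _ _ 8 3 T8 (leqnn 3))).
apply: subset_leq_card; rewrite gen_subG; apply/subsetP => u; rewrite !inE -orbA.
have sj : <[j]> \subset <[i]> <*> <[j]> := joing_subr _ _.
have si : <[i]> \subset <[i]> <*> <[j]> := joing_subl _ _.
case/or3P=> /eqP->; last by apply: (subsetP (joing_subr _ _)); apply: cycle_id.
  by apply: (subsetP (subset_trans si (joing_subl _ _))); apply: cycle_id.
by apply: (subsetP (subset_trans sj (joing_subl _ _))); apply: cycle_id.
Qed.

Lemma rel_SL23_exists (gT : finGroupType) (H T : {group gT}) : T <| H -> T \isog 'Q_8 ->
  'C_H(T) \subset T -> #|H| = 24 -> exists i j z, rel_SL23 i j z /\ H :=: <<[set i; j; z]>>.
Proof.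
move=> nsT iT cT oH; have [sTH nTH] := andP nsT.
have d3H : 3 %| #|H| by rewrite oH.
have [z Hz oz] := Cauchy (isT : prime 3) d3H.
have z3 : z ^+ 3 = 1 by rewrite -[3]oz expg_order.
have [x [y [oT [Tx Ty] [ox oy] _ _]]] := quaternion_gens iT.
have nzT : z \notin 'C(T).
  apply/negP => cz; have : z \in T by apply: (subsetP cT); rewrite inE Hz.
  by move/order_dvdG; rewrite oT oz.
have nz := subsetP nTH z Hz.
have [i [Ti oi jz]] : exists i, [/\ i \in T, #[i] = 4 & (i ^ z) ^ z = i * i ^ z].
  have [Tj xj j2 DT [jz|jz]] := Q8_order3_rel iT nz z3 nzT Tx ox; first by exists x.
  exists x^-1; rewrite groupV orderV; split=> //; rewrite !conjVg jz.
  by rewrite invMg invgK; apply: (canRL (mulgK (x ^ z))); rewrite -mulgA -conjgE xj.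
have [Tj ij j2 DT _] := Q8_order3_rel iT nz z3 nzT Ti oi.
exists i, (i ^ z), z; split.
  by split=> //; rewrite -[4]oi expg_order.
apply/eqP; rewrite eq_sym eqEcard gen_subG; apply/andP; split.
  apply/subsetP => u; rewrite !inE -orbA => /or3P[]/eqP->//; exact: (subsetP sTH).
have sT : T \subset <<[set i; i ^ z; z]>>.
  by rewrite -DT mul_subG // cycle_subG mem_gen // !inE eqxx ?orbT.
have d8 := cardSg sT; have d3 : 3 %| #|<<[set i; i ^ z; z]>>|.
  by rewrite -oz order_dvdG // mem_gen // !inE eqxx orbT.
by rewrite oH dvdn_leq // (@Gauss_dvd 8 3) // -{1}oT d8.
Qed.

Definition mx22 (R : Type) (a b c d : R) : 'M[R]_2 :=
  \matrix_(i, j) if i == 0%R then (if j == 0%R then a else b) else (if j == 0%R then c else d).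

Lemma mulmx22 (F : fieldType) (a b c d a' b' c' d' : F) :
  (mx22 a b c d *m mx22 a' b' c' d' =
    mx22 (a * a' + b * c') (a * b' + b * d') (c * a' + d * c') (c * b' + d * d'))%R.
Proof. by apply: mx2P; rewrite !mulmx2E !mxE. Qed.

Lemma det_mx22E (F : fieldType) (a b c d : F) : (\det (mx22 a b c d) = a * d - b * c)%R.
Proof. by rewrite det_mx22 !mxE. Qed.

(** Singular matrices are sent to 1; the matrices used have determinant 1. *)
Definition GL22 (M : 'M['F_3]_2) : {'GL_2['F_3]} := insubd (1%g : {'GL_2['F_3]}) M.

Lemma conjg_eqM (gT : finGroupType) (x y w : gT) : x * y = y * w -> x ^ y = w.
Proof. by move=> E; rewrite conjgE E mulKg. Qed.

Lemma SL23_triple : exists i j z : {'GL_2['F_3]},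
  [/\ rel_SL23 i j z, [/\ i \in SL 2 'F_3, j \in SL 2 'F_3 & z \in SL 2 'F_3],
      i ^+ 2 != 1 & z != 1].
Proof.
have V (a b c d : 'F_3) : (a * d - b * c = 1)%R -> GLval (GL22 (mx22 a b c d)) = mx22 a b c d.
  move=> d1; apply: insubdK; change (mx22 a b c d \in unitmx).
  by rewrite unitmxE det_mx22E d1 unitr1.
have ex (a b c d : 'F_3) : (a * d - b * c == 1)%R -> exists u : {'GL_2['F_3]}, GLval u = mx22 a b c d.
  by move/eqP/V; exists (GL22 (mx22 a b c d)).
(* [i] and [j] generate the quaternion subgroup of SL(2, 3), and [z] is a transvection. *)
have [i Vi] := ex 0%R 1%R (-1)%R 0%R isT.
have [j Vj] := ex 1%R (-1)%R (-1)%R (-1)%R isT.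
have [z Vz] := ex 1%R 1%R 0%R 1%R isT.
have eqGL (u v : {'GL_2['F_3]}) : GLval u = GLval v -> u = v by apply: val_inj.
have E2 (a b c d a' b' c' d' : 'F_3) : a == a' -> b == b' -> c == c' -> d == d' ->
  mx22 a b c d = mx22 a' b' c' d' by move=> /eqP-> /eqP-> /eqP-> /eqP->.
have ij : i * j * i = j.
  by apply: eqGL; rewrite !GL_MxE Vi Vj !mulmx22; apply: E2; vm_compute.
have iz : i * z = z * j.
  by apply: eqGL; rewrite !GL_MxE Vi Vj Vz !mulmx22; apply: E2; vm_compute.
have jz : j * z = z * (i * j).
  by apply: eqGL; rewrite !GL_MxE Vi Vj Vz !mulmx22; apply: E2; vm_compute.
have i2 : GLval (i ^+ 2) = mx22 (-1)%R 0%R 0%R (-1)%R.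
  by rewrite !expgS expg0 mulg1 !GL_MxE Vi !mulmx22; apply: E2; vm_compute.
have j2 : j ^+ 2 = i ^+ 2.
  by apply: eqGL; rewrite i2 !expgS expg0 mulg1 !GL_MxE Vj !mulmx22; apply: E2; vm_compute.
have one : GLval (1 : {'GL_2['F_3]}) = mx22 1%R 0%R 0%R 1%R.
  by rewrite GL_1E; apply: mx2P; rewrite !mxE.
exists i, j, z; split.
- split=> //.
  + by apply: eqGL; rewrite (expgM i 2 2) [_ ^+ 2 ^+ 2]expgS expg1 GL_MxE i2 mulmx22 one; apply: E2; vm_compute.
  + by apply: conjg_eqM; rewrite -{2}ij mulgK.
  + by apply: eqGL; rewrite !expgS expg0 mulg1 !GL_MxE Vz !mulmx22 one; apply: E2; vm_compute.
  by split; apply: conjg_eqM.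
- by split; rewrite inE ?Vi ?Vj ?Vz det_mx22E.
- by apply/eqP => /(congr1 GLval); rewrite i2 one => /matrixP/(_ 0%R 0%R); rewrite !mxE.
by apply/eqP => /(congr1 GLval); rewrite Vz one => /matrixP/(_ 0%R 1%R); rewrite !mxE.
Qed.

Lemma rel_SL23_full (gT : finGroupType) (K : {group gT}) (i j z : gT) : rel_SL23 i j z ->
  i ^+ 2 != 1 -> z != 1 -> i \in K -> j \in K -> z \in K -> 24 %| #|K|.
Proof.
move=> R ni nz Ki Kj Kz; have [T8 _] := rel_SL23_norm R; have [i4 j2 ij z3 _] := R.
have oi : #[i] = 4.
  have : #[i] %| (2 ^ 2)%N by rewrite order_dvdn -[(2 ^ 2)%N]/4%N i4.
  case/(dvdn_pfactor _ _ (isT : prime 2)) => [[|[|[|k]]]] // _ oi.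
    by move/eqP: oi ni; rewrite order_eq1 => /eqP->; rewrite expg1n eqxx.
  by move: ni; rewrite -[2]/(2 ^ 1)%N -oi expg_order eqxx.
have oz : #[z] = 3 by apply: nt_prime_order.
have sT : <[i]> <*> <[j]> \subset K by rewrite join_subG !cycle_subG Ki.
have o8 : #|<[i]> <*> <[j]>| = 8.
  have d4 : 4 %| #|<[i]> <*> <[j]>| by rewrite -oi orderE cardSg // joing_subl.
  have lt : #|<[i]>| < #|<[i]> <*> <[j]>|.
    apply: proper_card; rewrite properE joing_subl; apply/negP => /(subset_trans (joing_subr _ _)).
    rewrite cycle_subG => ji; case/negP: ni.
    have : i ^ j = i by apply/conjg_fixP/commgP; apply: (centsP (cycle_abelian i)); rewrite ?cycle_id.
    by rewrite ij => /eqP; rewrite eq_invg_mul -(expgS i 1).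
  move: lt T8; rewrite -orderE oi; case/dvdnP: d4 => k ->.
  by rewrite (@ltn_pmul2r 4 1 k) // (@leq_pmul2r 4 k 2) //; case: k => [|[|[|k]]].
by rewrite (@Gauss_dvd 8 3) // -{1}o8 cardSg // -oz order_dvdG.
Qed.

Lemma isog_SL23 (gT : finGroupType) (H T : {group gT}) : T <| H -> T \isog 'Q_8 ->
  'C_H(T) \subset T -> #|H| = 24 -> H \isog SL 2 'F_3.
Proof.
move=> nsT iT cT oH; have [i [j [z [R DH]]]] := rel_SL23_exists nsT iT cT oH.
have [i' [j' [z' [R' [Si Sj Sz] ni nz]]]] := SL23_triple.
have hom := triple_homg rel_SL23_pair rel_SL23_card R R'.
have DS : SL 2 'F_3 = <<[set i'; j'; z']>>.
  apply/esym/eqP; rewrite eqEcard gen_subG; apply/andP; split.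
    by apply/subsetP => u; rewrite !inE -orbA => /or3P[]/eqP->; move: Si Sj Sz; rewrite !inE.
  rewrite [#|SL 2 'F_3|]card_SL_2_3 dvdn_leq //.
  by apply: (rel_SL23_full R' ni nz); rewrite mem_gen // !inE eqxx ?orbT.
have hS : SL_group 2 'F_3 \homg H by rewrite [gval _]DS DH; apply: hom; rewrite -DH.
have iS : SL_group 2 'F_3 \isog H by rewrite isogEcard hS oH [#|_|]card_SL_2_3.
by rewrite isog_sym in iS.
Qed.

Definition rel_Oct (gT : finGroupType) (x y z : gT) :=
  [/\ x ^+ 8 = 1 /\ y ^+ 2 = x ^+ 4, z ^+ 3 = 1, y * x * y^-1 = x^-1,
      x * z * x^-1 = x ^+ 2 * y * z^-1 & z * x ^+ 2 * z^-1 = y].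

Lemma rel_Oct_pair (gT rT : finGroupType) (a b c : gT) (a' b' c' : rT) :
  rel_Oct a b c -> rel_Oct a' b' c' -> rel_Oct (a, a') (b, b') (c, c').
Proof.
case=> [[r0 r1] r2 r3 r4 r5] [[r0' r1'] r2' r3' r4' r5']; split; rewrite ?expg_pair.
- by rewrite r0 r0' r1 r1'.
- by rewrite r2 r2'.
- by rewrite -[LHS]/(b * a * b^-1, b' * a' * b'^-1) r3 r3'.
- by rewrite -[LHS]/(a * c * a^-1, a' * c' * a'^-1) r4 r4'.
by rewrite -[LHS]/(c * a ^+ 2 * c^-1, c' * a' ^+ 2 * c'^-1) r5 r5'.
Qed.

(** The triple [x ^+ 2], [y], [z^-1] satisfies [rel_SL23], so it generates at most 24 elements; [x]
    normalises this subgroup and has its square in it. *)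
Lemma rel_Oct_card (gT : finGroupType) (x y z : gT) : rel_Oct x y z ->
  #|<<[set x; y; z]>>| <= 48.
Proof.
case=> [[x8 y2] z3 yx xz zx].
pose i := x ^+ 2.
have xy : y ^ x^-1 = i * y.
  have E : x = y * x^-1 * y^-1 by apply: invg_inj; rewrite !invMg !invgK mulgA yx.
  have E' : y * x^-1 = x * y by rewrite {2}E mulgKV.
  by rewrite conjgE invgK E' mulgA.
have ix : i ^ x^-1 = i by apply/conjg_fixP/commgP/commuteV/commute_sym/commuteX.
have ij : i ^ y = i^-1.
  have : x^-1 ^ y = x by rewrite -yx conjgE !mulgA mulVg mul1g mulgKV.
  by move=> E; rewrite conjXg -[x]invgK conjVg E expgVn.
have iz : i ^ z^-1 = y by rewrite conjgE invgK mulgA.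
have yz : y ^ z^-1 = i * y.
  have zz : z^-1 * z^-1 = z.
    by apply: (mulgI z); rewrite mulKVg; apply/eqP; rewrite eq_invg_mul -[z * z]/(z ^+ 2) -expgS z3.
  (* The relation for [x * z * x^-1], inverted, writes [z] as a product of factors whose action on
     [i] is known one after the other. *)
  have zE : z = x * z^-1 * x^-1 * (i * y).
    have -> : x * z^-1 * x^-1 = z * (i * y)^-1.
      by apply: invg_inj; rewrite [RHS]invMg !invMg !invgK [LHS]mulgA xz.
    by rewrite mulgKV.
  rewrite -{1}iz -conjgM zz {1}zE (conjgM _ _ (i * y)) (conjgM _ _ x^-1) (conjgM _ x).
  have -> : i ^ x = i by rewrite -{1}ix conjgKV.
  by rewrite iz xy conjgE mulKg.
have R : rel_SL23 i y z^-1.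
  split=> //.
  - by rewrite -expgM.
  - by rewrite y2 -expgM.
  - by rewrite expgVn z3 invg1.
have [T8 nz'] := rel_SL23_norm R.
pose T := (<[i]> <*> <[y]>)%G; pose TZ := (T <*> <[z]>)%G.
have nz : z \in 'N(T) by rewrite -groupV.
have le1 : #|TZ| <= 24.
  have := mul_cycle_card (k := 3) nz; rewrite z3 group1 => /(_ isT isT)/leq_trans; apply.
  by rewrite (@leq_pmul2r 3 _ 8).
have iT : i \in T by rewrite mem_gen // inE cycle_id.
have yT : y \in T by rewrite mem_gen // inE cycle_id orbT.
have sT : T \subset TZ by apply: joing_subl.
have zT : z \in TZ by rewrite mem_gen // inE cycle_id orbT.
have nx : x \in 'N(TZ).
  rewrite -groupV inE conjYg conjYg -!cycleJ join_subG join_subG !cycle_subG ix xy.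
  have -> : z ^ x^-1 = i * y * z^-1 by rewrite conjgE invgK mulgA xz.
  have [iTZ yTZ] : i \in TZ /\ y \in TZ by split; apply: (subsetP sT).
  have kTZ : i * y \in TZ := groupM iTZ yTZ.
  by rewrite iTZ kTZ /=; apply: groupM; rewrite ?groupV.
have := mul_cycle_card (k := 2) nx; rewrite -/i (subsetP sT) // => /(_ isT isT) le2.
apply: leq_trans (leq_trans le2 (@leq_mul _ _ 24 2 le1 (leqnn 2))).
apply: subset_leq_card; rewrite gen_subG; apply/subsetP => u; rewrite !inE -orbA.
have sTZ : TZ \subset TZ <*> <[x]> := joing_subl _ _.
case/or3P=> /eqP->; [|by apply: (subsetP sTZ); apply: (subsetP sT)|exact: (subsetP sTZ)].
by apply: (subsetP (joing_subr _ _)); apply: cycle_id.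
Qed.

Lemma joing_cycle3 (gT : finGroupType) (x y z : gT) : <[x]> <*> <[y]> <*> <[z]> = <<[set x; y; z]>>.
Proof.
apply/eqP; rewrite eqEsubset !join_subG !cycle_subG !subUset !sub1set.
rewrite !mem_gen ?inE ?eqxx ?orbT //=.
- by rewrite cycle_id orbT.
- by rewrite mem_gen // inE cycle_id orbT.
by rewrite mem_gen // inE cycle_id.
Qed.

Lemma rel_Oct_GL (gT : finGroupType) (H : {group gT}) (x y z : gT) : rel_Oct x y z ->
  H :=: <<[set x; y; z]>> -> #|H| = 48 -> is_GLtilde23 H.
Proof.
move=> R DH oH; apply: intro_isoGrp.
  apply/existsP; exists (x, y, z) => /=.
  case: R => [[x8 y2] z3 yx xz zx]; rewrite !xpair_eqE x8 z3 xz zx {1}y2 yx !eqxx !andbT.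
  by rewrite joing_cycle3 DH.
move=> rT K /existsP[[[x' y'] z']] /=; rewrite !xpair_eqE.
case/and5P=> /eqP DK /eqP x8 /eqP y2 /eqP z3 /and3P[/eqP yx /eqP xz /eqP zx].
rewrite -DK joing_cycle3 DH; apply: (triple_homg rel_Oct_pair rel_Oct_card R); last by rewrite -DH.
by split.
Qed.

Lemma expg3_conj_rel (gT : finGroupType) (k a y i : gT) : a * k = y * a -> a * y = i * a ->
  (k * a) ^+ 3 = k * y * i * a ^+ 3.
Proof.
move=> ak ay; rewrite !expgS expg0 !mulg1 -!mulgA (mulgA a k) ak -!mulgA (mulgA a k) ak.
by rewrite -!mulgA (mulgA a y) ay -!mulgA.
Qed.

(** A Sylow 2-subgroup has order 16 and one involution, so it is generalised quaternion and gives
    [x] of order 8 with square in [T]. All relations but the one for [x * z * x^-1] come from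
    ['Q_16] and the action of [z] on [T]. *)
Lemma rel_Oct_exists (gT : finGroupType) (H T : {group gT}) : T <| H -> T \isog 'Q_8 ->
  'C_H(T) \subset T -> #|H| = 48 -> {in H &, forall a b, #[a] = 2 -> #[b] = 2 -> a = b} ->
  exists x y z, rel_Oct x y z /\ H :=: <<[set x; y; z]>>.
Proof.
move=> nsT iT cT oH uinv; have [sTH nTH] := andP nsT.
have d3H : 3 %| #|H| by rewrite oH.
have [z Hz oz] := Cauchy (isT : prime 3) d3H.
have z3 : z ^+ 3 = 1 by rewrite -[3]oz expg_order.
have [x0 [y0 [oT [Tx0 Ty0] [ox0 oy0] [nxy0 xy0 _ DT0] [_ DZ _]]]] := quaternion_gens iT.
have nzT : z \notin 'C(T).
  apply/negP => cz; have : z \in T by apply: (subsetP cT); rewrite inE Hz.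
  by move/order_dvdG; rewrite oT oz.
have nz := subsetP nTH z Hz.
have nabT : ~~ abelian T.
  apply/negP => cTT; have := xy0; rewrite (conjgE x0 y0) (centsP cTT x0 Tx0 y0 Ty0) mulKg.
  by move/esym/eqP; rewrite eq_invg_mul -(expgS x0 1) -order_dvdn ox0.
have pT : 2.-group T by rewrite /pgroup oT.
have [S sylS sTS] := Sylow_superset sTH pT; have [sSH pS _] := and3P sylS.
have oS : #|S| = 16.
  by rewrite (card_Hall sylS) oH p_part; have -> : logn 2 48 = 4 by [].
have ntS : S :!=: 1 by rewrite -cardG_gt1 oS.
have uS : {in S &, forall a b, #[a] = 2 -> #[b] = 2 -> a = b}.
  by move=> a b Sa Sb; apply: uinv; apply: (subsetP sSH).
case: (uniq_involution_pgroup pS ntS uS) => [cyc|[n n_gt2 iS]].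
  by case/negP: nabT; apply: abelianS sTS (cyclic_abelian cyc).
have Dn : n = 4.
  apply/eqP; rewrite -(@eqn_exp2l 2) // -[X in _ == X]/16 -oS (card_isog iS) card_quaternion //.
rewrite {n n_gt2}Dn in iS.
have [[x y1] genS _] := generators_quaternion (n := 4) isT iS.
have [[_ _ invS] _ _ _ _] := quaternion_structure (n := 4) isT genS iS.
case: genS => _ Sx ox _; rewrite /= in ox.
have nsTS : T <| S by apply: normalS sTS sSH nsT.
have Tx2 : x ^+ 2 \in T.
  rewrite coset_idr ?groupX ?(subsetP (normal_norm nsTS)) // morphX ?(subsetP (normal_norm nsTS)) //.
  have o2 : #|S / T| = 2 by rewrite card_quotient ?normal_norm // -divgS // oS oT.
  by apply/eqP; rewrite -order_dvdn -o2 order_dvdG // mem_quotient.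
have ox2 : #[x ^+ 2] = 4 by rewrite orderXdiv ox.
have nz' : z^-1 \in 'N(T) by rewrite groupV.
have z3' : z^-1 ^+ 3 = 1 by rewrite expgVn z3 invg1.
have nzT' : z^-1 \notin 'C(T) by rewrite groupV.
(* Passing from [x] to its inverse fixes the sign left open by [Q8_order3_rel]. *)
have [x1 [Sx1 ox1 Tx1 Dx1 kz]] : exists x1, [/\ x1 \in S, #[x1] = 8, x1 ^+ 2 \in T, <[x1]> = <[x]> &
    ((x1 ^+ 2) ^ z^-1) ^ z^-1 = x1 ^+ 2 * (x1 ^+ 2) ^ z^-1].
  have [Tj ij j2 DT [jz|jz]] := Q8_order3_rel iT nz' z3' nzT' Tx2 ox2; first by exists x.
  exists x^-1; rewrite groupV orderV cycleV expgVn groupV; split=> //.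
  rewrite !conjVg jz invMg invgK; apply: (canRL (mulgK ((x ^+ 2) ^ z^-1))); rewrite -mulgA -conjgE.
  exact: ij.
have ox12 : #[x1 ^+ 2] = 4 by rewrite orderXdiv ox1.
pose i := x1 ^+ 2; pose y := i ^ z^-1.
have [Tj ij j2 DT _] := Q8_order3_rel iT nz' z3' nzT' Tx1 ox12.
rewrite -/i in Tx1 ox12 kz Tj ij j2 DT *; rewrite -/y in kz Tj ij j2 DT *.
have nyx : y \notin <[x1]>.
  apply: contra nabT => yx; apply: abelianS (cycle_abelian x1).
  by rewrite -DT mul_subG ?cycle_subG ?mem_cycle.
have xy : x1 ^ y = x1^-1.
  apply: invS; first by rewrite -Dx1 cycle_id.
  by rewrite inE -Dx1 nyx (subsetP sTS).
have xy' : y * x1 * y^-1 = x1^-1.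
  have E : x1^-1 ^ y = x1 by rewrite conjVg xy invgK.
  have : x1 ^ y^-1 = x1^-1 by rewrite -{1}E conjgK.
  by rewrite conjgE invgK mulgA.
have yx : y ^ x1^-1 = i * y.
  by rewrite conjgE invgK -xy conjgE mulKVg mulgA.
have Hx1 := subsetP sSH _ Sx1.
have yz : y ^ z = i by rewrite /y conjgKV.
have iy : i * y = y * i^-1 by rewrite -ij conjgE mulKVg.
have yi : y * i = i^-1 * y by apply: (mulgI i); rewrite mulKVg mulgA iy mulgKV.
have iz : i ^ z = i * y.
  by apply: (conjg_inj z^-1); rewrite conjgK conjMg kz -/y iy mulgA -(expgS y 1) j2 expgS expg1 mulgK.
have ix : i ^ x1 = i by apply/conjg_fixP/commgP/commute_sym/commuteX.
have ixV : i ^ x1^-1 = i by rewrite -{1}ix conjgK.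
have yx1 : y ^ x1 = i^-1 * y by apply: (mulgI i); rewrite mulKVg -{1}ix -conjMg -yx conjgKV.
have ik : i ^ (i * y) = i^-1 by rewrite (conjgM i i y) (conjgE i i) mulKg ij.
(* The two sides of the missing relation act alike on [T], so [w = u^-1 * v] lies in ['Z(T)] and has
   square 1. Both have cube 1 and [w] commutes with [u], hence [w = 1]. *)
pose u := x1 * z * x1^-1; pose v := i * y * z^-1.
have uV t : t ^ u^-1 = ((t ^ x1) ^ z^-1) ^ x1^-1 by rewrite /u !invMg invgK -!conjgM mulgA.
have vV t : t ^ v^-1 = (t ^ z) ^ (i * y)^-1 by rewrite /v invMg invgK -conjgM.
have Eu1 : i ^ u^-1 = i ^ v^-1 by rewrite uV vV ix -/y yx iz conjgE invgK mulgV mulg1.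
have Eu2 : y ^ u^-1 = y ^ v^-1.
  have e1 : (i^-1 * y) ^ z^-1 = y^-1 * (i * y) by rewrite (conjMg i^-1 y) (conjVg i) kz.
  have e2 : (y^-1 * (i * y)) ^ x1^-1 = (i * y)^-1 * (i * (i * y)).
    by rewrite (conjMg y^-1 (i * y)) (conjVg y) (conjMg i y) yx ixV.
  rewrite uV vV yx1 yz e1 e2 -conjgE ik; apply: (conjg_inj (i * y)).
  by rewrite conjgKV (conjVg i) ik invgK.
have Hy := subsetP sTH _ Tj; have Hi := subsetP sTH _ Tx1.
have Hu : u \in H by rewrite !groupM ?groupV.
have Hv : v \in H by rewrite !groupM ?groupV.
pose w := u^-1 * v.
have cw t : t ^ u^-1 = t ^ v^-1 -> w \in 'C[t].
  move=> E; apply/cent1P/commute_sym/commgP/conjg_fixP.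
  by rewrite /w conjgM E conjgKV.
have cTw : w \in 'C(T).
  by rewrite -DT centM !cent_cycle inE !cw.
have Tw : w \in T by apply: (subsetP cT); rewrite inE cTw groupM ?groupV.
have u3 : u ^+ 3 = 1.
  by have -> : u = z ^ x1^-1 by [rewrite conjgE invgK mulgA]; rewrite -conjXg z3 conj1g.
have v3 : v ^+ 3 = 1.
  have zk : z^-1 * (i * y) = y * z^-1.
    apply: (mulIg z); rewrite mulgKV -mulgA -conjgE conjMg iz yz.
    by rewrite -mulgA yi mulKVg.
  have zy : z^-1 * y = i * z^-1 by apply: (mulIg z); rewrite mulgKV -mulgA -conjgE yz.
  by rewrite (expg3_conj_rel zk zy) z3' mulg1 -(mulgA i) -(expgS y 1) j2 -!expgS -expgSr -[4]ox12 expg_order.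
have w2 : w ^+ 2 = 1.
  have : w \in 'Z(T) by rewrite inE Tw.
  have x04 : x0 ^+ 2 ^+ 2 = 1 by rewrite -expgM -[(2 * 2)%N]ox0 expg_order.
  by rewrite DZ => /cycleP[k ->]; rewrite -[LHS]expgM mulnC (expgM _ 2) x04 expg1n.
have w1 : w = 1.
  have [//|nw] := eqVneq w 1.
  have ow : #[w] = 2 by apply: nt_prime_order.
  have Hw : w \in H by rewrite groupM ?groupV.
  have wu : commute u w.
    by apply/commute_sym/commgP/conjg_fixP; apply: uinv; rewrite ?groupJ ?orderJ.
  have : (u * w) ^+ 3 = 1 by rewrite /w mulKVg.
  by rewrite expgMn // u3 mul1g expgS w2 mulg1.
have uv : u = v by apply/eqP; rewrite eq_mulVg1 -/w w1.
have R : rel_Oct x1 y z.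
  split=> //.
  - by rewrite j2 -expgM -[8]ox1 expg_order.
  - by rewrite -mulgA /y conjgE invgK.
exists x1, y, z; split=> //; apply/esym/eqP; rewrite eqEcard gen_subG; apply/andP; split.
  by apply/subsetP => t; rewrite !inE -orbA => /or3P[]/eqP->.
pose K := <<[set x1; y; z]>>%G; pose L := (<[x1]> <*> <[y]>)%G.
have sLS : L \subset S by rewrite join_subG !cycle_subG Sx1 (subsetP sTS).
have sLK : L \subset K by rewrite join_subG !cycle_subG !mem_gen // !inE eqxx ?orbT.
have d16 : 16 %| #|L|.
  have lt : #|<[x1]>| < #|L|.
    apply: proper_card; rewrite properE joing_subl; apply: contra nyx => /subsetP; apply.
    by rewrite mem_gen // inE cycle_id orbT.
  have := cardSg sLS; rewrite oS -[16]/(2 ^ 4)%N => /(dvdn_pfactor _ _ (isT : prime 2))[k _ Dk].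
  by move: lt; rewrite Dk -orderE ox1 -[8]/(2 ^ 3)%N ltn_exp2l // => k3; rewrite dvdn_exp2l.
rewrite oH dvdn_leq // (@Gauss_dvd 16 3) // (dvdn_trans d16 (cardSg sLK)) /=.
by rewrite -oz order_dvdG // mem_gen // !inE eqxx orbT.
Qed.

Lemma GLtilde23_order48 (gT : finGroupType) (H T : {group gT}) : T <| H -> T \isog 'Q_8 ->
  'C_H(T) \subset T -> #|H| = 48 -> {in H &, forall a b, #[a] = 2 -> #[b] = 2 -> a = b} ->
  is_GLtilde23 H.
Proof.
move=> nsT iT cT oH uinv; have [x [y [z [R DH]]]] := rel_Oct_exists nsT iT cT oH uinv.
exact: rel_Oct_GL R DH oH.
Qed.

(** Numbering [S] turns the action into permutations of ordinals, the points on which ['Alt_('I_4)]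
    acts; [s0] serves [enum_rank_in]. *)
Lemma act_perm_exists (aT : finGroupType) (rT : finType) (X : {group aT}) (S : {set rT})
    (to : {action aT &-> rT}) (s0 : rT) : [acts X, on S | to] -> s0 \in S ->
  exists f : {morphism X >-> {perm 'I_#|S|}}, 'ker f = 'C_X(S | to).
Proof.
move=> actS Ss0.
pose h x (i : 'I_#|S|) := if x \in X then enum_rank_in Ss0 (to (enum_val i) x) else i.
have mem x (i : 'I_#|S|) : x \in X -> to (enum_val i) x \in S.
  by move=> Xx; rewrite (actsP actS) // enum_valP.
have hK x (i : 'I_#|S|) : x \in X -> enum_val (h x i) = to (enum_val i) x.
  by move=> Xx; rewrite /h Xx enum_rankK_in // mem.
have inj x : injective (h x).
  move=> i j; have [Xx E|nXx] := boolP (x \in X); last by rewrite /h (negPf nXx).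
  by apply/enum_val_inj/(act_inj to x); rewrite -!hK // E.
pose f x := perm (@inj x).
have fM : {in X &, {morph f : x y / x * y}}.
  move=> x y Xx Xy; apply/permP => i; rewrite permM !permE.
  by apply: enum_val_inj; rewrite !hK ?groupM // actM.
exists (Morphism fM); apply/setP => x; apply/idP/setIP => [kx|[Xx /astabP fix_s]].
  have Xx : x \in X := dom_ker kx; have fx1 : f x = 1 := mker kx.
  split=> //; apply/astabP => s Ss.
  have := hK x (enum_rank_in Ss0 s) Xx; rewrite enum_rankK_in // => <-.
  have /permP/(_ (enum_rank_in Ss0 s)) := fx1; rewrite permE perm1 => ->.
  by rewrite enum_rankK_in.
apply/(kerP _ Xx)/permP => i; rewrite permE perm1; apply: enum_val_inj.
by rewrite hK // fix_s // enum_valP.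
Qed.

Lemma card_act_faithful (aT : finGroupType) (rT : finType) (X : {group aT}) (S : {set rT})
    (to : {action aT &-> rT}) (s0 : rT) : [acts X, on S | to] -> s0 \in S ->
  #|X : 'C_X(S | to)| %| #|S|`!.
Proof.
move=> actS Ss0; have [f Df] := act_perm_exists actS Ss0.
have := card_morphim f X; rewrite setIid Df => <-.
by have := cardSg (subsetT (f @* X)); rewrite cardsT card_Sn.
Qed.

(** * Groups with a self-centralising normal four-group *)

Section Klein.
Variables (gT : finGroupType) (X V : {group gT}).
Hypotheses (nsV : V <| X) (abV : 2.-abelem V) (oV : #|V| = 4) (cV : 'C_X(V) = V).
Hypothesis d3 : 3 %| #|X : V|.

Let sVX : V \subset X := normal_sub nsV.

(** [X / V] acts faithfully on the three nonidentity elements of [V], so its order divides 6. *)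
Lemma klein_card : #|X| = 12 \/ #|X| = 24.
Proof.
have [v Vv ntv] : exists2 v, v \in V & v != 1.
  by apply/trivgPn; rewrite trivg_card1 oV.
have act1 : [acts X, on V^# | 'J] by rewrite astabsJ normD1 normal_norm.
have V1v : v \in V^# by rewrite !inE ntv.
have := card_act_faithful act1 V1v.
have -> : 'C_X(V^# | 'J) = V.
  rewrite astabJ -[RHS]cV; congr (_ :&: _).
  apply/eqP; rewrite eqEsubset [X in _ && X]centS ?subsetDl // andbT.
  apply/subsetP => c /centP cc; apply/centP => w Vw.
  by have [->|nw] := eqVneq w 1; [apply: commute1 | apply: cc; rewrite !inE nw].
have -> : #|V^#| = 3 by have := cardsD1 1 V; rewrite group1 oV add1n => [[<-]].
rewrite -(Lagrange sVX) oV; case/dvdnP: d3 => k ->.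
rewrite -[X in _ %| X]/(2 * 3)%N (@dvdn_pmul2r 3 k 2) //.
by case: k => [|[|[|k]]] // _; [left|right].
Qed.

(** The number of Sylow 3-subgroups divides 8 and is 1 modulo 3. If [P] were normal, [[~: P, V]]
    would lie in [P :&: V = 1]. *)
Lemma klein_Syl3 (P : {group gT}) : 3.-Sylow(X) P -> 'C_V(P) = 1 /\ #|'Syl_3(X)| = 4.
Proof.
move=> sylP; have [sPX pP _] := and3P sylP.
have oP : #|P| = 3 by rewrite (card_Hall sylP); case: klein_card => ->; rewrite p_part.
have nVP : P \subset 'N(V) := subset_trans sPX (normal_norm nsV).
have ncVP : ~~ (P \subset 'C(V)).
  apply/negP => cPV; have : P \subset V by rewrite -cV subsetI sPX.
  by move/cardSg; rewrite oP oV.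
have cVP : 'C_V(P) = 1.
  have := conj_fix_mod pP nVP; rewrite oV => fixm.
  have : #|'C_V(P)| %| (2 ^ 2)%N by rewrite -[(2 ^ 2)%N]oV cardSg ?subsetIl.
  case/(dvdn_pfactor _ _ (isT : prime 2)) => [[|[|[|k]]]] // _ oC.
  - by apply/card1_trivg.
  - by rewrite oC in fixm.
  case/negP: ncVP; rewrite centsC; apply/setIidPl/eqP.
  by rewrite eqEcard subsetIl oV oC.
split=> //; rewrite (card_Syl sylP).
have dvd : #|X : 'N_X(P)| %| #|X : P| by apply: indexgS; rewrite subsetI sPX normG.
have {dvd} : #|X : 'N_X(P)| %| (2 ^ 3)%N.
  apply: dvdn_trans dvd _; rewrite -divgS // oP.
  by case: klein_card => ->.
have := card_Syl_mod X (isT : prime 3); rewrite (card_Syl sylP) => md.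
case/(dvdn_pfactor _ _ (isT : prime 2)) => [[|[|[|[|k]]]]] // _ ox; rewrite ?ox // in md *.
case/negP: ncVP; have nPX : X \subset 'N(P).
  have /eqP := ox; rewrite indexg_eq1 => sXN.
  by apply: subset_trans sXN (subsetIr _ _).
have : [~: P, V] \subset P :&: V.
  by rewrite commg_subI // subsetI subxx ?(subset_trans sVX).
rewrite coprime_TIg ?oP ?oV // => /trivgP/eqP; by rewrite -(sameP commG1P eqP).
Qed.

(* [X] acts faithfully on its four Sylow 3-subgroups. *)
Lemma klein_Alt_Sym : X \isog 'Alt_('I_4) \/ X \isog 'Sym_('I_4).
Proof.
have [P sylP] := Sylow_exists 3 X; have [cVP oSyl] := klein_Syl3 sylP.
have actS : [acts X, on 'Syl_3(X) | 'JG] := atrans_acts (Syl_trans 3 X).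
have SylP : P \in 'Syl_3(X) by rewrite inE.
have [f Df] := act_perm_exists actS SylP.
have [sPX pP _] := and3P sylP.
have nVP : P \subset 'N(V) := subset_trans sPX (normal_norm nsV).
have coVP : coprime #|V| #|P|.
  by rewrite (card_Hall sylP) oV; case: klein_card => ->; rewrite p_part.
(* Elements of [V] in the kernel normalise [P], hence centralise it and are trivial; so the kernel
   centralises [V], and lies in [V]. *)
have kf : 'ker f = 1.
  have nsK : 'ker f <| X := ker_normal f.
  have KV1 : 'ker f :&: V = 1.
    apply/trivgP; rewrite -cVP; apply/subsetP => v /setIP[kv Vv]; rewrite inE Vv.
    have nPv : v \in 'N(P).
      by move: kv; rewrite -[v \in _]/(v \in 'ker f) Df => /setIP[_ /astabP/(_ P SylP) E];
      apply/normP; have /(congr1 val) := E.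
    apply/centP => x Px; apply/commgP; rewrite -in_set1 -[[set 1]](coprime_TIg coVP) inE.
    apply/andP; split.
      by rewrite commgEl groupM ?groupV ?memJ_norm ?(subsetP nVP).
    by rewrite commgEr groupM // memJ_norm ?groupV.
  have : 'ker f \subset V.
    rewrite -cV subsetI normal_sub //=; apply/commG1P/trivgP; rewrite -KV1.
    apply: commg_subI; rewrite subsetI subxx /=.
      by apply: subset_trans (normal_sub nsK) (normal_norm nsV).
    exact: subset_trans sVX (normal_norm nsK).
  by move/setIidPl => <-.
move: f Df kf; rewrite oSyl => f Df kf.
have isoX : X \isog f @* X by apply/isogP; exists f; rewrite ?kf.
case: klein_card => oX; last first.
  right; rewrite (_ : 'Sym_('I_4) = f @* X) //.
  apply/esym/eqP; rewrite eqEcard subsetT card_Sym card_ord -(card_isog isoX) oX //.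
left; pose K := (f @* X)%G; have oK : #|K| = 12 by rewrite -(card_isog isoX).
have VX' : V \subset X^`(1).
  have sRV : [~: V, P] \subset V by rewrite commg_subl.
  have nRP : P \subset 'N([~: V, P]) by rewrite commg_normr.
  have := conj_fix_mod (A := [~: V, P]%G) pP nRP.
  have -> : 'C_[~: V, P](P) = 1.
    by apply/trivgP; rewrite -cVP setSI.
  rewrite cards1 => md.
  have : #|[~: V, P]| %| (2 ^ 2)%N by rewrite -[(2 ^ 2)%N]oV cardSg.
  case/(dvdn_pfactor _ _ (isT : prime 2)) => [[|[|[|k]]]] // _ oR.
  - have /commG1P cVP' := card1_trivg oR.
    by have := card1_trivg oR; have /setIidPl := cVP'; rewrite cVP => V1; move: oV; rewrite -V1 cards1.
  - by have := md; rewrite /= oR.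
  have <- : [~: V, P] = V by apply/eqP; rewrite eqEcard sRV oR oV.
  exact: commgSS.
(* [V = [~: V, P]] lies in the derived subgroup of [X], whose image is even. In order 12, index 2
   over ['Alt_('I_4)] would then require 8 to divide 12. *)
have d4 : 4 %| #|K :&: 'Alt_('I_4)|.
  have oW : #|f @* V| = 4 by rewrite card_injm ?oV //; rewrite kf.
  rewrite -{1}oW; apply: cardSg; rewrite subsetI morphimS //=.
  apply: subset_trans (morphimS f VX') _; rewrite morphim_der //.
  apply: subset_trans (dergS 1 (subsetT _)) _; apply: der1_min.
    by have /andP[] := Alt_normal 'I_4.
  apply: cyclic_abelian; apply: prime_cyclic; rewrite card_quotient; last by have /andP[] := Alt_normal 'I_4.
  by rewrite [#|_ : _|]Alt_index ?card_ord.
have sKA : K \subset 'Alt_('I_4).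
  have nA : K \subset 'N('Alt_('I_4)) by apply: subset_trans (subsetT _) _; have /andP[] := Alt_normal 'I_4.
  have q2 : #|K / 'Alt_('I_4)| %| 2.
    have o2 : #|'Sym_('I_4) / 'Alt_('I_4)| = 2.
      rewrite card_quotient; last by have /andP[] := Alt_normal 'I_4.
      by rewrite [#|_ : _|]Alt_index ?card_ord.
    by have := cardSg (quotientS 'Alt_('I_4) (subsetT K)); rewrite [#|setT / _|]o2.
  have := LagrangeI K 'Alt_('I_4); rewrite oK.
  have : #|K : 'Alt_('I_4)| %| 2 by rewrite -{1}(setIidPl nA) -card_quotient_subnorm.
  case/dvdnP: d4 => k ->; have [/eqP|] := eqVneq #|K : 'Alt_('I_4)| 1%N; first by rewrite indexg_eq1.
  case: #|_ : _| => [|[|[|j]]] // _ _; rewrite -mulnA mulnC => /eqP; rewrite -[12]/(4 * 3)%N.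
  by clear; lia.
have E : f @* X = 'Alt_('I_4).
  apply/eqP; rewrite eqEcard [X in X && _]sKA /= [#|f @* X|]oK.
  have := card_Alt (T := 'I_4); rewrite card_ord => /(_ isT) c; by rewrite -(@leq_pmul2l 2) // c.
by rewrite -E.
Qed.
End Klein.

(** * The case of degree 9 *)

Definition sq1 (gT : finGroupType) (A : {set gT}) : {set gT} := [set a in A | a ^+ 2 == 1].

(** Counts pairs (a, b) with [(a * b) ^+ 2 = 1] in two ways: each [t] in [T] has two factorisations,
    and [a ^+ 2] and [b ^+ 2] must be both 1 or both [z]. *)
Lemma cprod_count (gT : finGroupType) (T A B : {group gT}) (z : gT) :
  A \* B = T -> A :&: B = <[z]> -> #[z] = 2 ->
  {in A, forall a, a ^+ 2 \in <[z]>} -> {in B, forall b, b ^+ 2 \in <[z]>} ->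
  (2 * #|sq1 T| = #|sq1 A| * #|sq1 B| + (#|A| - #|sq1 A|) * (#|B| - #|sq1 B|))%N.
Proof.
move=> /cprodP[_ DT cAB] DI oz sqA sqB.
pose P := [set u in setX A B | u.1 * u.2 \in sq1 T].
have zP c : c \in <[z]> -> c = 1 \/ c = z.
  by case/cyclePmin=> k; rewrite oz; case: k => [|[|k]] // _ ->; [left|right; rewrite expg1].
have nz : z != 1 by rewrite -order_eq1 oz.
have z2 : z * z = 1 by rewrite -[z * z]/(z ^+ 2) -[2]oz expg_order.
have PE : P = setX (sq1 A) (sq1 B) :|: setX (A :\: sq1 A) (B :\: sq1 B).
  apply/setP => -[a b]; rewrite !inE /=; have [Aa|] := boolP (a \in A); last by rewrite ?andbF.
  have [Bb|] := boolP (b \in B); last by rewrite ?andbF.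
  have -> : a * b \in T by rewrite -DT mem_mulg.
  rewrite /= !andbT expgMn; last by apply/commute_sym/(centsP cAB).
  by case: (zP _ (sqA a Aa)) => ->; case: (zP _ (sqB b Bb)) => ->; rewrite ?mulg1 ?mul1g ?z2 ?eqxx ?(negPf nz).
have -> : (#|sq1 A| * #|sq1 B| + (#|A| - #|sq1 A|) * (#|B| - #|sq1 B|) = #|P|)%N.
  rewrite PE cardsU !cardsX !cardsD.
  have sub (C : {group gT}) : C :&: sq1 C = sq1 C by apply/setIidPr/subsetP => c; rewrite inE => /andP[].
  rewrite !sub (_ : _ :&: _ = set0) ?cards0 ?subn0 //.
  by apply/setP => -[a b]; rewrite !inE /=; case: (a \in A); case: (a ^+ 2 == 1); rewrite ?andbF.
rewrite mulnC -sum_nat_const -[#|P|]sum1_card.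
rewrite (partition_big (fun u => u.1 * u.2) (mem (sq1 T))) /=; last by move=> u; rewrite !inE => /andP[].
apply: eq_bigr => t St; apply/esym; rewrite sum1dep_card.
have Tt : t \in T by move: St; rewrite inE => /andP[].
have /mulsgP[a0 b0 Aa0 Bb0 Dt] : t \in A * B by rewrite DT.
rewrite -oz orderE -[RHS](card_imset (f := fun w => (a0 * w, w^-1 * b0))); last by move=> u v [/mulgI].
apply: eq_card => -[a b]; rewrite !inE /=;
  apply/idP/imsetP => [/andP[/andP[/andP[Aa Bb] _] /eqP E]|[w zw [-> ->]]].
  exists (a0^-1 * a); last by rewrite mulKVg invMg invgK -mulgA -Dt -E mulKg.
  rewrite -DI inE groupM ?groupV //=.
  have -> : a0^-1 * a = b0 * b^-1 by apply: (mulIg b); rewrite mulgKV -mulgA E Dt mulKg.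
  by rewrite groupM ?groupV.
move: zw; rewrite -DI => /setIP[Aw Bw].
have -> : a0 * w * (w^-1 * b0) = t by rewrite -mulgA mulKVg.
by rewrite !groupM ?groupV //= eqxx Tt andbT /=; move: St; rewrite inE => /andP[_ ->].
Qed.

Lemma sq1_Q8 (gT : finGroupType) (A : {group gT}) : A \isog 'Q_8 -> #|sq1 A| = 2.
Proof.
move=> iA; have [x [y [oA [Ax Ay] [ox oy] _ [inv _ _]]]] := quaternion_gens iA.
have -> : sq1 A = [set 1; x ^+ 2].
  apply/setP => a; rewrite !inE; apply/andP/orP => [[Aa /eqP a2]|[]/eqP->].
  - have [->|na] := eqVneq a 1; [by left|right].
    by apply/eqP/inv => //; apply: nt_prime_order.
  - by rewrite group1 expg1n.
  by rewrite groupX // -expgM -[(2 * 2)%N]ox expg_order.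
by rewrite cards2 eq_sym -order_dvdn ox.
Qed.

Lemma sq1_D8 (gT : finGroupType) (A : {group gT}) : A \isog 'D_8 -> #|sq1 A| = 6.
Proof.
move=> iA; have [[x y] genA _] := generators_2dihedral (n := 3) isT iA.
have [[_ oX _] _ _ _ _] := dihedral2_structure (n := 3) isT genA iA.
case: genA => oA Ax ox /setDP[Ay nxy]; rewrite /= in ox oA.
have nx2 : x ^+ 2 != 1 by rewrite -order_dvdn ox.
have -> : sq1 A = (A :\: <[x]>) :|: [set 1; x ^+ 2].
  apply/setP => a; rewrite !inE; have [ax|nax] := boolP (a \in <[x]>) => /=.
    have Aa : a \in A by apply: subsetP ax; rewrite cycle_subG.
    rewrite Aa; case: (cycle4P ox ax) => ->.
    - by rewrite expg1n !eqxx.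
    - rewrite (negPf nx2) -[x == x ^+ 2](inj_eq (mulgI x^-1)) -order_eq1 ox mulKg.
      by rewrite mulVg [1 == x]eq_sym -order_eq1 ox.
    - by rewrite -expgM -[(2 * 2)%N]ox expg_order !eqxx orbT.
    rewrite expgVn !eq_invg1 (negPf nx2) -order_eq1 ox eq_invg_mul -expgS.
    by rewrite -order_dvdn ox.
  have [Aa|nAa] := boolP (a \in A); last first.
    by rewrite /=; apply/esym/norP; split; apply: contra nax => /eqP->; rewrite ?group1 ?mem_cycle.
  by rewrite -order_dvdn oX // inE nax.
rewrite cardsU cardsD (setIidPr _) ?cycle_subG // -orderE ox oA cards2 eq_sym nx2.
rewrite (_ : _ :&: _ = set0) ?cards0 //.
apply/setP => a; rewrite !inE; apply/negP => /andP[/andP[na _] /orP[]/eqP E]; rewrite E in na.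
  by rewrite group1 in na.
by rewrite mem_cycle in na.
Qed.

Section CaseV.
Variables (hT : finGroupType) (H T : {group hT}) (x : hT).
Local Notation Z := 'Z(T).
Hypotheses (solH : solvable H) (DT : T :=: 'O_2(H)).
Hypotheses (esT : extraspecial T) (oT : #|T| = 32) (cT : 'C_H(T) = Z).
Hypotheses (Hx : x \in H) (ox : #[x] = 5) (cTx : 'C_T[x] = Z).
Hypothesis inv6 : forall s w, s \in T -> s \notin Z -> s ^+ 2 = 1 -> w \in H -> s ^ w = s -> w ^+ 6 \in T.

Let nsTH : T <| H. Proof. by rewrite DT pcore_normal. Qed.
Let sTH : T \subset H := normal_sub nsTH.
Let pT : 2.-group T. Proof. by rewrite DT; apply: pcore_pgroup. Qed.
Let oZ : #|Z| = 2 := card_center_extraspecial pT esT.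
Let sZT : Z \subset T := center_sub _.
Let nsZH : Z <| H := char_normal_trans (center_char _) nsTH.
Let nZH : H \subset 'N(Z) := normal_norm nsZH.
Let nTH : H \subset 'N(T) := normal_norm nsTH.
Let nZT : T \subset 'N(Z) := subset_trans sTH nZH.

Lemma caseV_sq t : t \in T -> t ^+ 2 \in Z.
Proof.
move=> Tt; have [[<- _] _] := esT.
have : t ^+ (2 ^ 1) \in 'Mho^1(T) := Mho_p_elt 1 Tt (mem_p_elt pT Tt).
by rewrite (Phi_joing pT); apply: (subsetP (joing_subr _ _)).
Qed.

Lemma caseV_quo_comm : abelian (T / Z).
Proof.
by apply/sub_der1_abelian; have [[_ ->] _] := esT.
Qed.

Lemma caseV_gen : exists2 z, Z = <[z]> & #[z] = 2.
Proof.
have [//|z Zz oz] := Cauchy (isT : prime 2) (_ : 2 %| #|Z|); first by rewrite oZ.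
by exists z => //; apply/eqP; rewrite eq_sym eqEcard cycle_subG Zz -orderE oz oZ.
Qed.

Lemma caseV_norm_sq1 : H \subset 'N(sq1 T).
Proof.
apply/normsP => h Hh; apply/setP => t; rewrite mem_conjg !inE -conjXg conjg_eq1.
by rewrite memJ_norm // groupV (subsetP nTH).
Qed.

Lemma caseV_sub_sq1 : Z \subset sq1 T.
Proof.
apply/subsetP => t Zt; rewrite inE (subsetP sZT) //=.
by rewrite -order_dvdn -oZ order_dvdG.
Qed.

Lemma caseV_count_mod : #|sq1 T| = 2 %[mod 5].
Proof.
have act : [acts <[x]>, on sq1 T | 'J].
  by rewrite astabsJ (subset_trans _ caseV_norm_sq1) // cycle_subG.
have p5 : 5.-group <[x]> by rewrite /pgroup -orderE ox.
rewrite (pgroup_fix_mod p5 act) afixJ cent_cycle.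
rewrite (_ : _ :&: _ = Z) ?oZ //; apply/setP => t; apply/setIP/idP => [[] | Zt].
  by rewrite inE -cTx => /andP[Tt _] cx; rewrite inE Tt.
split; first exact: (subsetP caseV_sub_sq1).
by move: Zt; rewrite -cTx => /setIP[].
Qed.

(** [T] is a central product of two extraspecial groups of order 8. Two of the same type give 20
    elements of square 1, different types give 12; only 12 is 2 modulo 5. *)
Lemma caseV_decomp : is_extraspecial_Q8_D8 T /\ #|sq1 T| = 12.
Proof.
have [t Tt nt] : exists2 t, t \in T & t \notin Z.
  by apply/subsetPn; apply/negP => /subset_leq_card; rewrite oZ oT.
have TZt : t \in T :\: Z by rewrite inE nt.
have [A [B [[oA oB] [DAB DI] [ZA ZB] [esA tA] esB]]] := split1_extraspecial pT esT TZt.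
have [z DZ oz] := caseV_gen.
have oA8 : #|A| = 8 by rewrite oA.
have oB8 : #|B| = 8 by rewrite oB oT.
have {}esB : extraspecial B.
  move: esB; case: ifP => // _ E; move: oB8; rewrite E oZ //.
have DI' : A :&: B = <[z]> by rewrite DI ZA.
have [sAT sBT] : A \subset T /\ B \subset T.
  by have [_ <- _] := cprodP DAB; rewrite mulG_subl mulG_subr.
have sqA : {in A, forall a, a ^+ 2 \in <[z]>} by move=> a Aa; rewrite -DZ caseV_sq // (subsetP sAT).
have sqB : {in B, forall a, a ^+ 2 \in <[z]>} by move=> a Aa; rewrite -DZ caseV_sq // (subsetP sBT).
have := cprod_count DAB DI' oz sqA sqB; rewrite oA8 oB8.
have md := caseV_count_mod.
have ext (Q D : {group hT}) : Q \isog 'Q_8 -> D \isog 'D_8 -> Q \* D = T -> is_extraspecial_Q8_D8 T.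
  by move=> iQ iD E; split=> //; exists Q, D.
case/orP: (card_isog8_extraspecial oA8 esA) => iA; case/orP: (card_isog8_extraspecial oB8 esB) => iB;
  rewrite ?(sq1_Q8 iA) ?(sq1_D8 iA) ?(sq1_Q8 iB) ?(sq1_D8 iB) => E.
- have E20 : #|sq1 T| = 20 by apply: double_inj; rewrite -mul2n E.
  by rewrite E20 in md.
- split; last by apply: double_inj; rewrite -mul2n E.
  by apply: (ext B A) => //; rewrite cprodC.
- split; last by apply: double_inj; rewrite -mul2n E.
  exact: (ext A B).
have E20 : #|sq1 T| = 20 by apply: double_inj; rewrite -mul2n E.
by rewrite E20 in md.
Qed.

Lemma caseV_Fitting : 'F(H) = T.
Proof.
rewrite DT; apply: Fitting_eq_pcore; set K := 'O_2^'(H).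
have nsK : K <| H := pcore_normal _ _.
have oK : 2^'.-group K := pcore_pgroup _ _.
have TI : K :&: T = 1 by rewrite setIC coprime_TIg // (pnat_coprime pT).
have : K \subset 'C_H(T).
  rewrite subsetI normal_sub //=; apply/commG1P/trivgP; rewrite -TI commg_subI //.
    by rewrite subsetI subxx (subset_trans (normal_sub nsK)).
  by rewrite subsetI subxx (subset_trans sTH) ?normal_norm.
rewrite cT => /subset_trans/(_ sZT)/setIidPl; by rewrite TI.
Qed.

Local Notation Tq := (T / Z).
Local Notation Hq := (H / Z).
Local Notation xq := (coset Z x).

(** An element [c] of odd prime order in the preimage satisfies [[~: T, <[c]>] \subset Z], so by
    coprime action it centralises [T] and lies in [Z], a 2-group. The preimage is thus a normal
    2-subgroup, contained in [T]. *)
Lemma caseV_cent_quo : 'C_Hq(Tq) = Tq.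
Proof.
apply/eqP; rewrite eqEsubset subsetI quotientS //= [X in _ && X]caseV_quo_comm andbT.
pose C := (coset Z @*^-1 'C_Hq(Tq) :&: H)%G.
have nsC : C <| H.
  rewrite /normal subsetIr normsI ?normG // (subset_trans _ (morphpre_norm _ _)) //.
  rewrite -sub_morphim_pre // normsI ?normG // norms_cent // quotient_norms //.
have DC : C / Z = 'C_Hq(Tq).
  rewrite quotientGI ?cosetpreK //; last by rewrite sub_cosetpre.
  by apply/setIidPl; rewrite subsetIl.
have cCT : [~: T, C] \subset Z.
  rewrite -quotient_cents2 //; last by rewrite (subset_trans (subsetIr _ _)).
  by rewrite DC centsC subsetIr.
have pC : 2.-group C.
  apply/pgroupP => q pr_q dq; apply: contraT => nq.
  have [c Cc oc] := Cauchy pr_q dq.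
  have Hc : c \in H by case/setIP: Cc.
  have nTc : <[c]> \subset 'N(T) by rewrite cycle_subG (subsetP nTH).
  have co : coprime #|T| #|<[c]>|.
    rewrite -orderE oc oT (@coprime_pexpl 5 2) // prime_coprime // dvdn_prime2 // eq_sym.
    by apply: contra nq => /eqP->.
  have E := coprime_commGid nTc co (pgroup_sol pT).
  have : c \in Z.
    rewrite -cT inE Hc; rewrite -cycle_subG centsC; apply/commG1P; rewrite -E.
    apply/commG1P; rewrite centsC cycle_subG; apply/centP => v.
    have sub : [~: T, <[c]>] \subset Z by rewrite (subset_trans _ cCT) // commgS // cycle_subG.
    move=> /(subsetP sub) Zv; have [z DZ oz] := caseV_gen.
    have Zvc : v ^ c \in Z by rewrite memJ_norm // (subsetP nZH).
    have zP u : u \in Z -> u = 1 \/ u = z.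
      rewrite DZ => /cyclePmin[k]; rewrite oz; case: k => [|[|k]] // _ ->; first by left.
      by right; rewrite expg1.
    apply/esym/commgP/conjg_fixP; case: (zP v Zv) => Dv; first by rewrite Dv conj1g.
    case: (zP _ Zvc) => // E1; last by rewrite E1.
    by rewrite -[v](conjgK c) E1 !conj1g.
  by move/order_dvdG; rewrite oc oZ dvdn_prime2 // => /eqP E2; rewrite E2 in nq.
rewrite -DC quotientS // DT; exact: pcore_max.
Qed.

Lemma caseV_cent_xq : 'C_Tq[xq] = 1.
Proof.
rewrite -cent_cycle -quotient_cycle ?(subsetP nZH) //.
rewrite -coprime_quotient_cent //; last exact: (pgroup_sol pT).
- by rewrite cent_cycle cTx trivg_quotient.
- by rewrite cycle_subG (subsetP nZH).
by rewrite oT -orderE ox.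
Qed.

Lemma caseV_card_Tq : #|Tq| = 16.
Proof. by rewrite card_quotient // -divgS // oT oZ. Qed.

(** [x] fixes only 1 in [T / Z], so [|A|] is 1 modulo 5; among the divisors of 16 these are 1 and
    16. *)
Lemma caseV_irr (A : {group coset_of Z}) : A \subset Tq -> xq \in 'N(A) -> A :!=: 1 -> A :=: Tq.
Proof.
move=> sA nA ntA; have o5 : 5.-group <[xq]>.
  have : 5.-elt x by rewrite /p_elt ox.
  by rewrite /pgroup -orderE => /(morph_p_elt (coset_morphism Z)); apply; apply: (subsetP nZH).
have := @conj_fix_mod _ A <[xq]>%G 5 o5; rewrite cycle_subG => /(_ nA).
have -> : 'C_A(<[xq]>) = 1.
  by apply/trivgP; rewrite /= cent_cycle -caseV_cent_xq setSI.
rewrite cards1 => E; apply/eqP; rewrite eqEcard sA caseV_card_Tq.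
have : #|A| %| 2 ^ 4 by rewrite -[(2 ^ 4)%N]caseV_card_Tq cardSg.
case/(dvdn_pfactor _ _ (isT : prime 2)) => i; case: i => [|[|[|[|[|]]]]] // _ EA; rewrite EA // in E *.
by rewrite trivg_card1 EA in ntA.
Qed.

Local Notation S := (sq1 T :\: Z).

Lemma caseV_card_S : #|S| = 10.
Proof.
by rewrite cardsD (setIidPr caseV_sub_sq1) oZ; have [_ ->] := caseV_decomp.
Qed.

Lemma caseV_norm_S : H \subset 'N(S).
Proof. by rewrite normsD ?caseV_norm_sq1. Qed.

Local Notation Sq := (coset Z @: S).

Lemma caseV_mem_S s : reflect [/\ s \in T, s \notin Z & s ^+ 2 = 1] (s \in S).
Proof.
rewrite in_setD [s \in sq1 _]inE andbCA.
by apply: (iffP and3P) => -[Ts ns /eqP s2]; split=> //; apply/eqP.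
Qed.

Lemma caseV_S_coset s z : s \in S -> z \in Z -> s * z \in S.
Proof.
move=> /caseV_mem_S[Ts ns s2] Zz; apply/caseV_mem_S.
have cz : commute s z by case/centerP: Zz => Tz /(_ s Ts) /commute_sym.
have Tz := subsetP sZT z Zz; rewrite expgMn // s2 mul1g; split; first exact: groupM.
  by apply: contra ns => Zsz; rewrite -(mulgK z s); apply: groupM; rewrite ?groupV.
by apply/eqP; rewrite -order_dvdn -oZ order_dvdG.
Qed.

Lemma caseV_S_T : S \subset T.
Proof. by apply/subsetP => s; rewrite !inE => /and3P[]. Qed.

Lemma caseV_card_Sq : #|Sq| = 5.
Proof.
apply: double_inj; rewrite -muln2 -[RHS]caseV_card_S -sum_nat_const -[RHS]sum1_card.
rewrite [RHS](partition_big (coset Z) (mem Sq)) /=; last by move=> s Ss; apply: imset_f.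
apply: eq_bigr => _ /imsetP[s Ss ->]; rewrite sum1dep_card -oZ -(card_lcoset Z s).
apply: eq_card => t; have Ts := subsetP caseV_S_T s Ss.
have Ns := subsetP nZT s Ts; rewrite [RHS]inE; apply/lcosetP/andP => [[z Zz ->]|[St /eqP E]].
  by rewrite caseV_S_coset // coset_kerr.
exists (s^-1 * t); last by rewrite mulKVg.
have Nt := subsetP nZT t (subsetP caseV_S_T t St).
by rewrite coset_idr ?groupM ?groupV // morphM ?groupV // morphV //= E mulVg.
Qed.

Lemma caseV_Sq_gen : <<Sq>> = Tq.
Proof.
have sST : Sq \subset Tq.
  by apply/subsetP => _ /imsetP[s Ss ->]; rewrite mem_quotient // (subsetP caseV_S_T).
apply: caseV_irr; first by rewrite gen_subG.
  apply: (subsetP (norm_gen _)); rewrite inE.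

  apply/subsetP => _ /imsetP[_ /imsetP[s Ss ->] ->].
  have Ns := subsetP nZT s (subsetP caseV_S_T s Ss); have Nx := subsetP nZH x Hx.
  by rewrite -morphJ //= imset_f // memJ_norm // (subsetP caseV_norm_S).
apply/trivgPn; have /card_gt0P[s Ss] : 0 < #|S| by rewrite caseV_card_S.
exists (coset Z s); first by rewrite mem_gen // imset_f.
have Ns := subsetP nZT s (subsetP caseV_S_T s Ss).
by have [_ nZs _] := caseV_mem_S s Ss; apply: contra nZs => /eqP/coset_idr; apply.
Qed.

Local Notation Y := (H / T).
Local Notation xb := (coset T x).

Lemma caseV_card_Y : #|Y| %| 120.
Proof.
have [s0 Ss0] : exists s, s \in Sq by apply/set0Pn; rewrite -card_gt0 caseV_card_Sq.
have act : [acts Hq, on Sq | 'J].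
  rewrite astabsJ; apply/subsetP => _ /morphimP[h Nh Hh ->].
  rewrite inE; apply/subsetP => _ /imsetP[_ /imsetP[s Ss ->] ->].
  have Ns := subsetP nZT s (subsetP caseV_S_T s Ss).
  by rewrite -morphJ //= imset_f // memJ_norm // (subsetP caseV_norm_S).
have := card_act_faithful act Ss0; rewrite caseV_card_Sq astabJ -cent_gen caseV_Sq_gen caseV_cent_quo.
rewrite -[5`!]/120%N -card_quotient ?quotient_norms //.
by rewrite (card_isog (third_isog sZT nsZH nsTH)).
Qed.

Lemma caseV_order_xb : #[xb] = 5.
Proof.
have Nx := subsetP nTH x Hx.
apply: nt_prime_order => //; first by rewrite -morphX // -ox expg_order morph1.
apply/eqP => E; have : x \in T by apply: coset_idr E.
by move/order_dvdG; rewrite ox oT.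
Qed.

Lemma caseV_pcore2 : 'O_2(Y) = 1.
Proof. by rewrite DT; apply: trivg_pcore_quotient. Qed.

(** An element [y] of 3-power order above ['O_3(Y)] fixes one of the 10 elements of [S], as 10 is 1
    modulo 3. Since ['O_3(Y)], of order at most 3, is centralised by [xb], the fixed points of [y]
    on [T / Z] are stable under [x]; they are everything, and [y] is in [T]. *)
Lemma caseV_pcore3 : 'O_3(Y) = 1.
Proof.
have Nx := subsetP nTH x Hx; have Yx : xb \in Y by rewrite mem_quotient.
have p3 : 3.-group 'O_3(Y) := pcore_pgroup _ _.
have oK : #|'O_3(Y)| <= 3.
  have := partn_dvd 3 (isT : 0 < 120) (dvdn_trans (cardSg (pcore_sub 3 Y)) caseV_card_Y).
  by rewrite part_pnat_id // p_part; apply: dvdn_leq.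
have p5 : 5.-group <[xb]> by rewrite /pgroup -orderE caseV_order_xb.
have nK : <[xb]> \subset 'N('O_3(Y)).
  by rewrite cycle_subG (subsetP (normal_norm (pcore_normal 3 Y))).
have E5 := conj_fix_mod p5 nK.
have cK : 'O_3(Y) \subset 'C(<[xb]>).
  apply/setIidPl/eqP; rewrite eqEcard subsetIl /=.
  rewrite !modn_small in E5; first by rewrite E5.
  - by apply: leq_ltn_trans (subset_leq_card (subsetIl _ _)) _; apply: leq_trans (_ : 4 <= 5).
  exact: leq_trans (_ : 4 <= 5).
apply/trivgP/subsetP => k Kk; rewrite inE.
have /morphimP[y0 Ny0 Hy0 Dk] : k \in Y := subsetP (pcore_sub _ _) k Kk.
pose y := y0.`_3.
have Hy : y \in H by rewrite /y /constt groupX.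
have Ny : y \in 'N(T) := subsetP nTH y Hy.
have Ey : coset T y = k.
  by rewrite /y morph_constt // -[coset_morphism T y0]/(coset T y0) -Dk constt_p_elt // (mem_p_elt p3).
have p3y : 3.-group <[y]> by rewrite /pgroup -orderE; apply: p_elt_constt.
have actS : [acts <[y]>, on S | 'J].
  by rewrite astabsJ cycle_subG (subsetP caseV_norm_S).
have [s Ss cs] : exists2 s, s \in S & s \in 'C(<[y]>).
  have := pgroup_fix_mod p3y actS; rewrite caseV_card_S afixJ => E.
  have /set0Pn[s /setIP[Ss cs]] : S :&: 'C(<[y]>) != set0.
    by rewrite -card_gt0 lt0n; apply/eqP => E0; rewrite E0 in E.
  by exists s.
have [Ts ns _] := caseV_mem_S s Ss.
have Ns := subsetP nZT s Ts; have NZx := subsetP nZH x Hx; have NZy := subsetP nZH y Hy.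
have rT : [~ x, y] \in T.
  apply: coset_idr; first by rewrite groupR.
  rewrite morphR //= [coset T y]Ey; apply/eqP/commgP/commute_sym.
  by move: (subsetP cK k Kk); rewrite cent_cycle => /cent1P.
have cyy : 'C_Tq[coset Z y] = Tq.
  apply: (caseV_irr (A := 'C_Tq[coset Z y])); first exact: subsetIl.
    rewrite inE; apply/subsetP => _ /imsetP[a /setIP[Ta /cent1P ca] ->].
    have nTqx : xq \in 'N(Tq) by rewrite (subsetP (quotient_norms _ nTH)) // mem_quotient.
    have Tax : a ^ xq \in Tq by rewrite memJ_norm.
    rewrite inE Tax /=; apply/cent1P/commgP/conjg_fixP.
    rewrite -conjgM commgC conjgM conjgM; have -> : a ^ coset Z y = a.
      by apply/conjg_fixP/commgP/commute_sym.
    apply/conjg_fixP/commgP; apply: (centsP caseV_quo_comm) => //.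
    by rewrite -morphR // mem_quotient.
  apply/trivgPn; exists (coset Z s).
    rewrite inE mem_quotient //=; apply/cent1P.
    rewrite /commute -!morphM //; congr (coset Z _); apply/esym.
    by move: cs; rewrite cent_cycle => /cent1P.
  by apply: contra ns => /eqP E; apply: coset_idr E.
have : coset Z y \in Tq.
  by rewrite -caseV_cent_quo inE mem_quotient //= -sub_cent1 -{1}cyy subsetIr.
rewrite -cycle_subG -quotient_cycle // quotientSGK ?cycle_subG // => Ty.
by rewrite -Ey coset_id.
Qed.

Lemma caseV_FY : 'F(Y) = <[xb]>.
Proof.
have Yx : xb \in Y by rewrite mem_quotient.
have hall (q : nat) : q.-Hall('F(Y)) 'O_q(Y).
  by rewrite -(p_core_Fitting q Y) nilpotent_pcore_Hall // Fitting_nil.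
have oF : #|'F(Y)| %| 120 := dvdn_trans (cardSg (Fitting_sub Y)) caseV_card_Y.
have p5F : 5.-group 'F(Y).
  apply/pgroupP => q pr_q dq; have : q \in primes 120.
    by rewrite mem_primes pr_q (dvdn_trans dq).
  have nq r : prime r -> 'O_r(Y) = 1 -> q != r.
    move=> pr_r E; apply: contraL dq => /eqP->.
    have := card_Hall (hall r); rewrite /= E cards1 => /esym/eqP; rewrite partn_eq1 // => pr'.
    by rewrite (p'natEpi _) // in pr' *; apply: contra pr' => dr; rewrite mem_primes pr_r cardG_gt0.
  rewrite (_ : primes 120 = [:: 2; 3; 5]) // !inE.
  by rewrite (negPf (nq 2 isT caseV_pcore2)) (negPf (nq 3 isT caseV_pcore3)).
have oF5 : #|'F(Y)| %| 5.
  by have := partn_dvd 5 (isT : 0 < 120) oF; rewrite part_pnat_id // p_part.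
have solY : solvable Y := quotient_sol T solH.
have ntF : 'F(Y) != 1.
  rewrite trivg_Fitting //; apply: contraTneq Yx => ->; rewrite inE -order_eq1.
  by rewrite caseV_order_xb.
have F5 : #|'F(Y)| = 5.
  case/primeP: (isT : prime 5) => _ /(_ _ oF5) /orP[/eqP E|/eqP //].
  by rewrite trivg_card1 E in ntF.
have hallF : 5.-Hall(Y) 'F(Y).
  rewrite pHallE Fitting_sub F5 eqn_dvd -{1}F5 -{1}(part_pnat_id p5F).
  rewrite partn_dvd ?cardSg ?Fitting_sub //=.
  by have := partn_dvd 5 (isT : 0 < 120) caseV_card_Y; rewrite [partn 120 5]p_part.
apply/esym/eqP; rewrite eqEcard -orderE caseV_order_xb F5 leqnn andbT cycle_subG.
by rewrite (mem_normal_Hall hallF (Fitting_normal Y) Yx) /p_elt caseV_order_xb.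
Qed.

(** Conjugation by [w] raises [xb] to a power [k] with [k ^ 6 = 1] modulo 5, which forces [k] to be
    1 or -1. *)
Lemma caseV_conj_xb w : w \in H -> w ^+ 6 \in T -> xb ^ coset T w = xb \/ xb ^ coset T w = xb^-1.
Proof.
move=> Hw w6; have Nw := subsetP nTH w Hw; have ox' := caseV_order_xb.
have y6 : coset T w ^+ 6 = 1 by rewrite -morphX //= coset_id.
have /cyclePmin[k lt_k Dk] : xb ^ coset T w \in <[xb]>.
  rewrite -caseV_FY memJ_norm; first by rewrite caseV_FY cycle_id.
  by rewrite (subsetP (normal_norm (Fitting_normal Y))) // mem_quotient.
have it n : xb ^ (coset T w ^+ n) = xb ^+ (k ^ n).
  by elim: n => [|n IHn]; rewrite ?conjg1 // expgSr conjgM IHn conjXg Dk -expgM expnS.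
have := it 6; rewrite y6 conjg1 => /eqP; rewrite -[X in X == _]expg1 eq_expg_mod_order ox'.
rewrite ox' in lt_k; case: k lt_k Dk {it} => [|[|[|[|[|]]]]] // _ Dk _.
  by left; rewrite Dk expg1.
by right; rewrite Dk; apply: (mulgI xb); rewrite mulgV -expgS -[5]ox' expg_order.
Qed.

Lemma caseV_cent_xb w : w \in H -> w ^+ 6 \in T -> xb ^ coset T w = xb -> w \in T.
Proof.
move=> Hw w6 E; have Nw := subsetP nTH w Hw.
have : coset T w \in 'F(Y).
  apply: (subsetP (sub_cent_Fitting (quotient_sol T solH))).
  rewrite inE mem_quotient //= caseV_FY cent_cycle; apply/cent1P/commute_sym/commgP/conjg_fixP.
  exact: E.
rewrite caseV_FY => /order_dvdG; rewrite -orderE caseV_order_xb order_dvdn => /eqP y5.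
apply: coset_idr => //; move: w6; rewrite -[6]/(5 + 1)%N expgD => /coset_id.
by rewrite morphM ?groupX // !morphX // -[coset_morphism T w]/(coset T w) y5 mul1g.
Qed.

(* The centraliser in [H] of a noncentral involution [s] of [T] has index at
   most 10, and meets [T] in 16 elements; by [inv6] its elements centralise or
   invert [x] modulo [T]. *)
Lemma caseV_card_Y10 : #|Y| <= 10.
Proof.
have /card_gt0P[s Ss] : 0 < #|S| by rewrite caseV_card_S.
have [Ts ns s2] := caseV_mem_S s Ss; have Hs := subsetP sTH s Ts.
have w6 w : w \in 'C_H[s] -> w ^+ 6 \in T.
  move=> /setIP[Hw /cent1P cw]; apply: (inv6 Ts ns s2 Hw).
  by apply/conjg_fixP/commgP/commute_sym.
have oC : #|'C_H[s]| <= 2 * #|'C_T[s]|.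
  have [sub|/subsetPn[w Cw nTw]] := boolP ('C_H[s] \subset 'C_T[s]).
    by apply: leq_trans (subset_leq_card sub) _; rewrite leq_pmull.
  have [Hw cw] := setIP Cw.
  have inv u : u \in 'C_H[s] -> u \notin T -> xb ^ coset T u = xb^-1.
    move=> Cu nu; have Hu : u \in H by case/setIP: Cu.
    have [E|//] := caseV_conj_xb Hu (w6 u Cu).
    by rewrite (caseV_cent_xb Hu (w6 u Cu) E) in nu.
  have nw : w \notin T by apply: contra nTw => Tw; rewrite inE Tw.
  have sub : 'C_H[s] \subset 'C_T[s] :|: 'C_T[s] :* w.
    apply/subsetP => u Cu; have [Hu cu] := setIP Cu; rewrite inE.
    have [Tu|nu] := boolP (u \in T); first by rewrite inE Tu cu.
    apply/orP; right; rewrite mem_rcoset.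
    have Cuw : u * w^-1 \in 'C_H[s] by apply: groupM; rewrite ?groupV.
    have [Huw cuw] := setIP Cuw; rewrite inE cuw andbT.
    have Nu := subsetP nTH u Hu; have Nw := subsetP nTH w Hw.
    apply: (caseV_cent_xb Huw (w6 _ Cuw)).
    rewrite morphM ?groupV // conjgM (inv u) // morphV //.
    apply: (conjg_inj (coset T w)); rewrite conjgKV (inv w) //.
  apply: leq_trans (subset_leq_card sub) _.
  by rewrite (leq_trans (leq_card_setU _ _)) // card_rcoset addnn mul2n.
have oCT : #|'C_T[s]| <= 16.
  have /properP[sub _] : 'C_T[s] \proper T.
    rewrite properE subsetIl; apply: contra ns => /subset_trans/(_ (subsetIr _ _)) cs.
    by rewrite inE Ts -sub_cent1.
  have := cardSg (subsetIl T 'C[s]); rewrite oT -[32]/(2 ^ 5)%N.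
  case/(dvdn_pfactor _ _ (isT : prime 2)) => i le_i E; rewrite E.
  have: i != 5.
    apply: contra ns => /eqP Ei; rewrite inE Ts -sub_cent1 /=; apply/setIidPl/eqP.
    by rewrite eqEcard subsetIl /= oT E Ei.
  move=> ni; apply: leq_trans (_ : 2 ^ 4 <= _)%N => //; rewrite leq_exp2l //.
  by rewrite -ltnS ltn_neqAle ni.
have oH : #|H| <= 320.
  rewrite -(Lagrange (subsetIl H 'C[s])) index_cent1 -[320]/((2 * 16) * 10)%N leq_mul //.
    by apply: leq_trans oC _; rewrite leq_mul2l.
  rewrite -caseV_card_S subset_leq_card //; apply/subsetP => _ /imsetP[h Hh ->].
  by rewrite memJ_norm // (subsetP caseV_norm_S).
by rewrite card_quotient // -divgS // oT leq_divLR // -[32]oT cardSg.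
Qed.

Lemma caseV_structure : [/\ is_extraspecial_Q8_D8 'F(H), #|Fitting2 H / 'F(H)| = 5%N
  & exists2 C : {group 'Z_2}, C \subset Zp 2 & H / Fitting2 H \isog C].
Proof.
have [E8 _] := caseV_decomp.
have F5 : #|'F(H / 'F(H))| = 5 by rewrite caseV_Fitting caseV_FY -orderE caseV_order_xb.
have E5 : Fitting2 H / 'F(H) = 'F(H / 'F(H)) by rewrite /Fitting2 cosetpreK.
split; first by rewrite /= (_ : 'F(H)%G = T) //; apply/val_inj/caseV_Fitting.
  by rewrite E5.
have sF2 : Fitting2 H \subset H.
  by rewrite sub_cosetpre_quo ?Fitting_normal ?Fitting_sub.
have nsF2 : Fitting2 H <| H.
  by rewrite -[X in _ <| X](quotientGK (Fitting_normal H)) cosetpre_normal Fitting_normal.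
have sFF2 : 'F(H) \subset Fitting2 H by apply: sub_cosetpre.
have o2 : #|H / Fitting2 H| <= 2.
  rewrite -(card_isog (third_isog sFF2 (Fitting_normal H) nsF2)) E5.
  rewrite card_quotient ?normal_norm ?Fitting_normal // -divgS ?Fitting_sub // F5.
  have d5 : 5 %| #|H / 'F(H)| by rewrite -F5 cardSg ?Fitting_sub.
  rewrite leq_divLR //; have := caseV_card_Y10; rewrite -caseV_Fitting; exact: id.
have : 0 < #|H / Fitting2 H| := cardG_gt0 _.
case E: #|H / Fitting2 H| o2 => [|[|[|]]] // _ _.
  exists 1%G; first exact: sub1G.
  by rewrite isog_cyclic_card ?E ?cards1 ?cyclic1 // (card1_trivg E) cyclic1.
exists (Zp_group 2) => //; rewrite isog_cyclic_card ?prime_cyclic ?E //.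
all: by rewrite /= ?card_Zp.
Qed.
End CaseV.

(** * Sixth powers of symplectic matrices commuting with an involution *)

Section SymplecticInvolution.
Local Open Scope ring_scope.

(** By Cayley-Hamilton, trace 0, 1 or -1 means [M ^+ 2 = -1], [M ^+ 3 = -1] or [M ^+ 3 = 1]. *)
Lemma expr6_det1 (M : 'M['F_3]_2) :
  M 0 0 * M 1 1 - M 0 1 * M 1 0 = 1 -> M ^+ 6 = 1 \/ M ^+ 6 = -1.
Proof.
move=> d1; have : M ^+ 2 = (M 0 0 + M 1 1) *: M - 1 by rewrite expr2 -mulmxE cayley2.
have t3 : forall t : 'F_3, [\/ t = 0, t = 1 | t = -1].
  by case=> -[|[|[|k]]] // lt_k; [constructor 1 | constructor 2 | constructor 3]; apply: val_inj.
case: (t3 (M 0 0 + M 1 1)) => -> M2.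
- right; rewrite (exprM M 2 3) M2 scale0r sub0r !exprS expr0 mulr1.
  by rewrite mulrNN mulr1 mulN1r.
- left; have M3 : M ^+ 3 = -1.
    by rewrite exprS M2 scale1r mulrBr mulr1 -expr2 M2 scale1r addrAC subrr sub0r.
  by rewrite (exprM M 3 2) M3 sqrrN expr1n.
left; have M3 : M ^+ 3 = 1.
  by rewrite exprS M2 scaleN1r mulrBr mulr1 mulrN -expr2 M2 scaleN1r opprD !opprK addrAC subrr add0r.
by rewrite (exprM M 3 2) M3 expr1n.
Qed.

Variables (J S W : 'M['F_3]_4).
Hypotheses (uJ : J \in unitmx) (skJ : J^T = - J) (SJ : S *m J *m S^T = J) (WJ : W *m J *m W^T = J).
Hypotheses (SS : S *m S = 1%:M) (SW : S *m W = W *m S).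
Hypotheses (rkp : \rank (1%:M + S)%R = 2%N) (rkm : \rank (1%:M - S)%R = 2%N).

(** The rows of [1 + e *: S] span the eigenspace of [S] for [e], stable under [W]. Where [J] is
    nondegenerate on it, the induced [M] preserves a skew form, so it has determinant 1. *)
Lemma eigen_basis (e : 'F_3) : e ^+ 2 = 1 -> \rank (1%:M + e *: S)%R = 2%N ->
  exists B : 'M['F_3]_(2, 4), [/\ (B :=: (1%:M + e *: S)%R)%MS, row_free B, B *m S = e *: B
    & exists2 M : 'M['F_3]_2, B *m W = M *m B &
       (B *m J *m B^T \in unitmx -> M ^+ 6 = 1 \/ M ^+ 6 = -1)].
Proof.
move=> e2 rk; set A := 1%:M + e *: S; rewrite -/A in rk.
have [B [eqB freeB]] : exists B : 'M['F_3]_(2, 4), (B :=: A)%MS /\ row_free B.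
  by move: (row_base A) (eq_row_base A) (row_base_free A); rewrite rk => B; exists B.
have AS : A *m S = e *: A.
  by rewrite mulmxDl mul1mx -scalemxAl SS scalerDr scalerA -expr2 e2 scale1r addrC.
have BS : B *m S = e *: B.
  have /submxP[D ->] : (B <= A)%MS by rewrite eqB.
  by rewrite -mulmxA AS -scalemxAr.
have BWsub : (B *m W <= B)%MS.
  rewrite eqB; apply/submxP; exists (2^-1 *: (B *m W)).
  rewrite mulmxDr mulmx1 -!scalemxAl -!scalemxAr -(mulmxA B) -SW (mulmxA B) BS -!scalemxAl.
  rewrite [e *: (e *: _)]scalerA -expr2 e2 scale1r -scalerDl.
  by rewrite [_ + _](_ : _ = 1) ?scale1r //; apply: val_inj.
exists B; split=> //; have [M DM] := submxP BWsub.
exists M => // uK; apply: expr6_det1.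
apply: (det1_of_form (J := B *m J *m B^T)) => //.
  by rewrite !trmx_mul trmxK skJ mulNmx mulmxN mulmxA.
have -> : M *m (B *m J *m B^T) *m M^T = (M *m B) *m J *m (M *m B)^T by rewrite trmx_mul !mulmxA.
by rewrite -DM trmx_mul -!mulmxA (mulmxA J) (mulmxA W) (mulmxA W) WJ !mulmxA.
Qed.

(* The eigenspaces of [S] are orthogonal nondegenerate planes stable under [W],
   and 6th powers in SL(2, 3) are scalars. *)
Lemma comm_involution_expr6 : [\/ W ^+ 6 = 1, W ^+ 6 = -1, W ^+ 6 = S | W ^+ 6 = - S].
Proof.
have [|//|B [eqB freeB BS [M BM M6]]] := @eigen_basis 1; rewrite ?expr1n ?scale1r //.
have [||C [eqC freeC CS [N CN N6]]] := @eigen_basis (-1); rewrite ?sqrrN ?expr1n ?scaleN1r //.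
rewrite scale1r in BS; rewrite scaleN1r in CS.
(* Eigenvectors of the isometry [S] for the eigenvalues 1 and -1 are orthogonal. *)
have BJC : B *m J *m C^T = 0.
  have : B *m J *m C^T = - (B *m J *m C^T).
    rewrite -{1}SJ !mulmxA BS -(mulmxA _ S^T) -trmx_mul CS.
    by rewrite linearN /= mulmxN.
  move/eqP; rewrite -subr_eq0 opprK -mulr2n -scaler_nat scaler_eq0 => /orP[|/eqP//].
  by [].
have CJB : C *m J *m B^T = 0.
  apply: trmx_inj; rewrite !trmx_mul trmxK skJ mulNmx mulmxN mulmxA BJC.
  by rewrite oppr0 trmx0.
pose P := col_mx B C.
have uP : P \in unitmx.
  rewrite -row_full_unit -sub1mx -addsmxE.
  have -> : (1%:M : 'M['F_3]_4) = 2^-1 *: (1%:M + S + (1%:M - S)).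
    by rewrite addrACA subrr addr0 -mulr2n -scaler_nat scalerA mulVf // scale1r.
  move/eqmxP: eqB => /andP[_ sB]; move/eqmxP: eqC => /andP[_ sC].
  rewrite scale1r in sB; rewrite scaleN1r in sC.
  exact: scalemx_sub (addmx_sub_adds sB sC).
have uPJ : P *m J *m P^T \in unitmx by rewrite !unitmx_mul uP uJ unitmx_tr uP.
have [uB uC] : B *m J *m B^T \in unitmx /\ C *m J *m C^T \in unitmx.
  apply/andP; move: uPJ; rewrite tr_col_mx mul_col_mx mul_col_row BJC CJB.
  by rewrite !unitmxE det_ublock unitrM.
have it (X : 'M_(2, 4)) Y : X *m W = Y *m X -> X *m W ^+ 6 = Y ^+ 6 *m X.
  move=> E; elim: 6%N => [|k IHk]; first by rewrite !expr0 mulmx1 mul1mx.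
  by rewrite exprSr -mulmxE mulmxA IHk -mulmxA E mulmxA exprSr -mulmxE.
have PW : P *m W ^+ 6 = col_mx (M ^+ 6 *m B) (N ^+ 6 *m C) by rewrite mul_col_mx !(it _ _ BM, it _ _ CN).
have canc X : P *m W ^+ 6 = P *m X -> W ^+ 6 = X by move/(can_inj (mulKmx uP)).
case: (M6 uB) => EM; case: (N6 uC) => EN; rewrite EM EN ?mulNmx ?mul1mx in PW.
- by constructor 1; apply: canc; rewrite PW mulmx1.
- by constructor 3; apply: canc; rewrite PW mul_col_mx BS CS.
- by constructor 4; apply: canc; rewrite PW mulmxN mul_col_mx BS CS opp_col_mx opprK.
by constructor 2; apply: canc; rewrite PW mulmxN mulmx1 opp_col_mx.
Qed.
End SymplecticInvolution.

Section CaseVRepr.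
Variables (hT : finGroupType) (H : {group hT}) (rH : mx_representation 'F_3 H 4) (J : 'M['F_3]_4).
Hypotheses (ffulH : mx_faithful rH).
Hypothesis transH : forall u v : 'rV['F_3]_4, u != 0%R -> v != 0%R -> exists2 h, h \in H & v = (u *m rH h)%R.
Hypotheses (uJ : J \in unitmx) (invJ : forall h, h \in H -> (rH h *m J *m (rH h)^T)%R = J) (skJ : (J^T = - J)%R).
Variable T : {group hT}.
Hypotheses (nsTH : T <| H) (pT : 2.-group T) (esT : extraspecial T).

(** A nontrivial commutator [z = [~ s, t]] acts as -1, so [t] exchanges the eigenspaces of [s],
    which are therefore planes. The possible values of [w ^+ 6] are then 1, [z], [s] and [s * z]. *)
Lemma extraspecial_inv6 s w : s \in T -> s \notin 'Z(T) -> s ^+ 2 = 1 -> w \in H -> s ^ w = s -> w ^+ 6 \in T.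
Proof.
move=> Ts ns s2 Hw sw; have sTH := normal_sub nsTH.
have oZ : #|'Z(T)| = 2 := card_center_extraspecial pT esT.
have sZT : 'Z(T) \subset T := center_sub _.
have [t Tt nst] : exists2 t, t \in T & [~ s, t] != 1.
  have /subsetPn[t Tt nt] : ~~ (T \subset 'C[s]).
    by apply: contra ns => sub; rewrite inE Ts -sub_cent1.
  by exists t => //; apply: contra nt => /commgP/commute_sym/cent1P.
set z := [~ s, t] in nst.
have Zz : z \in 'Z(T) by have [[_ <-] _] := esT; rewrite mem_commg.
have Tz := subsetP sZT z Zz.
have [Hs Ht Hz] := And3 (subsetP sTH s Ts) (subsetP sTH t Tt) (subsetP sTH z Tz).
have z2 : z ^+ 2 = 1 by apply/eqP; rewrite -order_dvdn -oZ order_dvdG.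
have rz : (rH z = -1)%R.
  have := trans_abelian_free (isT : prime 3) ffulH transH (A := 'Z(T)%G).
  move/(_ (char_normal_trans (center_char _) nsTH) (center_abelian _)).
  have -> : (3^').-group 'Z(T) by rewrite /pgroup oZ.
  move/(_ isT z Zz nst) => u1; apply/eqP; rewrite -subr_eq0 opprK.
  apply/eqP; apply: (can_inj (mulKmx u1)); rewrite mulmx0 mulmxBl mulmxDr mul1mx mulmx1 -repr_mxM //.
  by rewrite -[(z * z)%g]/(z ^+ 2) z2 repr_mx1; apply/eqP; rewrite subr_eq0 addrC.
have SS : (rH s *m rH s = 1%:M)%R by rewrite -repr_mxM // -[(s * s)%g]/(s ^+ 2) s2 repr_mx1.
have SW : (rH s *m rH w = rH w *m rH s)%R.
  by rewrite -!repr_mxM // -{2}sw -conjgC.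
have ct : (rH s *m rH t = - (rH t *m rH s))%R.
  rewrite -repr_mxM // [(s * t)%g]commgC -/z (repr_mxM rH (groupM Ht Hs) Hz) (repr_mxM rH Ht Hs).
  by rewrite rz mulmxN mulmx1.
have ut : rH t \in unitmx by apply: repr_mx_unit.
have rkE : \rank (1%:M + rH s)%R = \rank (1%:M - rH s)%R.
  have E : ((1%:M + rH s) *m rH t = rH t *m (1%:M - rH s))%R.
    by rewrite mulmxDl mulmxBr mul1mx mulmx1 ct.
  rewrite -(mxrankMfree _ (_ : row_free (rH t))) ?row_free_unit // E.
  by rewrite eqmxMfull // row_full_unit.
have rk4 : (\rank (1%:M + rH s)%R + \rank (1%:M - rH s)%R = 4)%N.
  apply/eqP; rewrite eqn_leq; apply/andP; split.
    apply: mulmx0_rank_max; rewrite mulmxBr mulmx1 mulmxDl mul1mx SS.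
    by apply/eqP; rewrite subr_eq0 addrC.
  apply: leq_trans (mxrank_add _ _); rewrite addrACA subrr addr0 -mulr2n -scaler_nat.
  by rewrite mxrank_scale_nz // mxrank1.
have rkp : \rank (1%:M + rH s)%R = 2 by apply: double_inj; rewrite -addnn {2}rkE.
have rkm : \rank (1%:M - rH s)%R = 2 by rewrite -rkE.
have w6 : rH (w ^+ 6) = (rH w ^+ 6)%R by rewrite -repr_mxX.
have H6 : w ^+ 6 \in H by rewrite groupX.
have := comm_involution_expr6 uJ skJ (invJ Hs) (invJ Hw) SS SW rkp rkm; rewrite -w6.
have inj a b : a \in H -> b \in H -> rH a = rH b -> a = b by apply: rH_inj.
case=> E.
- by rewrite (inj _ 1 H6 (group1 H)) ?group1 // repr_mx1.
- by rewrite (inj _ z H6 Hz) // rz.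
- by rewrite (inj _ s H6 Hs).
rewrite (inj _ (s * z)%g H6 (groupM Hs Hz)); first exact: groupM.
by rewrite E repr_mxM // rz mulmxN mulmx1.
Qed.
End CaseVRepr.

(** * Distribution of the five cases over p and n *)

Theorem theoremA (gT : finGroupType) (G : {group gT}) (chi alpha : 'CF(G))
    (m : nat) (E : {group gT})
    (solG : solvable G)
    (irr_chi : chi \in irr G) (faithful_chi : cfaithful chi)
    (irr_alpha : alpha \in irr G) (m_gt0 : (0 < m)%N)
    (chi_conj : (chi * chi^*%CF = 1 + m%:R *: alpha)%R)
    (chiefE : chief_factor G 'Z(G) E) :
  [/\ m = 1%N,
      (chi 1%g ^+ 2 = #|E : 'Z(G)|%:R)%R
    & (chi 1%g = 2%:R)%R /\
        (G / 'Z(G) \isog 'Alt_('I_4) \/ G / 'Z(G) \isog 'Sym_('I_4))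
   \/ (chi 1%g = 3%:R)%R /\ (G / E \isog 'Q_8 \/ G / E \isog SL 2 'F_3)
   \/ (chi 1%g = 5%:R)%R /\ G / E \isog SL 2 'F_3
   \/ (chi 1%g = 7%:R)%R /\ is_GLtilde23 (G / E)
   \/ [/\ (chi 1%g = 9%:R)%R,
          is_extraspecial_Q8_D8 'F(G / E),
          #|Fitting2 (G / E) / 'F(G / E)| = 5%N
        & exists2 C : {group 'Z_2}, C \subset Zp 2 &
            G / E / Fitting2 (G / E) \isog C]].
Proof.
have [m1 chi2 [p [n' [n [rH [J [pr_p DN chi1 ffulH [transH uJ invJ skewJ]]]]]]]] :=
  chief_symplectic_repr solG irr_chi faithful_chi irr_alpha m_gt0 chi_conj chiefE.
split=> //; have solH := quotient_sol E solG.
have [nsEG /proper_sub sZE sEG nsZE abV] := chief_facts solG chiefE.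
case: n => [|[|n]] in DN chi1.
- by rewrite double0 in DN.
- have Dn' : n' = 1%N by case: DN.
  subst n'; have [p2|p_odd] := boolP (p == 2); last first.
    have {}p_odd : odd p by case: (even_prime pr_p) p_odd => [->|].
    have nsT : 'O_2(G / E) <| G / E := pcore_normal _ _.
    right; case: (trans_symplectic_dim2 pr_p p_odd ffulH solH transH uJ invJ skewJ) => [[Dp i]|[Dp oH iT cT]|[Dp oH iT cT u]];
      rewrite Dp expn1 in chi1.
    + by left.
    + by right; left; split=> //; apply: (isog_SL23 nsT iT cT oH).
    right; right; left; split=> //; exact: (GLtilde23_order48 nsT iT cT oH u).
  move/eqP in p2; subst p; rewrite expn1 in chi1; left; split=> //.
  have nsV : E / 'Z(G) <| G / 'Z(G) := quotient_normal _ nsEG.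
  (* For [p ^ n = 2], [E / 'Z(G)] is a self-centralising four-group, and transitivity on its 3
     nonzero vectors makes [|G / E|] divisible by 3. *)
  apply: (klein_Alt_Sym nsV).
  + rewrite card_quotient ?normal_norm //; apply/eqP; rewrite -(eqr_nat algC) -chi2 chi1.
    by rewrite -natrX.
  + apply/eqP; rewrite eqEsubset [X in _ && X]subsetI quotientS //= [E / 'Z(G) \subset _]abV andbT.
    apply/subsetP => _ /setIP[/morphimP[g Ng Gg ->] cg].
    apply/mem_quotient.
    apply: (cent_quotient_chief irr_chi faithful_chi irr_alpha chi_conj solG chiefE Gg) => e Ee.
    have Ne : e \in 'N('Z(G)) by apply: subsetP Ee; rewrite normal_norm.
    apply: coset_idr; first by rewrite groupR.
    rewrite morphR //=; apply/eqP/commgP/commute_sym; apply: (centP cg); exact: mem_quotient.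
  have -> : #|G / 'Z(G) : E / 'Z(G)| = #|G / E|.
    by rewrite (card_isog (isog_symr (third_isog sZE (center_normal G) nsEG))) card_quotient ?normal_norm.
  exact: (trans_card pr_p transH).
have [exc|nexc] := boolP ((p == 2) && (n'.+1 == 6)).
  have [/eqP p2 /eqP E6] := andP exc; case: E6 => Dn'; subst p n'.
  by case: (trans_symplectic_dim6_char2 ffulH solH transH uJ invJ).
have [[Dp N4 esT oT cT] cTx] := trans_symplectic_dim_gt2 pr_p ffulH solH transH uJ invJ DN nexc isT.
have n0 : n = 0%N by move: DN; rewrite N4; case: (n).
case: N4 => Dn'; subst p n' n; do 4!right.
have o80 := trans_card pr_p transH.
have [x Hx ox] := Cauchy (isT : prime 5) (dvdn_trans (isT : 5 %| 3 ^ 4 - 1) o80).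
have inv6 := extraspecial_inv6 ffulH transH uJ invJ skewJ (pcore_normal _ _) (pcore_pgroup _ _) esT.
have [A B C] := caseV_structure solH (erefl : 'O_2(G / E)%G :=: 'O_2(G / E)) esT oT cT Hx ox (cTx x Hx ox) inv6.
by split.
Qed.
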